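(* Let $\mathbf{G}$ be the transfer function of a minimal strictly proper LTI plant and let $\mathbf{K}$ be a minimal $n$-th order dynamic controller that internally stabilizes $\mathbf{G}$, with at least one stable pole. Write $\mathbf{K}=\mathbf{K}_<+\mathbf{K}_\ge$, where $\mathbf{K}_<$ (order $n_1\ge1$) contains the poles of $\mathbf{K}$ in the open left-half plane and $\mathbf{K}_\ge$ (order $n_2=n-n_1$) contains those in the closed right-half plane. Let $\mathbf{K}_r=\mathbf{K}_{<,r}+\mathbf{K}_\ge$ be an $r$-th order controller, $r<n$, where $\mathbf{K}_{<,r}$ is the balanced truncation of $\mathbf{K}_<$ of order $n_r=r-n_2$, and let $\mathrm{diag}(\Sigma_{<,1},\Sigma_{<,2})$, with $\Sigma_{<,1}\in\mathbb{R}^{n_r\times n_r}$, be the corresponding partition of the balanced Gramian of $\mathbf{K}_<$. Suppose $\Sigma_{<,1}$ and $\Sigma_{<,2}$ share no eigenvalues, and $$\sigma_{n_r+1}+\cdots+\sigma_{n_1}<\frac{1}{2\,\|(I-\mathbf{G}\mathbf{K})^{-1}\mathbf{G}\|_{\mathcal{H}_\infty}},$$ where $\sigma_{n_r+1},\dots,\sigma_{n_1}$ are the diagonal elements of $\Sigma_{<,2}$. Then $\mathbf{K}_r$ internally stabilizes the plant, and the resulting LQG cost satisfies $$J(\mathbf{K}_r)\le\frac{1}{\left(1-\|\mathbf{X}\|_{\mathcal{H}_\infty}\|\mathbf{\Delta}\|_{\mathcal{H}_\infty}\right)^2}\,\bigl(J(\mathbf{K})+S_1+S_2\bigr),$$ where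 $\mathbf{Y}:=(I-\mathbf{G}\mathbf{K})^{-1}$, $\mathbf{X}:=(I-\mathbf{G}\mathbf{K})^{-1}\mathbf{G}$, $\mathbf{\Delta}:=\mathbf{K}_r-\mathbf{K}$, and $$S_1:=2\|\mathbf{\Delta}\|_{\mathcal{H}_\infty}\|\mathbf{X}\|_{\mathcal{H}_2}\|\mathbf{X}\mathbf{K}\|_{\mathcal{H}_2}+2\|\mathbf{\Delta}\|_{\mathcal{H}_2}\bigl(\|\mathbf{K}\mathbf{Y}\|_{\mathcal{H}_2}\|\mathbf{Y}\|_{\mathcal{H}_\infty}+\|\mathbf{K}\mathbf{X}\|_{\mathcal{H}_2}\|\mathbf{X}\|_{\mathcal{H}_\infty}\bigr)\bigl(1+\|\mathbf{K}\mathbf{X}\|_{\mathcal{H}_\infty}\bigr),$$ $$S_2:=\|\mathbf{\Delta}\|_{\mathcal{H}_\infty}^2\|\mathbf{X}\|_{\mathcal{H}_2}^2+\|\mathbf{\Delta}\|_{\mathcal{H}_2}^2\bigl(\|\mathbf{Y}\|_{\mathcal{H}_\infty}^2+\|\mathbf{X}\|_{\mathcal{H}_\infty}^2\bigr)\bigl(1+\|\mathbf{K}\mathbf{X}\|_{\mathcal{H}_\infty}\bigr)^2.$$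
   Context: Plant: $\dot x=Ax+Bu+Bw$, $y=Cx+v$, with real matrices, $x(t)\in\mathbb{R}^{n_x}$, $u(t),w(t)\in\mathbb{R}^m$, $y(t),v(t)\in\mathbb{R}^p$; the plant is minimal, i.e. $(A,B)$ is controllable and $(C,A)$ is observable. Its transfer function is $\mathbf{G}(s)=C(sI-A)^{-1}B$. The signals $w$ and $v$ are zero-mean Gaussian white noises, each with spectrum equal to the identity. Dynamic controller: $\dot\xi=A_K\xi+B_Ky$, $u=C_K\xi$, with real matrices; it is identified with the strictly proper real-rational transfer function $\mathbf{K}(s)=C_K(sI-A_K)^{-1}B_K$, represented by a minimal realization; its order is the dimension of $\xi$. Feedback sign convention: $\mathbf{u}=\mathbf{K}\mathbf{y}$. A controller $\mathbf{K}$ internally stabilizes $\mathbf{G}$ if the closed-loop matrix $\begin{bmatrix}A & BC_K\\ B_KC & A_K\end{bmatrix}$ has all eigenvalues in the open left-half plane; equivalently, if $(I-\mathbf{G}\mathbf{K})^{-1}\mathbf{G}$, $(I-\mathbf{G}\mathbf{K})^{-1}\mathbf{G}\mathbf{K}$, $\mathbf{K}(I-\mathbf{G}\mathbf{K})^{-1}\mathbf{G}$, $\mathbf{K}(I-\mathbf{G}\mathbf{K})^{-1}$ all belong to $\mathcal{RH}_\infty$, the set of real-rational proper transfer matrices with all poles in the open left-half plane (''stable''). For stable $\mathbf{F}$, $\|\mathbf{F}\|_{\mathcal{H}_\infty}=\sup_{\omega\in\mathbb{R}}\sigma_{\max}(\mathbf{F}(j\omega))$; for stable strictly proper $\mathbf{F}$,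 $\|\mathbf{F}\|_{\mathcal{H}_2}=\sqrt{\frac{1}{2\pi}\int_{-\infty}^{\infty}\mathrm{Tr}(\mathbf{F}(-j\omega)^{\mathsf T}\mathbf{F}(j\omega))\,d\omega}$. The (normalized) LQG cost of an internally stabilizing controller is $J(\mathbf{K})=\lim_{T\to\infty}\mathbb{E}\left[\frac1T\int_0^T x(t)^{\mathsf T}C^{\mathsf T}Cx(t)+u(t)^{\mathsf T}u(t)\,dt\right]$, which equals $$\|(I-\mathbf{G}\mathbf{K})^{-1}\mathbf{G}\|_{\mathcal{H}_2}^2+\|(I-\mathbf{G}\mathbf{K})^{-1}\mathbf{G}\mathbf{K}\|_{\mathcal{H}_2}^2+\|\mathbf{K}(I-\mathbf{G}\mathbf{K})^{-1}\mathbf{G}\|_{\mathcal{H}_2}^2+\|\mathbf{K}(I-\mathbf{G}\mathbf{K})^{-1}\|_{\mathcal{H}_2}^2.$$ Stable/unstable separation: by a real invertible change of coordinates, $A_K$ is brought to the form $\mathrm{diag}(\hat A_<,\hat A_\ge)$, where $\hat A_<\in\mathbb{R}^{n_1\times n_1}$ has all eigenvalues in the open left-half plane and $\hat A_\ge\in\mathbb{R}^{n_2\times n_2}$ has all eigenvalues in the closed right-half plane; with $B_K$, $C_K$ transformed and partitioned conformally, $\mathbf{K}_<(s)=\hat C_<(sI-\hat A_<)^{-1}\hat B_<$ and $\mathbf{K}_\ge(s)=\hat C_\ge(sI-\hat A_\ge)^{-1}\hat B_\ge$. Balanced truncation of a stable strictly proper system with minimal realization $(A',B',C')$ of order $n_1$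 to order $n_r<n_1$: let $W_c,W_o\succ0$ solve $A'W_c+W_cA'^{\mathsf T}+B'B'^{\mathsf T}=0$ and $A'^{\mathsf T}W_o+W_oA'+C'^{\mathsf T}C'=0$; let $\Sigma=\mathrm{diag}(\sigma_1,\dots,\sigma_{n_1})$ with $\sigma_i=\sqrt{\lambda_i(W_cW_o)}$; factorize $W_c=QQ^{\mathsf T}$, choose $U$ orthogonal with $Q^{\mathsf T}W_oQ=U\Sigma^2U^{\mathsf T}$, and set $T=\Sigma^{1/2}U^{\mathsf T}Q^{-1}$. Then $\tilde A=TA'T^{-1}$, $\tilde B=TB'$, $\tilde C=C'T^{-1}$ is a balanced realization (both Gramians equal $\Sigma$). Partition $\Sigma=\mathrm{diag}(\Sigma_1,\Sigma_2)$ with $\Sigma_1$ of size $n_r\times n_r$, and $\tilde A,\tilde B,\tilde C$ conformally; the balanced truncation is $\tilde C_1(sI-\tilde A_{11})^{-1}\tilde B_1$. For $\mathbf{K}_<$ the blocks $\Sigma_1,\Sigma_2$ are denoted $\Sigma_{<,1},\Sigma_{<,2}$. *)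

(* Defs.v *)
From HB Require Import structures.
From mathcomp Require Import all_boot all_order all_algebra.
From mathcomp Require Import complex.
From mathcomp Require Import all_classical all_reals all_analysis.

Set Implicit Arguments.
Unset Strict Implicit.
Unset Printing Implicit Defensive.

Import Order.TTheory GRing.Theory Num.Theory.
Import numFieldNormedType.Exports.

Local Open Scope classical_set_scope.
Local Open Scope complex_scope.
Local Open Scope ring_scope.

(** * State-space systems *)

(* The realization (A, B, C) of a strictly proper system with [m] inputs,
   [p] outputs and [n] states. *)
Record lti (R : realType) (m p n : nat) := Lti {
  ssA : 'M[R]_n;
  ssB : 'M[R]_(n, m);
  ssC : 'M[R]_(p, n) }.

Definition controllable (R : realType) (n m : nat)
    (A : 'M[R]_n) (B : 'M[R]_(n, m)) : Prop :=
  \rank (\mxrow_(k < n) (A ^+ k *m B)) = n.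

Definition observable (R : realType) (n p : nat)
    (C : 'M[R]_(p, n)) (A : 'M[R]_n) : Prop :=
  \rank (\mxcol_(k < n) (C *m A ^+ k)) = n.

Definition minimal (R : realType) (m p n : nat) (S : lti R m p n) : Prop :=
  controllable (ssA S) (ssB S) /\ observable (ssC S) (ssA S).

(* The spectrum of a real matrix is taken in R[i]. *)
Definition hurwitz (R : realType) (n : nat) (A : 'M[R]_n) : Prop :=
  forall l : R[i], eigenvalue (map_mx (real_complex R) A) l -> complex.Re l < 0.

Definition antistable (R : realType) (n : nat) (A : 'M[R]_n) : Prop :=
  forall l : R[i], eigenvalue (map_mx (real_complex R) A) l -> 0 <= complex.Re l.

(* The state of the closed loop (positive feedback u = K y) is
   col_mx x xi. *)
Definition closed_loopA (R : realType) (m p nx nk : nat)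
    (G : lti R m p nx) (K : lti R p m nk) : 'M[R]_(nx + nk) :=
  block_mx (ssA G) (ssB G *m ssC K) (ssB K *m ssC G) (ssA K).

(* Input matrix from the stacked noise col_mx w v. *)
Definition closed_loopB (R : realType) (m p nx nk : nat)
    (G : lti R m p nx) (K : lti R p m nk) : 'M[R]_(nx + nk, m + p) :=
  block_mx (ssB G) 0 0 (ssB K).

Definition internally_stabilizes (R : realType) (m p nx nk : nat)
    (G : lti R m p nx) (K : lti R p m nk) : Prop :=
  hurwitz (closed_loopA G K).

(* Parallel connection; its transfer function is the sum of the two. *)
Definition parallel (R : realType) (m p n1 n2 : nat)
    (S1 : lti R m p n1) (S2 : lti R m p n2) : lti R m p (n1 + n2) :=
  Lti (block_mx (ssA S1) 0 0 (ssA S2)) (col_mx (ssB S1) (ssB S2))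
      (row_mx (ssC S1) (ssC S2)).

Definition change_coordinates (R : realType) (m p n : nat) (T : 'M[R]_n)
    (S : lti R m p n) : lti R m p n :=
  Lti (T *m ssA S *m invmx T) (T *m ssB S) (ssC S *m invmx T).

Definition stable_separation (R : realType) (m p n1 n2 : nat)
    (K : lti R m p (n1 + n2)) (Klt : lti R m p n1) (Kge : lti R m p n2) : Prop :=
  [/\ exists2 T, T \in unitmx & change_coordinates T K = parallel Klt Kge,
      hurwitz (ssA Klt) & antistable (ssA Kge)].

(** * Balanced truncation *)

Definition posdefmx (R : realType) (n : nat) (W : 'M[R]_n) : Prop :=
  W^T = W /\ forall x : 'cV[R]_n, x != 0 -> 0 < (x^T *m W *m x) 0 0.

(* [Sr] is obtained from [S] by balancing and keeping the first [nr] states;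
   [sig] is the diagonal of the balanced Gramian.  No ordering of [sig] is
   imposed. *)
Definition balanced_truncation (R : realType) (m p nr nt : nat)
    (S : lti R m p (nr + nt)) (sig : 'rV[R]_(nr + nt)) (Sr : lti R m p nr)
    : Prop :=
  exists (Wc Wo Q U : 'M[R]_(nr + nt)) (lam : 'rV[R]_(nr + nt)),
  let A := ssA S in let B := ssB S in let C := ssC S in
  let T := diag_mx (map_mx Num.sqrt sig) *m U^T *m invmx Q in
  let Sb := change_coordinates T S in
  [/\ posdefmx Wc /\ A *m Wc + Wc *m A^T + B *m B^T = 0,
      posdefmx Wo /\ A^T *m Wo + Wo *m A + C^T *m C = 0,
      char_poly (Wc *m Wo) = \prod_(i < nr + nt) ('X - (lam 0 i)%:P) /\
        sig = map_mx Num.sqrt lam,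
      [/\ Wc = Q *m Q^T, U *m U^T = 1%:M &
          Q^T *m Wo *m Q = U *m diag_mx sig *m diag_mx sig *m U^T] &
      Sr = Lti (ulsubmx (ssA Sb)) (usubmx (ssB Sb)) (lsubmx (ssC Sb))].

(** * Rational transfer matrices and their norms *)

(* Transfer functions live in a field of rational functions, so that inverses
   such as (I - G K)^-1 and the cancellation of common poles in a difference
   are algebraic rather than pointwise. *)
Notation ratfun R := {fraction {poly R}}.

Definition tf (R : realType) (m p n : nat) (S : lti R m p n)
    : 'M[ratfun R]_(p, m) :=
  let cst (c : R) : ratfun R := FracField.tofrac (c%:P) in
  map_mx cst (ssC S)
    *m invmx (map_mx (@FracField.tofrac {poly R}) (char_poly_mx (ssA S)))
    *m map_mx cst (ssB S).

(* Value at s, computed from a representative in lowest terms; the (total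
   division) value at a pole is meaningless. *)
Definition ratval (R : realType) (s : R[i]) (f : ratfun R) : R[i] :=
  let num := (fraction.frac (generic_quotient.repr f)).1 in
  let den := (fraction.frac (generic_quotient.repr f)).2 in
  let g := gcdp num den in
  (map_poly (real_complex R) (num %/ g)).[s]
    / (map_poly (real_complex R) (den %/ g)).[s].

Definition freq (R : realType) (p m : nat) (F : 'M[ratfun R]_(p, m)) (w : R)
    : 'M[R[i]]_(p, m) :=
  map_mx (ratval (0 +i* w)) F.

Definition sigma_max (R : realType) (p m : nat) (M : 'M[R[i]]_(p, m)) : R :=
  sup [set s : R | 0 <= s /\ eigenvalue (map_mx (@conjc R) M^T *m M) (s ^+ 2)%:C].

(* [hinf_norm] and [h2_norm] are meant for stable (resp. stable strictly
   proper) rational matrices. *)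
Definition hinf_norm (R : realType) (p m : nat) (F : 'M[ratfun R]_(p, m)) : R :=
  sup (range (fun w : R => sigma_max (freq F w))).

(* The trace is real because the coefficients of [F] are. *)
Definition h2_norm (R : realType) (p m : nat) (F : 'M[ratfun R]_(p, m)) : R :=
  Num.sqrt ((2 * pi)^-1 *
    \int[lebesgue_measure]_(w in [set: R])
       complex.Re (\tr ((freq F (- w))^T *m freq F w))).

(** * White noise and the LQG cost *)

(* e^A, entrywise. *)
Definition expmx (R : realType) (n : nat) (A : 'M[R]_n) : 'M[R]_n :=
  \matrix_(i, j) limn (series (fun k => (A ^+ k) i j / k`!%:R)).

Definition sqr_integrable (R : realType) (k : nat) (f : R -> 'cV[R]_k) : Prop :=
  forall i, measurable_fun [set: R] (fun t => f t i 0) /\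
    (@lebesgue_measure R).-integrable [set: R] (fun t => ((f t i 0) ^+ 2)%:E).

Definition L2_inner (R : realType) (k : nat) (f g : R -> 'cV[R]_k) : R :=
  \int[lebesgue_measure]_(t in [set: R]) ((f t)^T *m g t) 0 0.

(* Zero-mean Gaussian white noise eta(t) in R^k with spectrum equal to the
   identity, as a generalized process: [W f] stands for the random variable
   \int f(t)^T eta(t) dt, and E[eta(t) eta(s)^T] = delta(t - s) I reads
   E[(W f) (W g)] = <f, g>.  The Gaussian clause excludes the degenerate law,
   for which [normal_prob] is a placeholder. *)
Definition white_noise (R : realType) (d : measure_display)
    (Omega : measurableType d) (P : probability Omega R) (k : nat)
    (W : (R -> 'cV[R]_k) -> Omega -> R) : Prop :=
  [/\ forall f, sqr_integrable f ->
        measurable_fun [set: Omega] (W f) /\ 'E_P[W f]%E = 0%E,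
      forall (a : R) f g, sqr_integrable f -> sqr_integrable g ->
        {ae P, forall o, W (fun t => a *: f t + g t) o = a * W f o + W g o},
      forall f g, sqr_integrable f -> sqr_integrable g ->
        'E_P[fun o => (W f o * W g o)%R]%E = (L2_inner f g)%:E &
      forall f, sqr_integrable f -> 0 < L2_inner f f ->
        forall V : set R, measurable V ->
          P (W f @^-1` V) = normal_prob 0 (Num.sqrt (L2_inner f f)) V].

(* [z] is a (jointly measurable) solution of zdot = A z + B eta on [0, +oo[
   from a deterministic initial state:
   z(t) = e^(tA) z0 + \int_0^t e^((t-s)A) B eta(s) ds. *)
Definition noise_response (R : realType) (d : measure_display)
    (Omega : measurableType d) (P : probability Omega R) (n k : nat)
    (W : (R -> 'cV[R]_k) -> Omega -> R) (A : 'M[R]_n) (B : 'M[R]_(n, k))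
    (z : R -> Omega -> 'cV[R]_n) : Prop :=
  (forall i, measurable_fun [set: R * Omega] (fun to => z to.1 to.2 i 0)) /\
  exists z0 : 'cV[R]_n, forall (t : R) i, 0 <= t ->
    {ae P, forall o, z t o i 0 = (expmx (t *: A) *m z0) i 0 +
       W (fun s => if (0 <= s <= t)%R
                   then (row i (expmx ((t - s) *: A) *m B))^T else 0) o}.

(* [z t = col_mx x xi] is the closed-loop state when the process noise [w] and
   the measurement noise [v] form the joint white noise [col_mx w v] (each with
   identity spectrum, and mutually independent). *)
Definition closed_loop_response (R : realType) (d : measure_display)
    (Omega : measurableType d) (P : probability Omega R) (m p nx nk : nat)
    (G : lti R m p nx) (K : lti R p m nk)
    (W : (R -> 'cV[R]_(m + p)) -> Omega -> R)
    (z : R -> Omega -> 'cV[R]_(nx + nk)) : Prop :=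
  noise_response P W (closed_loopA G K) (closed_loopB G K) z.

(* x^T C^T C x + u^T u with u = C_K xi. *)
Definition running_cost (R : realType) (m p nx nk : nat)
    (G : lti R m p nx) (K : lti R p m nk) (z : 'cV[R]_(nx + nk)) : R :=
  let x := usubmx z in
  let u := ssC K *m dsubmx z in
  (x^T *m (ssC G)^T *m ssC G *m x + u^T *m u) 0 0.

Definition mean_cost (R : realType) (d : measure_display)
    (Omega : measurableType d) (P : probability Omega R) (m p nx nk : nat)
    (G : lti R m p nx) (K : lti R p m nk)
    (z : R -> Omega -> 'cV[R]_(nx + nk)) (T : R) : \bar R :=
  'E_P[fun o => (T^-1 *
         \int[lebesgue_measure]_(t in `[0, T]) running_cost G K (z t o))%R]%E.

(* J is the LQG cost: in particular the limit exists. *)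
Definition lqg_cost (R : realType) (d : measure_display)
    (Omega : measurableType d) (P : probability Omega R) (m p nx nk : nat)
    (G : lti R m p nx) (K : lti R p m nk)
    (z : R -> Omega -> 'cV[R]_(nx + nk)) (J : R) : Prop :=
  mean_cost P G K z T @[T --> +oo] --> J%:E.

(* Main.v *)
(* The frequency response of a balanced truncation differs from the original by
   at most twice the sum of the discarded singular values: the states are removed
   one at a time, and a quadratic storage function built from the two Gramians
   gives twice the discarded value at each step.  Hence
   |X|_oo |Delta|_oo < 1.

   The loop of G with K_r is contained in the feedback loop of X with Delta,
   realized with the stable part of K running alongside, and the small-gain
   argument is a homotopy: the spectrum of the loop with t Delta cannot cross the
   imaginary axis.

   For the cost, the second moment of the state at time t is
   P + e^(tA) M e^(tA)^T, where P solves the Lyapunov equation, so that J is the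
   trace of P against the output weights; integrating the resolvent of A along the
   imaginary axis identifies it with the sum of the four squared H2 norms.  The
   identities Y_r = Y + X Delta Y_r and its companions express the four perturbed
   maps through the unperturbed ones; they are bounded at each frequency by
   inverting 1 - X Delta, and integrated with Minkowski's inequality. *)
Require Import Defs.
From HB Require Import structures.
From mathcomp Require Import all_boot all_order all_algebra.
From mathcomp Require Import complex generic_quotient fraction.
From mathcomp Require Import all_classical all_reals all_analysis.
From mathcomp Require Import measurable_realfun ring lra.

Set Implicit Arguments.
Unset Strict Implicit.
Unset Printing Implicit Defensive.

Import Order.TTheory GRing.Theory Num.Theory.
Import numFieldNormedType.Exports.

Local Open Scope classical_set_scope.
Local Open Scope complex_scope.
Local Open Scope ring_scope.

(** * Frobenius norm and operator bounds of complex matrices *)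

(** Disjointness of the Gramian blocks separates the kept states from the discarded ones, but not
    the discarded ones from each other. The truncations met while states are removed one at a time
    may thus have eigenvalues on the imaginary axis, where they have no frequency response. So the
    error bound fixes a frequency and an input and compares solutions of the truncated equations.
    These exist even at such an eigenvalue, and uniqueness is used only for the last truncation,
    whose stability is shown separately.

    K may be unstable, and even have poles on the axis, so K itself is never evaluated there. Delta
    is realized by the two stable parts alone, and the perturbation identities are derived over the
    field of rational functions, then evaluated on closed-loop maps only.

    The resolvent decays only like 1/w, so its integral along the axis exists only as a principal
    value, equal to pi I. The Lyapunov equation makes the squared frequency response linear in the
    resolvent, and this value then produces the trace formula for the H2 norm. *)

Section ComplexMatrixNorms.
Variable R : realType.
Local Notation C := R[i].

Lemma real_complexM (a b : R) : (a * b)%:C = a%:C * b%:C.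
Proof. exact: rmorphM. Qed.

Lemma real_complexD (a b : R) : (a + b)%:C = a%:C + b%:C.
Proof. exact: rmorphD. Qed.

Lemma real_complex_sum (I : finType) (f : I -> R) :
  (\sum_i f i)%:C = \sum_i (f i)%:C.
Proof. exact: rmorph_sum. Qed.

(** The adjoint, spelled as in [sigma_max] so that the two agree by conversion. *)
Definition hadj (m n : nat) (M : 'M[C]_(m, n)) : 'M[C]_(n, m) :=
  map_mx (@conjc R) M^T.

Lemma hadjE m n (M : 'M[C]_(m, n)) i j : hadj M i j = conjc (M j i).
Proof. by rewrite !mxE. Qed.

Lemma hadjK m n : cancel (@hadj m n) (@hadj n m).
Proof. by move=> M; apply/matrixP => i j; rewrite !hadjE conjcK. Qed.

Lemma hadjM m n k (A : 'M[C]_(m, n)) (B : 'M[C]_(n, k)) :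
  hadj (A *m B) = hadj B *m hadj A.
Proof. by rewrite /hadj trmx_mul map_mxM. Qed.

Lemma hadjD m n (A B : 'M[C]_(m, n)) : hadj (A + B) = hadj A + hadj B.
Proof. by rewrite /hadj linearD /= map_mxD. Qed.

Lemma hadjB m n (A B : 'M[C]_(m, n)) : hadj (A - B) = hadj A - hadj B.
Proof. by rewrite /hadj linearB /= map_mxB. Qed.

Lemma hadjZ m n (a : C) (A : 'M[C]_(m, n)) : hadj (a *: A) = conjc a *: hadj A.
Proof. by rewrite /hadj linearZ /= map_mxZ. Qed.

Lemma hadj_scalar n (a : C) : hadj (a%:M : 'M[C]_n) = (conjc a)%:M.
Proof. by rewrite /hadj tr_scalar_mx map_scalar_mx. Qed.

Definition cmx m n (M : 'M[R]_(m, n)) : 'M[C]_(m, n) :=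
  map_mx (real_complex R) M.

Lemma hadj_cmx m n (M : 'M[R]_(m, n)) : hadj (cmx M) = cmx M^T.
Proof. by apply/matrixP => i j; rewrite !mxE conjc_real. Qed.

(** Squared modulus with values in [R], so that sums and inequalities stay real. *)
Definition nsq (z : C) : R := complex.Re z ^+ 2 + complex.Im z ^+ 2.

Lemma nsq_ge0 z : 0 <= nsq z.
Proof. by rewrite addr_ge0 ?sqr_ge0. Qed.

Lemma nsqE z : (nsq z)%:C = conjc z * z.
Proof.
by case: z => a b; apply/eqP; rewrite eq_complex /nsq /=; apply/andP; split;
  apply/eqP; ring.
Qed.

Lemma nsq_eq0 z : (nsq z == 0) = (z == 0).
Proof.
case: z => a b; rewrite /nsq eq_complex /=.
by rewrite paddr_eq0 ?sqr_ge0// !sqrf_eq0.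
Qed.

Lemma nsqM x y : nsq (x * y) = nsq x * nsq y.
Proof. by case: x y => a b [c d]; rewrite /nsq /=; ring. Qed.

Lemma nsqV x : nsq x^-1 = (nsq x)^-1.
Proof.
have [->|x0] := eqVneq x 0; first by rewrite invr0 /nsq /= expr0n addr0 invr0.
apply: (@mulfI _ (nsq x)); first by rewrite nsq_eq0.
rewrite -nsqM !divff ?nsq_eq0//; by rewrite /nsq /= expr0n addr0 expr1n.
Qed.

Lemma nsq_conj z : nsq (conjc z) = nsq z.
Proof. by case: z => a b; rewrite /nsq /= sqrrN. Qed.

Lemma nsqN z : nsq (- z) = nsq z.
Proof. by case: z => a b; rewrite /nsq /= !sqrrN. Qed.

Lemma nsq_real (a : R) : nsq a%:C = a ^+ 2.
Proof. by rewrite /nsq /= expr0n addr0. Qed.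

Lemma nsq_le_sqr (z : C) (a : R) : 0 <= a -> nsq z <= a ^+ 2 ->
  `|complex.Re z| <= a /\ `|complex.Im z| <= a.
Proof.
move=> a0 h; split; rewrite -(ler_pXn2r (n := 2)) ?nnegrE// real_normK ?num_real//.
  by rewrite (le_trans _ h)// lerDl sqr_ge0.
by rewrite (le_trans _ h)// lerDr sqr_ge0.
Qed.

Definition fro2 m n (M : 'M[C]_(m, n)) : R := \sum_i \sum_j nsq (M i j).
Definition fro m n (M : 'M[C]_(m, n)) : R := Num.sqrt (fro2 M).

Lemma fro2_ge0 m n (M : 'M[C]_(m, n)) : 0 <= fro2 M.
Proof. by apply: sumr_ge0 => i _; apply: sumr_ge0 => j _; exact: nsq_ge0. Qed.

Lemma fro_ge0 m n (M : 'M[C]_(m, n)) : 0 <= fro M.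
Proof. exact: sqrtr_ge0. Qed.

Lemma fro_sq m n (M : 'M[C]_(m, n)) : fro M ^+ 2 = fro2 M.
Proof. by rewrite sqr_sqrtr ?fro2_ge0. Qed.

Lemma fro2_tr m n (M : 'M[C]_(m, n)) : (fro2 M)%:C = \tr (hadj M *m M).
Proof.
rewrite /fro2 /mxtrace exchange_big rmorph_sum /=; apply: eq_bigr => j _.
rewrite mxE rmorph_sum /=; apply: eq_bigr => i _.
by rewrite nsqE hadjE.
Qed.

Lemma fro2_col n (x : 'cV[C]_n) : (fro2 x)%:C = (hadj x *m x) 0 0.
Proof. by rewrite fro2_tr /mxtrace big_ord1. Qed.

Lemma fro2_eq0 m n (M : 'M[C]_(m, n)) : fro2 M = 0 -> M = 0.
Proof.
move=> h; apply/matrixP => i j; rewrite mxE.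
have h0 k : 0 <= \sum_j nsq (M k j) by apply: sumr_ge0 => l _; exact: nsq_ge0.
have /eqP := h; rewrite psumr_eq0// => /allP/(_ i (mem_index_enum _))/=.
rewrite psumr_eq0; last by move=> *; exact: nsq_ge0.
by move=> /allP/(_ j (mem_index_enum _))/=; rewrite nsq_eq0 => /eqP.
Qed.

Lemma fro2_0 m n : fro2 (0 : 'M[C]_(m, n)) = 0.
Proof.
by rewrite /fro2 big1// => i _; rewrite big1// => j _; rewrite mxE /nsq /= expr0n addr0.
Qed.

Lemma fro_0 m n : fro (0 : 'M[C]_(m, n)) = 0.
Proof. by rewrite /fro fro2_0 sqrtr0. Qed.

Lemma fro_eq0 m n (M : 'M[C]_(m, n)) : fro M = 0 -> M = 0.
Proof. by move=> h; apply: fro2_eq0; rewrite -fro_sq h expr0n. Qed.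

Lemma fro2_hadj m n (M : 'M[C]_(m, n)) : fro2 (hadj M) = fro2 M.
Proof.
rewrite /fro2 exchange_big; apply: eq_bigr => i _; apply: eq_bigr => j _.
by rewrite hadjE nsq_conj.
Qed.

Lemma fro_hadj m n (M : 'M[C]_(m, n)) : fro (hadj M) = fro M.
Proof. by rewrite /fro fro2_hadj. Qed.

Lemma fro2_cols m n (M : 'M[C]_(m, n)) : fro2 M = \sum_j fro2 (col j M).
Proof.
rewrite /fro2 exchange_big; apply: eq_bigr => j _; apply: eq_bigr => i _.
by rewrite big_ord1 mxE.
Qed.

Lemma cauchy_schwarz_sum (I : finType) (a b : I -> R) :
  (\sum_i a i * b i) ^+ 2 <= (\sum_i a i ^+ 2) * (\sum_i b i ^+ 2).
Proof.
set A := \sum_i a i ^+ 2; set B := \sum_i b i ^+ 2; set D := \sum_i a i * b i.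
have B0 : 0 <= B by apply: sumr_ge0 => i _; exact: sqr_ge0.
have [B1|B1] := eqVneq B 0.
  have -> : D = 0.
    rewrite /D big1// => i _; move: B1 => /eqP.
    rewrite psumr_eq0; last by move=> *; exact: sqr_ge0.
    by move=> /allP/(_ i (mem_index_enum _))/=; rewrite sqrf_eq0 => /eqP->; rewrite mulr0.
  by rewrite expr0n mulr_ge0 //; apply: sumr_ge0 => i _; exact: sqr_ge0.
have Bp : 0 < B by rewrite lt_neqAle eq_sym B1.
have : 0 <= \sum_i (B * a i - D * b i) ^+ 2 by apply: sumr_ge0 => i _; exact: sqr_ge0.
have -> : \sum_i (B * a i - D * b i) ^+ 2 = B * (A * B - D ^+ 2).
  transitivity (\sum_i (B ^+ 2 * a i ^+ 2 - B * D * 2 * (a i * b i) + D ^+ 2 * b i ^+ 2)).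
    by apply: eq_bigr => i _; ring.
  by rewrite big_split sumrB -!mulr_sumr -/A -/B -/D /=; ring.
by rewrite pmulr_rge0// subr_ge0.
Qed.

Lemma l2_triangle (I : finType) (a b : I -> R) :
  Num.sqrt (\sum_i (a i + b i) ^+ 2) <=
  Num.sqrt (\sum_i a i ^+ 2) + Num.sqrt (\sum_i b i ^+ 2).
Proof.
have A0 : 0 <= \sum_i a i ^+ 2 by apply: sumr_ge0 => i _; exact: sqr_ge0.
have B0 : 0 <= \sum_i b i ^+ 2 by apply: sumr_ge0 => i _; exact: sqr_ge0.
rewrite -(ler_pXn2r (n := 2)) ?nnegrE ?addr_ge0 ?sqrtr_ge0//.
rewrite sqr_sqrtr; last by apply: sumr_ge0 => i _; exact: sqr_ge0.
rewrite sqrrD !sqr_sqrtr//.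
have -> : \sum_i (a i + b i) ^+ 2 =
    \sum_i a i ^+ 2 + (\sum_i a i * b i) *+ 2 + \sum_i b i ^+ 2.
  by rewrite -sumrMnl -!big_split /=; apply: eq_bigr => i _; rewrite sqrrD.
rewrite lerD2r lerD2l lerMn2r /= -sqrtrM//.
rewrite (le_trans (ler_norm _))// -sqrtr_sqr ler_wsqrtr//.
exact: cauchy_schwarz_sum.
Qed.

Lemma froD m n (A B : 'M[C]_(m, n)) : fro (A + B) <= fro A + fro B.
Proof.
pose f (M : 'M[C]_(m, n)) (p : 'I_m * 'I_n * bool) : R :=
  if p.2 then complex.Re (M p.1.1 p.1.2) else complex.Im (M p.1.1 p.1.2).
have E M : fro M = Num.sqrt (\sum_p f M p ^+ 2).
  rewrite /fro; congr Num.sqrt.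
  transitivity (\sum_p \sum_b f M (p, b) ^+ 2); last first.
    by rewrite pair_big; apply: eq_bigr => -[].
  rewrite /fro2 pair_big; apply: eq_bigr => -[i j] _ /=.
  by rewrite big_bool.
rewrite !E; apply: le_trans (l2_triangle _ _).
rewrite le_eqVlt; apply/orP; left; apply/eqP; congr Num.sqrt.
by apply: eq_bigr => -[[i j] b] _; rewrite /f /= mxE; case: b; case: (A i j) (B i j) => ? ? [].
Qed.

Lemma fro2M_col m n (A : 'M[C]_(m, n)) (x : 'cV[C]_n) :
  fro2 (A *m x) <= fro2 A * fro2 x.
Proof.
rewrite /fro2 mulr_suml; apply: ler_sum => i _; rewrite big_ord1.
have E (z w : C) : nsq (z + w) <= (Num.sqrt (nsq z) + Num.sqrt (nsq w)) ^+ 2.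
  rewrite -[leLHS]sqr_sqrtr ?nsq_ge0// ler_pXn2r ?nnegrE ?addr_ge0 ?sqrtr_ge0//.
  have N u : Num.sqrt (nsq u) = ComplexField.Normc.normc u by case: u.
  by rewrite !N; exact: le_normcD.
have : Num.sqrt (nsq ((A *m x) i 0)) <= \sum_j Num.sqrt (nsq (A i j)) * Num.sqrt (nsq (x j 0)).
  rewrite mxE; elim/big_ind2: _ => [|z a w b h1 h2|j _].
  - by rewrite /nsq /= expr0n addr0 sqrtr0.
  - rewrite (le_trans _ (lerD h1 h2))//.
    by rewrite -(ler_pXn2r (n := 2)) ?nnegrE ?addr_ge0 ?sqrtr_ge0// sqr_sqrtr ?nsq_ge0.
  - by rewrite nsqM sqrtrM ?nsq_ge0.
move=> h; rewrite -[leLHS]sqr_sqrtr ?nsq_ge0//.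
apply: (@le_trans _ _ ((\sum_j Num.sqrt (nsq (A i j)) * Num.sqrt (nsq (x j 0))) ^+ 2)).
  rewrite ler_pXn2r ?nnegrE ?sqrtr_ge0//.
  by apply: sumr_ge0 => j _; rewrite mulr_ge0 ?sqrtr_ge0.
apply: le_trans (cauchy_schwarz_sum _ _) _.
rewrite le_eqVlt; apply/orP; left; apply/eqP; congr (_ * _); apply: eq_bigr => j _.
  by rewrite sqr_sqrtr ?nsq_ge0.
by rewrite big_ord1 sqr_sqrtr ?nsq_ge0.
Qed.

(** An upper bound on the operator norm. As a predicate it composes and adds without computing any
    singular value. *)
Definition opbound m n (c : R) (M : 'M[C]_(m, n)) : Prop :=
  forall x : 'cV[C]_n, fro (M *m x) <= c * fro x.

Lemma opbound_fro m n (M : 'M[C]_(m, n)) : opbound (fro M) M.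
Proof.
move=> x; rewrite -sqrtrM ?fro2_ge0//.
by rewrite ler_wsqrtr// fro2M_col.
Qed.

Lemma opboundD m n c d (A B : 'M[C]_(m, n)) :
  opbound c A -> opbound d B -> opbound (c + d) (A + B).
Proof. by move=> hA hB x; rewrite mulmxDl mulrDl (le_trans (froD _ _))// lerD. Qed.

Lemma opboundM m n k c d (A : 'M[C]_(m, n)) (B : 'M[C]_(n, k)) : 0 <= c ->
  opbound c A -> opbound d B -> opbound (c * d) (A *m B).
Proof.
by move=> c0 hA hB x; rewrite -mulmxA (le_trans (hA _))// -mulrA ler_wpM2l.
Qed.

Lemma opbound1 n : opbound 1 (1%:M : 'M[C]_n).
Proof. by move=> x; rewrite mul1mx mul1r. Qed.

(** The squared Frobenius norm is the sum over columns, and the bound applies to each column. *)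
Lemma opbound_frol m n k c (A : 'M[C]_(m, n)) (B : 'M[C]_(n, k)) : 0 <= c ->
  opbound c A -> fro (A *m B) <= c * fro B.
Proof.
move=> c0 hA; rewrite -(ler_pXn2r (n := 2)) ?nnegrE ?mulr_ge0 ?fro_ge0//.
rewrite exprMn !fro_sq !fro2_cols mulr_sumr; apply: ler_sum => j _.
rewrite -!fro_sq -exprMn ler_pXn2r ?nnegrE ?mulr_ge0 ?fro_ge0//.
by rewrite colE -mulmxA -colE.
Qed.

Lemma nsq_dot n (y x : 'cV[C]_n) : nsq ((hadj y *m x) 0 0) <= fro2 y * fro2 x.
Proof.
have := fro2M_col (hadj y) x.
by rewrite {1}/fro2 !big_ord1 fro2_hadj.
Qed.

(** With z = M^H y, |z|^2 = y^H M z is at most |y| c |z|; then divide by |z|. *)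
Lemma opbound_hadj m n c (M : 'M[C]_(m, n)) : 0 <= c ->
  opbound c M -> opbound c (hadj M).
Proof.
move=> c0 hM y; set z := hadj M *m y.
have [z0|z0] := eqVneq (fro z) 0; first by rewrite z0 mulr_ge0 ?fro_ge0.
have zp : 0 < fro z by rewrite lt_neqAle eq_sym z0 fro_ge0.
rewrite -(ler_pM2l zp) -expr2 fro_sq.
have E : fro2 z = Num.sqrt (nsq ((hadj y *m (M *m z)) 0 0)).
  rewrite mulmxA -[M]hadjK -hadjM -/z -fro2_col nsq_real sqrtr_sqr ger0_norm//.
  exact: fro2_ge0.
rewrite E (le_trans (ler_wsqrtr (nsq_dot _ _)))// sqrtrM ?fro2_ge0// -!/(fro _).
by rewrite mulrC mulrA [_ * c]mulrC ler_wpM2r ?fro_ge0.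
Qed.

Lemma opbound_fror m n k c (A : 'M[C]_(m, n)) (B : 'M[C]_(n, k)) : 0 <= c ->
  opbound c B -> fro (A *m B) <= fro A * c.
Proof.
move=> c0 hB; rewrite -fro_hadj hadjM mulrC -[fro A]fro_hadj.
by apply: opbound_frol => //; exact: opbound_hadj.
Qed.

End ComplexMatrixNorms.

(** * The largest singular value as an operator bound *)

Section SigmaMax.
Variable R : realType.
Local Notation C := R[i].

Let sset m n (M : 'M[C]_(m, n)) : set R :=
  [set s : R | 0 <= s /\ eigenvalue (hadj M *m M) (s ^+ 2)%:C].

(** An eigenvector x of M^H M at s^2 satisfies |M x| = s |x|. Eigenvectors are rows here, hence the
    adjoint of v. *)
Lemma sigma_max_set_le m n c (M : 'M[C]_(m, n)) s : 0 <= c -> opbound c M ->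
  sset M s -> s <= c.
Proof.
move=> c0 hM [s0 /eigenvalueP[v vE v0]].
have f0 : fro (hadj v) != 0.
  by apply: contra v0 => /eqP/fro_eq0 h; rewrite -[v]hadjK h /hadj trmx0 map_mx0.
have fp : 0 < fro (hadj v) by rewrite lt_neqAle eq_sym f0 fro_ge0.
rewrite -(ler_pM2r fp); apply: le_trans (hM _).
rewrite -(ler_pXn2r (n := 2)) ?nnegrE ?mulr_ge0 ?fro_ge0// exprMn !fro_sq.
have : (fro2 (M *m hadj v))%:C = (s ^+ 2 * fro2 (hadj v))%:C.
  rewrite fro2_col hadjM hadjK !mulmxA -[v *m _ *m M]mulmxA vE -scalemxAl mxE.
  rewrite -{1}[v]hadjK -fro2_col real_complexM. reflexivity.
by move=> /complexI->.
Qed.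

Let sigma_maxE m n (M : 'M[C]_(m, n)) : sigma_max M = sup (sset M).
Proof. by []. Qed.

Lemma sigma_max_le m n c (M : 'M[C]_(m, n)) : 0 <= c -> opbound c M ->
  sigma_max M <= c.
Proof.
(* The set is empty when M has no columns; its supremum is then 0. *)
move=> c0 hM; rewrite sigma_maxE; have [->|/set0P ne] := eqVneq (sset M) set0; first by rewrite sup0.
by apply: ge_sup => // s hs; exact: (sigma_max_set_le c0 hM hs).
Qed.

Lemma sigma_max_set_ub m n (M : 'M[C]_(m, n)) : has_ubound (sset M).
Proof.
exists (fro M) => s; exact: (sigma_max_set_le (fro_ge0 _) (opbound_fro _)).
Qed.

Lemma sigma_max_ge0 m n (M : 'M[C]_(m, n)) : 0 <= sigma_max M.
Proof.
rewrite sigma_maxE; have [->|/set0P [s hs]] := eqVneq (sset M) set0.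
  by rewrite sup0.
by apply: (le_trans hs.1); exact: (ub_le_sup (sigma_max_set_ub M) hs).
Qed.

(** Diagonalize H = M^H M by a unitary P. The eigenvalues are |M p_i|^2 for the orthonormal p_i, so
    each is at most [sigma_max M ^+ 2], and |M x|^2 is their sum weighted by the squared coordinates
    of P x. *)
Lemma opbound_sigma_max m n (M : 'M[C]_(m, n)) : opbound (sigma_max M) M.
Proof.
move=> x; rewrite -(ler_pXn2r (n := 2)) ?nnegrE ?mulr_ge0 ?fro_ge0 ?sigma_max_ge0//.
rewrite exprMn !fro_sq.
set H := hadj M *m M; set P := spectral.spectralmx H; set d := spectral.spectral_diag H.
have Hn : H \is spectral.normalmx.
  apply/spectral.normalmxP; change (H *m hadj H = hadj H *m H).
  by rewrite /H hadjM hadjK.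
have PU : P *m hadj P = 1%:M.
  exact/spectral.unitarymxP/spectral.spectral_unitarymx.
have PU' : hadj P *m P = 1%:M by exact: mulmx1C.
have PI : invmx P = hadj P.
  by rewrite -[LHS]mulmx1 -PU mulKmx//; exact: spectral.spectral_unit.
have HE : H = hadj P *m diag_mx d *m P.
  by rewrite -PI; move/spectral.orthomx_spectralP: Hn.
have rowE i : row i P *m H = d 0 i *: row i P.
  rewrite HE !mulmxA -row_mul PU row1 -[in LHS]mulmxA -rowE.
  by apply/rowP => j; rewrite mul_diag_mx !mxE.
have dE i : d 0 i = (fro2 (M *m hadj (row i P)))%:C.
  rewrite fro2_col hadjM hadjK !mulmxA -[row i P *m _ *m M]mulmxA rowE -scalemxAl mxE.
  have -> : (row i P *m hadj (row i P)) 0 0 = (P *m hadj P) i i.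
    by rewrite !mxE; apply: eq_bigr => j _; rewrite !mxE.
  by rewrite PU mxE eqxx mulr1.
have dle i : fro2 (M *m hadj (row i P)) <= sigma_max M ^+ 2.
  set e := fro2 _; have e0 : 0 <= e by exact: fro2_ge0.
  rewrite -[leLHS]sqr_sqrtr// ler_pXn2r ?nnegrE ?sqrtr_ge0 ?sigma_max_ge0//.
  apply: (ub_le_sup (sigma_max_set_ub M)); split; first exact: sqrtr_ge0.
  apply/eigenvalueP; exists (row i P); first by rewrite rowE dE sqr_sqrtr.
  apply/negP => /eqP r0; have /matrixP/(_ i i) := PU.
  rewrite !mxE eqxx big1; last first.
    by move=> j _; have /rowP/(_ j) := r0; rewrite !mxE => ->; rewrite mul0r.
  by move=> /eqP; rewrite eq_sym oner_eq0.
have fE (y : 'cV[C]_n) : fro2 y = fro2 (P *m y).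
  by apply: complexI; rewrite !fro2_col hadjM mulmxA -[hadj y *m _ *m P]mulmxA PU' mulmx1.
have -> : fro2 (M *m x) = \sum_i fro2 (M *m hadj (row i P)) * nsq ((P *m x) i 0).
  apply: complexI; rewrite fro2_col hadjM mulmxA -[hadj x *m _ *m M]mulmxA -/H HE.
  rewrite !mulmxA -hadjM -mulmxA mxE real_complex_sum; apply: eq_bigr => i _.
  by rewrite mul_mx_diag real_complexM -dE nsqE !mxE; ring.
rewrite (fE x) /fro2 [leRHS]mulr_sumr; apply: ler_sum => i _.
by rewrite [X in _ <= _ * X]big_ord1 ler_wpM2r ?nsq_ge0 ?dle.
Qed.

(* Neumann: |u| <= g|u| + |(1-N)u|. *)
Lemma opbound_Neumann n g (N V : 'M[C]_n) : 0 <= g < 1 -> opbound g N ->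
  (1%:M - N) *m V = 1%:M -> opbound (1 / (1 - g)) V.
Proof.
move=> /andP[g0 g1] hN hV x; rewrite mul1r mulrC ler_pdivlMr ?subr_gt0//.
rewrite mulrBr mulr1 lerBlDr.
have e : V *m x = x + N *m (V *m x).
  apply/eqP; rewrite -subr_eq -{1}[V *m x]mul1mx -mulmxBl mulmxA hV.
  by rewrite mul1mx.
by rewrite {1}e (le_trans (froD _ _))// lerD2l mulrC; exact: hN.
Qed.

(** A vector with N v = v has |v| <= g |v|, hence vanishes. *)
Lemma Neumann_unit n g (N : 'M[C]_n) : 0 <= g < 1 -> opbound g N ->
  (1%:M - N) \in unitmx.
Proof.
move=> /andP[g0 g1] hN; apply: contraT; rewrite -unitmx_tr -row_free_unit -kermx_eq0.
move=> /rowV0Pn[v vK v0].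
have /sub_kermxP := vK; rewrite -[v]trmxK -trmx_mul => /(congr1 trmx).
rewrite trmxK trmx0 mulmxBl mul1mx => /eqP; rewrite subr_eq0 => /eqP e.
have h := hN v^T; rewrite -e in h.
suff /fro_eq0 h0 : fro v^T = 0 by move: v0; rewrite -[v]trmxK h0 trmx0 eqxx.
by apply/eqP; rewrite eq_le fro_ge0 andbT -(pmulr_rle0 _ (_ : 0 < 1 - g)) ?subr_gt0// mulrBl mul1r subr_le0.
Qed.

End SigmaMax.

(** * Resolvents *)

Section Resolvent.
Variable R : realType.
Local Notation C := R[i].

(* Newton interpolation of the resolvent at the points of [ls]:
   sum_k (s - l_0)^-1 ... (s - l_k)^-1 (A - l_0) ... (A - l_(k-1)) M. *)
Fixpoint newton n k (A : 'M[C]_n) (ls : seq C) (M : 'M[C]_(n, k)) (s : C) :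
    'M[C]_(n, k) :=
  if ls is l :: ls' then
    (s - l)^-1 *: (M + newton A ls' ((A - l%:M) *m M) s)
  else 0.

(** The remainder of the interpolation [newton]: the product of the A - l applied to M. *)
Fixpoint linprod n k (A : 'M[C]_n) (ls : seq C) (M : 'M[C]_(n, k)) : 'M[C]_(n, k) :=
  if ls is l :: ls' then linprod A ls' ((A - l%:M) *m M) else M.

(** Telescoping: s - A = (s - l) - (A - l), and the second part cancels the next term. *)
Lemma newtonP n k (A : 'M[C]_n) ls (M : 'M[C]_(n, k)) s :
  s \notin ls -> linprod A ls M = 0 -> (s%:M - A) *m newton A ls M s = M.
Proof.
elim: ls M => [|l ls IH] M /=; first by move=> _ ->; rewrite mulmx0.
rewrite inE negb_or => /andP[sl sls] hM.
rewrite -scalemxAr mulmxDr IH// -mulmxDl.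
have -> : s%:M - A + (A - l%:M) = (s - l)%:M.
  by rewrite addrA subrK raddfB.
by rewrite mul_scalar_mx scalerA mulVf ?scale1r// subr_eq0.
Qed.

Lemma linprodE n (A : 'M[C]_n.+1) ls (M : 'M[C]_n.+1) :
  linprod A ls M = horner_mx A (\prod_(l <- ls) ('X - l%:P)) * M.
Proof.
elim: ls M => [|l ls IH] M /=; first by rewrite big_nil rmorph1 mul1r.
rewrite IH big_cons mulrC rmorphM -mulrA; congr (_ * _).
by rewrite rmorphB /= horner_mx_X horner_mx_C.
Qed.

Lemma linprodMr n k (A : 'M[C]_n) ls (M : 'M[C]_(n, k)) :
  linprod A ls M = linprod A ls 1%:M *m M.
Proof.
have H j (N : 'M[C]_(n, j)) (M' : 'M[C]_(j, k)) : linprod A ls (N *m M') = linprod A ls N *m M'.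
  by elim: ls N => //= l ls IH N; rewrite mulmxA IH.
by rewrite -H mul1mx.
Qed.

(** [ls] lists the roots of the characteristic polynomial with multiplicity, and the remainder
    vanishes by Cayley-Hamilton. The determinant clause serves [hurwitz_limit]. *)
Lemma newton_exists n (A : 'M[C]_n) : exists ls : seq C,
  [/\ size ls = n, forall l, l \in ls -> eigenvalue A l,
      (forall k (M : 'M[C]_(n, k)), linprod A ls M = 0) &
      (forall s, \det (s%:M - A) = \prod_(l <- ls) (s - l))].
Proof.
have [ls E] := closed_field_poly_normal (char_poly A).
have /monicP lc := char_poly_monic A; rewrite lc scale1r in E.
exists ls; split.
- have := size_char_poly A; rewrite E size_prod_XsubC => -[] //.
- by move=> l h; rewrite eigenvalue_root_char E root_prod_XsubC.
- move=> k M; rewrite linprodMr.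
  (* [horner_mx] needs a positive dimension. *)
  case: n A E {lc} M => [|n] A E M; first by apply/matrixP => -[].
  by rewrite linprodE -E Cayley_Hamilton mul0r mul0mx.
- move=> s; have /(congr1 (horner^~ s)) := E; rewrite horner_prod.
  under eq_bigr do rewrite hornerXsubC.
  move=> <-; rewrite /char_poly -[_.[s]]/(horner_eval s _) -det_map_mx.
  congr (\det _); apply/matrixP => i j.
  rewrite !mxE rmorphB /= /horner_eval hornerC.
  by case: (i == j); rewrite ?mulr1n ?mulr0n ?hornerX ?horner0.
Qed.

Definition resolvent n (A : 'M[R]_n) (s : C) : 'M[C]_n := invmx (s%:M - cmx A).

Lemma eigenvalue_unitmx (F : fieldType) n (A : 'M[F]_n) s :
  eigenvalue A s = ((s%:M - A) \notin unitmx).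
Proof.
rewrite -row_free_unit -kermx_eq0; apply/eigenvalueP/rowV0Pn => -[v h v0].
  exists v => //; apply/sub_kermxP.
  by rewrite mulmxBr h mul_mx_scalar subrr.
exists v => //; move/sub_kermxP: h => /eqP.
by rewrite mulmxBr mul_mx_scalar subr_eq0 => /eqP.
Qed.

Lemma eigenvalue_tr (F : fieldType) n (A : 'M[F]_n) s :
  eigenvalue A^T s = eigenvalue A s.
Proof.
by rewrite !eigenvalue_unitmx -unitmx_tr linearB /= tr_scalar_mx trmxK.
Qed.

(** [eigenvalue] speaks of row vectors, whereas the states of a system are columns. *)
Lemma eigenvalue_colP (F : fieldType) n (A : 'M[F]_n) s :
  reflect (exists2 x : 'cV[F]_n, A *m x = s *: x & x != 0) (eigenvalue A s).
Proof.
rewrite -eigenvalue_tr; apply: (iffP eigenvalueP) => -[v h v0].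
  exists v^T; last by rewrite -trmx0 (inj_eq trmx_inj).
  by rewrite -[A]trmxK -trmx_mul h linearZ.
exists v^T; last by rewrite -trmx0 (inj_eq trmx_inj).
by rewrite -trmx_mul h linearZ.
Qed.

Lemma hurwitzN n (A : 'M[R]_n) (s : C) : hurwitz A -> 0 <= complex.Re s ->
  ~~ eigenvalue (cmx A) s.
Proof. by move=> hA s0; apply/negP => /hA; rewrite ltNge s0. Qed.

Lemma hurwitz_unit n (A : 'M[R]_n) (s : C) : hurwitz A -> 0 <= complex.Re s ->
  (s%:M - cmx A) \in unitmx.
Proof. by move=> hA s0; have := hurwitzN hA s0; rewrite eigenvalue_unitmx negbK. Qed.

(** On the closed right half-plane the resolvent becomes an explicit combination of products of (s -
    l)^-1. Its boundedness, differentiability and integral are all read off this form. *)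
Lemma hurwitz_newton n (A : 'M[R]_n) : hurwitz A -> exists ls : seq C,
  [/\ size ls = n, all (fun l => complex.Re l < 0) ls &
      forall s, 0 <= complex.Re s -> resolvent A s = newton (cmx A) ls 1%:M s].
Proof.
move=> hA; have [ls [sz eigA hN _]] := newton_exists (cmx A).
exists ls; split => //; first by apply/allP => l /eigA /hA.
move=> s s0; have sls : s \notin ls.
  by apply/negP => /eigA /hA; rewrite ltNge s0.
by rewrite -[RHS](mulKmx (hurwitz_unit hA s0)) newtonP// mulmx1.
Qed.

Lemma fro_scale m n (a : C) (M : 'M[C]_(m, n)) : fro (a *: M) = Num.sqrt (nsq a) * fro M.
Proof.
rewrite -sqrtrM ?nsq_ge0//; congr Num.sqrt; rewrite /fro2 mulr_sumr.
by apply: eq_bigr => i _; rewrite mulr_sumr; apply: eq_bigr => j _; rewrite mxE nsqM.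
Qed.

(** For Re s >= 0 > Re l, |s - l| is at least - Re l. *)
Lemma newton_bounded n k (A : 'M[C]_n) ls (M : 'M[C]_(n, k)) :
  all (fun l => complex.Re l < 0) ls ->
  exists2 c, 0 <= c & forall s, 0 <= complex.Re s -> fro (newton A ls M s) <= c.
Proof.
elim: ls M => [|l ls IH] M /=.
  by move=> _; exists 0 => // s _; rewrite fro_0.
move=> /andP[l0 hls]; have [c c0 hc] := IH ((A - l%:M) *m M) hls.
exists ((- complex.Re l)^-1 * (fro M + c)).
  by rewrite mulr_ge0 ?addr_ge0 ?fro_ge0// invr_ge0 oppr_ge0 ltW.
move=> s s0; rewrite fro_scale; apply: ler_pM; rewrite ?sqrtr_ge0 ?fro_ge0//.
  rewrite nsqV sqrtrV ?nsq_ge0// lef_pV2 ?posrE ?oppr_gt0//; last first.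
    rewrite sqrtr_gt0 lt_neqAle nsq_ge0 andbT eq_sym nsq_eq0 subr_eq0.
    by apply/eqP => e; move: l0; rewrite -e ltNge s0.
  rewrite -[leLHS]gtr0_norm ?oppr_gt0// -sqrtr_sqr ler_wsqrtr// /nsq.
  apply: (@le_trans _ _ (complex.Re (s - l) ^+ 2)); last by rewrite lerDl sqr_ge0.
  have -> : complex.Re (s - l) = complex.Re s - complex.Re l by case: (s) (l) => ? ? [].
  rewrite ler_pXn2r ?nnegrE ?oppr_ge0 ?subr_ge0 ?(le_trans (ltW l0))// ?lerDr// ltW//.
by apply: le_trans (froD _ _) _; rewrite lerD2l hc.
Qed.

Lemma resolvent_bounded n (A : 'M[R]_n) : hurwitz A ->
  exists2 c, 0 <= c & forall s, 0 <= complex.Re s -> fro (resolvent A s) <= c.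
Proof.
move=> hA; have [ls [_ hls E]] := hurwitz_newton hA.
have [c c0 hc] := newton_bounded (cmx A) (1%:M : 'M[C]_n) hls.
by exists c => // s s0; rewrite E// hc.
Qed.

End Resolvent.

(** * Improper integrals along the imaginary axis *)

Section SymmetricIntegral.
Variable R : realType.
Local Notation C := R[i].

Local Notation ji := (Complex (0:R) (1:R)).

Lemma cvg_limE (F : set_system R) (l l' : R) : l = l' -> F --> l -> F --> l'.
Proof. by move=> ->. Qed.

(** A derivative in the real variable w, taken on each real component so that real calculus
    applies. *)
Definition cderive (F f : R -> C) : Prop := forall x : R,
  is_derive x 1 (fun t => complex.Re (F t)) (complex.Re (f x)) /\
  is_derive x 1 (fun t => complex.Im (F t)) (complex.Im (f x)).

Lemma ReD (x y : C) : complex.Re (x + y) = complex.Re x + complex.Re y.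
Proof. by case: x y => ? ? []. Qed.
Lemma ImD (x y : C) : complex.Im (x + y) = complex.Im x + complex.Im y.
Proof. by case: x y => ? ? []. Qed.
Lemma ReB (x y : C) : complex.Re (x - y) = complex.Re x - complex.Re y.
Proof. by case: x y => ? ? []. Qed.
Lemma ReM (x y : C) : complex.Re (x * y) =
  complex.Re x * complex.Re y - complex.Im x * complex.Im y.
Proof. by case: x y => ? ? []. Qed.
Lemma ImM (x y : C) : complex.Im (x * y) =
  complex.Re x * complex.Im y + complex.Im x * complex.Re y.
Proof. by case: x y => ? ? []. Qed.

Lemma cderive_ext F G f g : F =1 G -> f =1 g -> cderive F f -> cderive G g.
Proof. by move=> /funext-> /funext->. Qed.

Lemma cderiveD F G f g : cderive F f -> cderive G g ->
  cderive (fun x => F x + G x) (fun x => f x + g x).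
Proof.
move=> hF hG x; have [a b] := hF x; have [c d] := hG x; split.
  rewrite (_ : (fun t => _) = (fun t => complex.Re (F t)) + (fun t => complex.Re (G t))).
    by rewrite ReD; exact: is_deriveD.
  by apply/funext => t; rewrite ReD.
rewrite (_ : (fun t => _) = (fun t => complex.Im (F t)) + (fun t => complex.Im (G t))).
  by rewrite ImD; exact: is_deriveD.
by apply/funext => t; rewrite ImD.
Qed.

Lemma cderiveM F G f g : cderive F f -> cderive G g ->
  cderive (fun x => F x * G x) (fun x => f x * G x + F x * g x).
Proof.
move=> hF hG x; have [a b] := hF x; have [c d] := hG x; split.
  rewrite (_ : (fun t => _) = (fun t => complex.Re (F t)) * (fun t => complex.Re (G t))
     - (fun t => complex.Im (F t)) * (fun t => complex.Im (G t))).
    apply: is_derive_eq; rewrite ReD !ReM /GRing.scale /=; ring.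
  by apply/funext => t; rewrite ReM.
rewrite (_ : (fun t => _) = (fun t => complex.Re (F t)) * (fun t => complex.Im (G t))
     + (fun t => complex.Im (F t)) * (fun t => complex.Re (G t))).
  apply: is_derive_eq; rewrite ImD !ImM /GRing.scale /=; ring.
by apply/funext => t; rewrite ImM.
Qed.

Lemma cderive_cst c : cderive (fun=> c) (fun=> 0).
Proof. by move=> x; split; exact: is_derive_cst. Qed.

Lemma cderiveZ a F f : cderive F f -> cderive (fun x => a * F x) (fun x => a * f x).
Proof.
move=> hF; apply: cderive_ext (cderiveM (cderive_cst a) hF) => // x.
by rewrite mul0r add0r.
Qed.

Lemma cderiveV F f : (forall x, F x != 0) -> cderive F f ->
  cderive (fun x => (F x)^-1) (fun x => - f x * (F x)^-1 ^+ 2).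
Proof.
move=> F0 hF x; have [a b] := hF x.
pose n := (fun t => complex.Re (F t)) * (fun t => complex.Re (F t))
     + (fun t => complex.Im (F t)) * (fun t => complex.Im (F t)).
have nE t : n t = complex.Re (F t) ^+ 2 + complex.Im (F t) ^+ 2 by rewrite !expr2.
have n0 : n x != 0.
  by have := F0 x; rewrite -nsq_eq0 /nsq nE.
have dn : is_derive x 1 n (2 * (complex.Re (F x) * complex.Re (f x) +
   complex.Im (F x) * complex.Im (f x))).
  apply: is_derive_eq; rewrite /GRing.scale /=; ring.
have dV := is_deriveV n0 dn.
have VE t : (F t)^-1 = (complex.Re (F t) / n t) +i* (- complex.Im (F t) / n t).
  by rewrite nE; case: (F t) => u v /=; rewrite mulNr.
split.
  rewrite (_ : (fun t => _) = (fun t => complex.Re (F t)) * (fun t => (n t)^-1)).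
    apply: is_derive_eq; rewrite VE /GRing.scale /= !expr2.
    by case: (f x) (nE x) n0 => u v /= ->; move: (complex.Re (F x)) (complex.Im (F x)) => p q n0; field.

  by apply/funext => t; rewrite VE.
rewrite (_ : (fun t => _) = - (fun t => complex.Im (F t)) * (fun t => (n t)^-1)).
  apply: is_derive_eq; rewrite VE /GRing.scale /= !expr2.
  rewrite fctE; by case: (f x) (nE x) n0 => u v /= ->; move: (complex.Re (F x)) (complex.Im (F x)) => p q n0; field.
by apply/funext => t; rewrite VE.
Qed.


Lemma cderive_jw (l : C) : cderive (fun w : R => (0 +i* w) - l) (fun=> ji).
Proof.
case: l => a b x; split.
  by rewrite (_ : (fun t => _) = cst (0 - a))//; exact: is_derive_cst.
rewrite (_ : (fun t => _) = id - cst b)//.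
by apply: is_derive_eq; rewrite subr0.
Qed.

Lemma jw_neq0 (l : C) (w : R) : complex.Re l < 0 -> (0 +i* w) - l != 0 :> C.
Proof.
case: l => a b /= a0; rewrite eq_complex /= sub0r oppr_eq0 negb_and.
by rewrite lt_eqF.
Qed.

(** Each differentiation of (jw - l)^-1 brings out a factor - j; the constant j / (k + 1)
    compensates for it and for the exponent. *)
Lemma cderive_jwV_pow (l : C) k : complex.Re l < 0 ->
  cderive (fun w : R => (ji / k.+1%:R) * ((0 +i* w) - l)^-1 ^+ k.+1)
          (fun w : R => ((0 +i* w) - l)^-1 ^+ k.+2).
Proof.
move=> l0.
have d1 : cderive (fun w : R => ((0 +i* w) - l)^-1) (fun w : R => - ji * ((0 +i* w) - l)^-1 ^+ 2).
  by apply: cderiveV; [move=> x; exact: jw_neq0|exact: cderive_jw].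
have dk : cderive (fun w : R => ((0 +i* w) - l)^-1 ^+ k.+1)
    (fun w : R => - ji * k.+1%:R * ((0 +i* w) - l)^-1 ^+ k.+2).
  elim: k => [|k IH]; first by apply: cderive_ext d1 => // x; rewrite mulr1.
  apply: cderive_ext (cderiveM d1 IH) => [x|x]; first by rewrite -exprS.
  rewrite -[k.+2%:R]natr1; set u := _^-1; rewrite !exprS; ring.
apply: cderive_ext (cderiveZ (ji / k.+1%:R) dk) => // x.
rewrite [LHS]mulrA [X in X * _](_ : _ = 1) ?mul1r//.
have k0 : (k.+1%:R : C) != 0 by rewrite pnatr_eq0.
transitivity (- (ji * ji) * (k.+1%:R / k.+1%:R)); first by ring.
by rewrite divff// mulr1 -expr2 sqr_i opprK.
Qed.

(* The principal value of the integral of [f] over R is [L]. *)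
Definition symint (f : R -> C) (L : C) : Prop := exists F,
  [/\ cderive F f,
   (complex.Re (F x) - complex.Re (F (- x))) @[x --> +oo] --> complex.Re L &
   (complex.Im (F x) - complex.Im (F (- x))) @[x --> +oo] --> complex.Im L].

Lemma symint_ext f g L : f =1 g -> symint f L -> symint g L.
Proof. by move=> /funext->. Qed.

Lemma symintD f g L M : symint f L -> symint g M ->
  symint (fun x => f x + g x) (L + M).
Proof.
move=> [F [dF aF bF]] [G [dG aG bG]]; exists (fun x => F x + G x); split.
- exact: cderiveD.
- rewrite ReD; under eq_fun do rewrite !ReD opprD addrACA.
  exact: cvgD.
- rewrite ImD; under eq_fun do rewrite !ImD opprD addrACA.
  exact: cvgD.
Qed.

Lemma symintZ a f L : symint f L -> symint (fun x => a * f x) (a * L).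
Proof.
move=> [F [dF aF bF]]; exists (fun x => a * F x); split.
- exact: cderiveZ.
- rewrite ReM [X in X @ _](_ : _ = (fun x => complex.Re a * (complex.Re (F x) - complex.Re (F (- x)))
   - complex.Im a * (complex.Im (F x) - complex.Im (F (- x))))).
    by apply: cvgB; apply: cvgMr.
  by apply/funext => x; rewrite !ReM; ring.
- rewrite ImM [X in X @ _](_ : _ = (fun x => complex.Re a * (complex.Im (F x) - complex.Im (F (- x)))
   + complex.Im a * (complex.Re (F x) - complex.Re (F (- x))))).
    by apply: cvgD; apply: cvgMr.
  by apply/funext => x; rewrite !ImM; ring.
Qed.

Lemma symint0 : symint (fun=> 0) 0.
Proof.
exists (fun=> 0); split; first exact: cderive_cst.
  by rewrite /= subr0; exact: cvg_cst.
by rewrite /= subr0; exact: cvg_cst.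
Qed.

Lemma symint_sum (I : Type) (r : seq I) (f : I -> R -> C) (L : I -> C) :
  (forall i, symint (f i) (L i)) ->
  symint (fun x => \sum_(i <- r) f i x) (\sum_(i <- r) L i).
Proof.
move=> h; elim: r => [|i r IH].
  rewrite big_nil; apply: symint_ext symint0 => x; by rewrite big_nil.
by rewrite big_cons; apply: symint_ext (symintD (h i) IH) => x; rewrite big_cons.
Qed.

Lemma cvg_nsq0 (F : R -> C) : nsq (F x) @[x --> +oo] --> 0 ->
  complex.Re (F x) @[x --> +oo] --> 0 /\ complex.Im (F x) @[x --> +oo] --> 0.
Proof.
move=> h; have H e : 0 < e -> \forall x \near +oo, nsq (F x) <= e ^+ 2.
  move=> e0; have e2 : 0 < e ^+ 2 by exact: exprn_gt0.
  move/cvgr0Pnorm_le : h => /(_ _ e2); apply: filterS => x.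
  by rewrite ger0_norm ?nsq_ge0.
by split; apply/cvgr0Pnorm_le => e e0; apply: filterS (H _ e0) => x hx;
  have [] := nsq_le_sqr (ltW e0) hx.
Qed.

(** At both ends |jw - l|^2 dominates the square of a shift of the variable. *)
Lemma cvg_nsq_jwV (l : C) : nsq (((0 +i* x) - l)^-1) @[x --> +oo] --> 0 /\
  nsq (((0 +i* (- x)) - l)^-1) @[x --> +oo] --> 0.
Proof.
suff H (b : R) (u : R -> R) : (forall x, (x - b) ^+ 2 <= u x) ->
    (u x)^-1 @[x --> +oo] --> 0.
  split; under eq_fun do rewrite nsqV.
    apply: (H (complex.Im l)) => x; case: l => a b; rewrite /nsq /=.
    by rewrite lerDr sqr_ge0.
  apply: (H (- complex.Im l)) => x; case: l => a b; rewrite /nsq /=.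
  have -> : (x - - b) ^+ 2 = (- x - b) ^+ 2 by ring.
  by rewrite lerDr sqr_ge0.
move=> hu; apply/cvgr0Pnorm_le => e e0.
near=> x.
have xb : 1 <= x - b by rewrite lerBrDr; near: x; exact: (nbhs_pinfty_ge (num_real _)).
have xe : e^-1 <= x - b by rewrite lerBrDr; near: x; exact: (nbhs_pinfty_ge (num_real _)).
have h : e^-1 <= u x.
  apply: le_trans (hu x); apply: (le_trans xe).
  by rewrite expr2 ler_peMr// (le_trans ler01).
have u0 : 0 < u x by apply: lt_le_trans h; rewrite invr_gt0.
rewrite ger0_norm; last by rewrite invr_ge0 ltW.
by rewrite -[X in _ <= X]invrK lef_pV2 ?posrE ?invr_gt0.
Unshelve. all: by end_near. Qed.

Lemma symint_pow (l : C) k : complex.Re l < 0 ->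
  symint (fun w : R => ((0 +i* w) - l)^-1 ^+ k.+2) 0.
Proof.
move=> l0; have [z1 z2] := cvg_nsq_jwV l.
have Z (u : R -> R) : nsq (((0 +i* (u x)) - l)^-1) @[x --> +oo] --> 0 ->
    nsq (ji / k.+1%:R * ((0 +i* (u x)) - l)^-1 ^+ k.+1) @[x --> +oo] --> 0.
  move=> hu; under eq_fun do rewrite nsqM.
  rewrite -[X in nbhs X](mulr0 (nsq (ji / k.+1%:R))); apply: cvgMr.
  elim: (k) => [|i IH]; first by under eq_fun do rewrite expr1.
  under eq_fun do rewrite exprS nsqM.
  by rewrite -[X in nbhs X](mulr0 0); exact: cvgM.
have [a1 b1] := cvg_nsq0 (Z _ z1); have [a2 b2] := cvg_nsq0 (Z _ z2).
eexists; split; first exact: cderive_jwV_pow.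
  by have h := cvgB a1 a2; rewrite subr0 in h; exact: h.
by have h := cvgB b1 b2; rewrite subr0 in h; exact: h.
Qed.

(** A primitive is an arctangent plus i times a logarithm. The arctangent contributes pi / 2 at each
    end, and the logarithms at x and - x cancel in the limit. *)
Lemma symint_one (l : C) : complex.Re l < 0 ->
  symint (fun w : R => ((0 +i* w) - l)^-1) (pi%:C).
Proof.
case: l => a b /= a0; have na0 : - a != 0 by rewrite oppr_eq0 lt_eqF.
have den (x : R) : 0 < a ^+ 2 + (x - b) ^+ 2.
  by rewrite ltr_pwDl ?sqr_ge0// exprn_even_gt0//= lt_eqF.
pose F x : C := (atan ((x - b) / (- a))) +i* (- (2^-1 * ln (a ^+ 2 + (x - b) ^+ 2))).
exists F; split.
- have VE t : ((0 +i* t) - (a +i* b))^-1 =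
    (- a / (a ^+ 2 + (t - b) ^+ 2)) +i* (- (t - b) / (a ^+ 2 + (t - b) ^+ 2)).
    rewrite (_ : (0 +i* t) - (a +i* b) = (- a) +i* (t - b)); last first.
      by apply/eqP; rewrite eq_complex /= sub0r !eqxx.
    have VC (u v : R) : (u +i* v)^-1 = (u / (u ^+ 2 + v ^+ 2)) +i* (- v / (u ^+ 2 + v ^+ 2)).
      by rewrite mulNr.
    by rewrite VC sqrrN.
  move=> x; rewrite VE; split => /=.
    have d1 : is_derive x 1 (fun t : R => (t - b) / (- a)) ((- a)^-1).
      rewrite (_ : (fun t => _) = (id - cst b) * cst ((- a)^-1)); last exact/funext.
      by apply: is_derive_eq; rewrite /GRing.scale /= mulr0 add0r subr0 mulr1.
    have d2 := is_derive1_comp (is_derive1_atan _) d1.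
    apply: (is_derive_eq d2).
    rewrite expr_div_n; move: (den x); move: (x - b) => y dy; field.
    by rewrite lt0r_neq0// lt_eqF.
  have d1 : is_derive x 1 (fun t : R => a ^+ 2 + (t - b) ^+ 2) (2 * (x - b)).
    rewrite (_ : (fun t => _) = cst (a ^+ 2) + (id - cst b) ^+ 2); last first.
      by apply/funext => t; rewrite fctE /=.
    apply: is_derive_eq; rewrite /GRing.scale /= add0r subr0 mulr1 expr1.
    by rewrite fctE.
  have d2 := @is_derive1_comp _ (@ln R) (fun t : R => a ^+ 2 + (t - b) ^+ 2) _ _ _ (is_derive1_ln (den x)) d1.
  rewrite (_ : (fun t => _) = - (cst 2^-1 * (@ln R \o (fun t : R => a ^+ 2 + (t - b) ^+ 2)))).
    apply: is_derive_eq; rewrite /GRing.scale /= mulr0 addr0.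
    move: (den x); move: (x - b) => y dy; field; exact: lt0r_neq0.
  by apply/funext.
- rewrite /=.
  have u1 : (x - b) / (- a) @[x --> +oo] --> +oo.
    apply: gt0_cvgMly; first by rewrite invr_gt0 oppr_gt0.
    exact: cvg_addrr.
  have u2 : (x + b) / (- a) @[x --> +oo] --> +oo.
    by apply: gt0_cvgMly; [by rewrite invr_gt0 oppr_gt0|exact: cvg_addrr].
  have c1 := cvg_comp _ _ u1 (@cvgy_atan R).
  have c2 := cvg_comp _ _ u2 (@cvgy_atan R).
  have -> : pi = pi / 2 + pi / 2 :> R by field.
  rewrite [X in X @ _](_ : _ = (fun x => atan ((x - b) / - a) + atan ((x + b) / - a))).
    exact: cvgD.
  by apply/funext => x; rewrite -atanN -mulNr opprB opprK [b + x]addrC.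
- rewrite /=.
  have c : (a ^+ 2 + (x - b) ^+ 2) / (a ^+ 2 + (- x - b) ^+ 2) @[x --> +oo] --> (1 : R).
    rewrite [X in X @ _](_ : _ = (fun x => 1 - 4 * x * b / (a ^+ 2 + (x + b) ^+ 2))); last first.
      apply/funext => x; have -> : (- x - b) ^+ 2 = (x + b) ^+ 2 by ring.
      have := den (- x); have -> : (- x - b) ^+ 2 = (x + b) ^+ 2 by ring.
      by move=> /lt0r_neq0 h; field.
    apply: (cvg_limE (subr0 1)); apply: cvgB; first exact: cvg_cst.
    apply/cvgr0Pnorm_le => e e0; near=> x.
    have x1 : 1 <= x by near: x; exact: (nbhs_pinfty_ge (num_real _)).
    (* This gives x + b >= x / 2, so the denominator is at least x^2 / 4 and the fraction is at most
       16 |b| / x; hence the next threshold. *)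
    have xb : 2 * `|b| <= x by near: x; exact: (nbhs_pinfty_ge (num_real _)).
    have xe : 16 * `|b| / e <= x by near: x; exact: (nbhs_pinfty_ge (num_real _)).
    rewrite ler_pdivrMr// in xe.
    have xp : 0 < x by apply: lt_le_trans x1.
    have h0 : x / 2 <= x + b by have := ler_norm (- b); rewrite normrN; lra.
    have h : x ^+ 2 / 4 <= a ^+ 2 + (x + b) ^+ 2.
      apply: (@le_trans _ _ ((x / 2) ^+ 2)); first by rewrite expr_div_n; lra.
      apply: (@le_trans _ _ ((x + b) ^+ 2)); last by rewrite lerDr sqr_ge0.
      by rewrite ler_pXn2r ?nnegrE//; lra.
    have hp : 0 < a ^+ 2 + (x + b) ^+ 2 by apply: lt_le_trans h; nra.
    rewrite !normrM normfV (gtr0_norm hp) (gtr0_norm xp) [ `|4|]ger0_norm//.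
    rewrite ler_pdivrMr//; apply: (@le_trans _ _ (e * (x ^+ 2 / 4))); last first.
      by rewrite ler_pM2l.
    by rewrite expr2; nra.
  rewrite [X in X @ _](_ : _ = (fun x => - (2^-1) *
     ln ((a ^+ 2 + (x - b) ^+ 2) / (a ^+ 2 + (- x - b) ^+ 2)))); last first.
    by apply/funext => x; rewrite ln_div ?posrE//; ring.
  apply: (cvg_limE (mulr0 (- (2^-1)))); rewrite -(@ln1 R); apply: cvgMr.
  by apply: (cvg_comp _ _ c); apply: continuous_ln.
Unshelve. all: by end_near. Qed.

End SymmetricIntegral.

(** * The principal value of the resolvent integral, and its passage to the Lebesgue integral *)

Section ResolventIntegral.
Variable R : realType.
Local Notation C := R[i].

(** Only a single factor contributes. If two poles a and b differ, (s - a)^-1 (s - b)^-1 = (a -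
    b)^-1 ((s - a)^-1 - (s - b)^-1) leaves two shorter products with equal integrals; if all
    coincide, a power has a primitive vanishing at infinity. *)
Lemma symint_prod n (ls : seq C) : size ls = n.+1 ->
  all (fun l => complex.Re l < 0) ls ->
  symint (fun w : R => \prod_(l <- ls) ((0 +i* w) - l)^-1)
    (if n is 0 then (pi : R)%:C else 0).
Proof.
elim: n ls => [|n IH] ls.
  case: ls => [//|l [|//]] _ /= /andP[l0 _].
  by apply: symint_ext (symint_one l0) => w; rewrite big_seq1.
case: ls => [//|a ls] [sz] /= /andP[a0 hls].
have [hal|] := boolP (all (pred1 a) ls).
  have E : ls = nseq n.+1 a by rewrite -sz; apply/all_pred1P.
  apply: symint_ext (symint_pow n a0) => w.
  by rewrite E big_cons big_nseq iter_mulr_1 -exprS.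
move=> /allPn[b bls]; rewrite /= => ba.
have pls : perm_eq ls (b :: rem b ls) by exact: perm_to_rem.
have hls' := hls; rewrite (perm_all _ pls) /= in hls'.
case/andP: hls' => b0 hrem.
have szr : size (rem b ls) = n by rewrite size_rem// sz.
have Ia : symint _ _ := IH (a :: rem b ls) _ _.
have {}Ia := Ia (congr1 S szr) (introT andP (conj a0 hrem)).
have Ib := IH (b :: rem b ls) (congr1 S szr) (introT andP (conj b0 hrem)).
have := symintZ ((a - b)^-1) (symintD Ia (symintZ (-1) Ib)).
rewrite mulN1r subrr mulr0; apply: symint_ext => w.
rewrite [RHS]big_cons [in RHS](perm_big _ pls)/= !big_cons mulN1r -mulrBl !mulrA; congr (_ * _).
have h1 := jw_neq0 w a0; have h2 := jw_neq0 w b0.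
have h3 : a - b != 0 by rewrite subr_eq0 eq_sym.
move: (0 +i* w) h1 h2 => s h1 h2.
by field; rewrite ?h1 ?h2 ?h3.
Qed.

(** [pre] collects the factors already met in the recursion. Every term after the leading one has at
    least two factors and integrates to 0. *)
Lemma symint_newton n k (A : 'M[C]_n) ls pre (M : 'M[C]_(n, k)) i j :
  all (fun l => complex.Re l < 0) pre -> all (fun l => complex.Re l < 0) ls ->
  symint (fun w : R => \prod_(l <- pre) ((0 +i* w) - l)^-1 * newton A ls M (0 +i* w) i j)
    (if (pre == [::]) && (ls != [::]) then (pi : R)%:C * M i j else 0).
Proof.
elim: ls pre M => [|l ls IH] pre M hpre /=.
  move=> _; rewrite andbF; apply: symint_ext (@symint0 R) => w.
  by rewrite mxE mulr0.
move=> /andP[l0 hls]; rewrite andbT.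
have h1 : all (fun l => complex.Re l < 0) (l :: pre) by rewrite /= l0.
have h2 := IH (l :: pre) ((A - l%:M) *m M) h1 hls.
have h3 := symint_prod (erefl (size (l :: pre))) h1.
have := symintD (symintZ (M i j) h3) h2; rewrite /= addr0.
have -> : M i j * (match size pre with 0 => (pi : R)%:C | _.+1 => 0 end) =
   (if pre == [::] then (pi : R)%:C * M i j else 0).
  by case: (pre) => [|? ?] /=; rewrite ?mulr0 1?mulrC.
apply: symint_ext => w; rewrite !big_cons !mxE; ring.
Qed.

Lemma symint_resolvent n (A : 'M[R]_n) i j : hurwitz A ->
  symint (fun w : R => resolvent A (0 +i* w) i j) ((pi : R)%:C * (i == j)%:R).
Proof.
move=> /hurwitz_newton[ls [sz hls E]].
have := @symint_newton _ _ (cmx A) ls [::] 1%:M i j isT hls.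
(* The index i forces a positive dimension. *)
have -> /= : ls != [::] by case: n A i j sz {E} => [? []//|n] A i j; case: (ls).
rewrite mxE; apply: symint_ext => w.
by rewrite big_nil mul1r E.
Qed.

Definition cdiff (f : R -> C) := exists f', cderive f f'.

Lemma cdiff_ext f g : f =1 g -> cdiff f -> cdiff g.
Proof. by move=> /funext->. Qed.

Lemma cdiff_cst c : cdiff (fun=> c).
Proof. by exists (fun=> 0); exact: cderive_cst. Qed.

Lemma cdiffD f g : cdiff f -> cdiff g -> cdiff (fun x => f x + g x).
Proof. by move=> [f' hf] [g' hg]; eexists; exact: cderiveD hf hg. Qed.

Lemma cdiffM f g : cdiff f -> cdiff g -> cdiff (fun x => f x * g x).
Proof. by move=> [f' hf] [g' hg]; eexists; exact: cderiveM hf hg. Qed.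

Lemma cdiff_sum (I : Type) (r : seq I) (f : I -> R -> C) :
  (forall i, cdiff (f i)) -> cdiff (fun x => \sum_(i <- r) f i x).
Proof.
move=> h; elim: r => [|i r IH].
  by apply: cdiff_ext (cdiff_cst 0) => x; rewrite big_nil.
by apply: cdiff_ext (cdiffD (h i) IH) => x; rewrite big_cons.
Qed.

Definition mxcdiff m n (F : R -> 'M[C]_(m, n)) := forall i j, cdiff (fun x => F x i j).

Lemma mxcdiff_cst m n (M : 'M[C]_(m, n)) : mxcdiff (fun=> M).
Proof. by move=> i j; exact: cdiff_cst. Qed.

Lemma mxcdiffM m n k F G : @mxcdiff m n F -> @mxcdiff n k G ->
  mxcdiff (fun x => F x *m G x).
Proof.
move=> hF hG i j; apply: (@cdiff_ext (fun x => \sum_l F x i l * G x l j)).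
  by move=> x; rewrite mxE.
by apply: cdiff_sum => l; exact: cdiffM.
Qed.

Lemma mxcdiff_newton n k (A : 'M[C]_n) ls (M : 'M[C]_(n, k)) :
  all (fun l => complex.Re l < 0) ls ->
  mxcdiff (fun w => newton A ls M (0 +i* w)).
Proof.
elim: ls M => [|l ls IH] M /=; first by move=> _; exact: mxcdiff_cst.
move=> /andP[l0 hls] i j.
apply: (@cdiff_ext (fun w : R => ((0 +i* w) - l)^-1 *
  (M i j + newton A ls ((A - l%:M) *m M) (0 +i* w) i j))).
  by move=> w; rewrite !mxE.
apply: cdiffM; last by apply: cdiffD; [exact: cdiff_cst|exact: IH].
eexists; apply: cderiveV; last exact: cderive_jw.
by move=> w; exact: jw_neq0.
Qed.

Lemma mxcdiff_resolvent n (A : 'M[R]_n) : hurwitz A ->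
  mxcdiff (fun w => resolvent A (0 +i* w)).
Proof.
move=> /hurwitz_newton[ls [_ hls E]].
have h := mxcdiff_newton (cmx A) (1%:M : 'M[C]_n) hls.
by move=> i j; apply: cdiff_ext (h i j) => w; rewrite E.
Qed.

Lemma cdiff_continuous f : cdiff f ->
  continuous (fun x => complex.Re (f x)) /\ continuous (fun x => complex.Im (f x)).
Proof.
by move=> [f' h]; split => x; have [d1 d2] := h x;
  apply: differentiable_continuous; apply/derivable1_diffP; case: d1 d2 => d1 _ [].
Qed.

Lemma continuous_sum_seq (I : Type) (r : seq I) (f : I -> R -> R) :
  (forall i, continuous (f i)) -> continuous (fun x => \sum_(i <- r) f i x).
Proof.
move=> h; elim: r => [|i r IH].
  rewrite (_ : (fun x => _) = cst 0); first by move=> x; exact: cvg_cst.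
  by apply/funext => y; rewrite big_nil.
rewrite (_ : (fun x => _) = (fun x => f i x + \sum_(j <- r) f j x)).
  by move=> x; apply: cvgD; [exact: h|exact: IH].
by apply/funext => y; rewrite big_cons.
Qed.

Lemma mxcdiff_fro2 m n F : @mxcdiff m n F -> continuous (fun x => fro2 (F x)).
Proof.
move=> hF; have c i j : continuous (fun x => nsq (F x i j)).
  have [c1 c2] := cdiff_continuous (hF i j) => x.
  by apply: cvgD; (rewrite expr2; under eq_fun do rewrite expr2; apply: cvgM; [exact: c1||exact: c2|exact: c1||exact: c2]).
by apply: continuous_sum_seq => i; exact: continuous_sum_seq.
Qed.

(** For a nonnegative even function the principal value is the Lebesgue integral: twice the integral
    over the half-line, where (F x - F (- x)) / 2 is a primitive vanishing at 0. *)
Lemma ge0_even_integral (f F : R -> R) (l : R) :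
  (forall x, 0 <= f x) -> continuous f -> (forall x, f (- x) = f x) ->
  (forall x : R, is_derive x 1 F (f x)) ->
  F x - F (- x) @[x --> +oo] --> l ->
  (\int[lebesgue_measure]_(x in [set: R]) (f x)%:E)%E = l%:E.
Proof.
move=> f0 cf fe dF Fl.
have fe' : f =1 f \o -%R by move=> x; rewrite /= fe.
rewrite (ge0_symfun_integralT f0 cf fe').
pose G x := 2^-1 * (F x - F (- x)).
have dG (x : R) : is_derive x 1 G (f x).
  have dN : is_derive x 1 (fun y : R => F (- y)) (- f x).
    have h := @is_derive1_comp _ F -%R x (f (- x)) (-1) (dF (- x)) (is_deriveNid _ _).
    by apply: (is_derive_eq h); rewrite fe mulrN1.
  rewrite (_ : G = 2^-1 *: (F - (fun y : R => F (- y)))); last exact/funext.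
  by apply: is_derive_eq; rewrite /GRing.scale /=; field.
have lG : G x @[x --> +oo] --> 2^-1 * l by apply: cvgMr.
rewrite (_ : [set x : R | 0 <= x] = `[0, +oo[%classic); last by rewrite set_itvcy.
rewrite (@ge0_continuous_FTC2y _ f G 0 (2^-1 * l))//.
- by rewrite /G oppr0 subrr mulr0 sube0 -EFinM; congr EFin; field.
- exact: continuous_subspaceT.
- apply: cvg_at_right_filter; apply: differentiable_continuous; apply/derivable1_diffP.
  by case: (dG 0).
- by move=> x _; rewrite derive1E; case: (dG x).
Qed.
End ResolventIntegral.

(** * Lyapunov equation and the H2 norm *)

Section Lyapunov.
Variable R : realType.
Local Notation C := R[i].

(* Cayley-Hamilton, one eigenvalue of [A] at a time. *)
Lemma sylvester_inj n (A : 'M[R]_n) (P : 'M[C]_n) : hurwitz A ->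
  cmx A *m P + P *m cmx A^T = 0 -> P = 0.
Proof.
move=> hA; have [ls [_ eigA /(_ n) hls _]] := newton_exists (cmx A).
have {}eigA : all (fun l => complex.Re l < 0) ls by apply/allP => l /eigA /hA.
move: (hls P) => {hls}.
elim: ls P eigA => [|l ls IH] P //= /andP[l0 hls] h0 hP.
(* The equation moves the factor A - l to the right of P, where it becomes - l - A^T, invertible
   since - l lies in the right half-plane. The product satisfies the same equation with one
   eigenvalue fewer, so it vanishes by induction. *)
have E : (cmx A - l%:M) *m P = P *m (- l%:M - cmx A^T).
  have /eqP : cmx A *m P = - (P *m cmx A^T) by apply/eqP; rewrite -addr_eq0 hP.
  rewrite mulmxBl mulmxBr mulmxN mul_mx_scalar mul_scalar_mx => /eqP->.
  by rewrite addrC.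
have : (cmx A - l%:M) *m P = 0.
  apply: (IH _ hls h0).
  rewrite {2}E; have -> : P *m (- l%:M - cmx A^T) *m cmx A^T =
      P *m cmx A^T *m (- l%:M - cmx A^T).
    by rewrite -!mulmxA; congr (_ *m _); rewrite mulmxBr mulmxBl mulmxN mulNmx scalar_mxC.
  have -> : cmx A *m ((cmx A - l%:M) *m P) = cmx A *m P *m (- l%:M - cmx A^T).
    by rewrite E mulmxA.
  by rewrite -mulmxDl hP mul0mx.
rewrite E => h.
have U : (- l%:M - cmx A^T) \in unitmx.
  rewrite -[_ - _]trmxK unitmx_tr linearB /= linearN /= tr_scalar_mx.
  rewrite (_ : (cmx A^T)^T = cmx A); last by apply/matrixP => i j; rewrite !mxE.
  have -> : - l%:M = (- l)%:M :> 'M[C]_n by rewrite raddfN.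
  by apply: (hurwitz_unit hA); case: (l) l0 => a b /= a0; rewrite oppr_ge0 ltW.
by rewrite -(mulmxK U P) h mul0mx.
Qed.

(** The Lyapunov operator is an injective endomorphism of a finite-dimensional space, hence
    bijective. Uniqueness applied to the transpose gives symmetry. *)
Lemma lyapunov_solution n (A Q : 'M[R]_n) : hurwitz A -> Q^T = Q ->
  exists2 P : 'M[R]_n, P^T = P & A *m P + P *m A^T + Q = 0.
Proof.
move=> hA QT.
pose N := lin_mulmx A + lin_mulmxr A^T : 'M[R]_(n * n).
have NE P : mxvec P *m N = mxvec (A *m P + P *m A^T).
  by rewrite mulmxDr !mul_vec_lin linearD.
have inj P : A *m P + P *m A^T = 0 -> P = 0.
  move=> h; suff : cmx P = 0.
    move=> h'; apply/matrixP => i j; have /matrixP/(_ i j) := h'.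
    by rewrite !mxE => -[].
  apply: (sylvester_inj hA).
  by rewrite /cmx -!map_mxM -map_mxD h map_mx0.
have NU : N \in unitmx.
  rewrite -row_free_unit -kermx_eq0; apply/negPn/negP => /rowV0Pn[v /sub_kermxP vN v0].
  have h : vec_mx v = 0.
    by apply: inj; apply: (can_inj mxvecK); rewrite -NE vec_mxK vN linear0.
  by move: v0; rewrite -[v]vec_mxK h linear0 eqxx.
have [P hP] : exists P, A *m P + P *m A^T + Q = 0.
  exists (vec_mx (mxvec (- Q) *m invmx N)).
  set P := vec_mx _; have : mxvec P *m N = mxvec (- Q).
    by rewrite vec_mxK mulmxKV.
  by rewrite NE => /(can_inj mxvecK)->; rewrite addNr.
exists P => //; apply/eqP; rewrite -subr_eq0; apply/eqP/inj.
have /(congr1 trmx) := hP; rewrite !linearD /= !trmx_mul !trmxK QT linear0.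
rewrite -[RHS]hP [X in X + Q = _]addrC => /addIr h.
by rewrite mulmxN mulmxBl addrACA -opprD h subrr.
Qed.

(** The value at jw computed from the realization, free of the lowest-terms convention of [freq];
    [freq_tf] identifies the two for stable systems. *)
Definition freqresp m p n (S : lti R m p n) (w : R) : 'M[C]_(p, m) :=
  cmx (ssC S) *m resolvent (ssA S) (0 +i* w) *m cmx (ssB S).

Lemma cmxM m n k (A : 'M[R]_(m, n)) (B : 'M[R]_(n, k)) : cmx (A *m B) = cmx A *m cmx B.
Proof. exact: map_mxM. Qed.
Lemma cmxD m n (A B : 'M[R]_(m, n)) : cmx (A + B) = cmx A + cmx B.
Proof. exact: map_mxD. Qed.

Lemma cmxN m n (A : 'M[R]_(m, n)) : cmx (- A) = - cmx A.
Proof. exact: map_mxN. Qed.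

Lemma conj_jw (w : R) : conjc (0 +i* w) = - (0 +i* w).
Proof. by apply/eqP; rewrite eq_complex /= oppr0 !eqxx. Qed.

Lemma jw_conj (w : R) : 0 +i* (- w) = conjc (0 +i* w).
Proof. by []. Qed.

Lemma resolvent_conj n (A : 'M[R]_n) s :
  map_mx (@conjc R) (resolvent A s) = resolvent A (conjc s).
Proof.
rewrite /resolvent map_invmx map_mxB map_scalar_mx; congr (invmx (_ - _)).
apply/matrixP => i j; rewrite !mxE. exact: conjc_real.
Qed.

Lemma freqrespN m p n (S : lti R m p n) w :
  freqresp S (- w) = map_mx (@conjc R) (freqresp S w).
Proof.
rewrite /freqresp !map_mxM resolvent_conj -jw_conj.
by congr (_ *m _ *m _); apply/matrixP => i j; rewrite !mxE; exact: esym (conjc_real _).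
Qed.

Lemma fro2_conj m n (M : 'M[C]_(m, n)) : fro2 (map_mx (@conjc R) M) = fro2 M.
Proof.
by apply: eq_bigr => i _; apply: eq_bigr => j _; rewrite mxE nsq_conj.
Qed.

(** On the axis s P and its conjugate cancel, so B B^T = (s - A) P + P (s - A)^H. Multiplying by the
    resolvent on the left and its adjoint on the right leaves a sum linear in the resolvent. *)
Lemma fro2_freqresp m p n (S : lti R m p n) (P : 'M[R]_n) w :
  hurwitz (ssA S) -> P^T = P ->
  ssA S *m P + P *m (ssA S)^T + ssB S *m (ssB S)^T = 0 ->
  fro2 (freqresp S w) = 2 * complex.Re
    (\tr (resolvent (ssA S) (0 +i* w) *m cmx (P *m (ssC S)^T *m ssC S))).
Proof.
move=> hA PT hP; case: S hA hP => A B C0 /= hA hP.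
set Rs := resolvent A _; set s := 0 +i* w.
have U : s%:M - cmx A \in unitmx by apply: hurwitz_unit.
have E : cmx (B *m B^T) = (s%:M - cmx A) *m cmx P + cmx P *m hadj (s%:M - cmx A).
  rewrite hadjB hadj_scalar hadj_cmx conj_jw mulmxBl mulmxBr.
  rewrite mul_scalar_mx mul_mx_scalar scaleNr -!cmxM addrACA subrr add0r.
  have -> : B *m B^T = - (A *m P + P *m A^T) by apply/eqP; rewrite -addr_eq0 addrC hP.
  by rewrite -opprD -cmxD cmxN.
apply: complexI; rewrite -fro2_hadj fro2_tr hadjK /freqresp /=.
have -> : cmx C0 *m Rs *m cmx B *m hadj (cmx C0 *m Rs *m cmx B) =
    cmx C0 *m (Rs *m cmx (B *m B^T) *m hadj Rs) *m hadj (cmx C0).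
  by rewrite !hadjM hadj_cmx cmxM !mulmxA.
have -> : Rs *m cmx (B *m B^T) *m hadj Rs = cmx P *m hadj Rs + Rs *m cmx P.
  rewrite E mulmxDr mulmxDl /Rs /resolvent mulKmx//; congr (_ + _).
  rewrite -!mulmxA -hadjM mulVmx// hadj_scalar rmorph1 mulmx1//.
rewrite mulmxDr mulmxDl mxtraceD.
have -> : cmx C0 *m (Rs *m cmx P) *m hadj (cmx C0) = cmx C0 *m Rs *m cmx P *m cmx C0^T.
  by rewrite hadj_cmx !mulmxA.
have -> : cmx C0 *m (cmx P *m hadj Rs) *m hadj (cmx C0) =
   hadj (cmx C0 *m Rs *m cmx P *m cmx C0^T).
  by rewrite !hadjM !hadj_cmx trmxK PT !mulmxA.
have -> (M : 'M[C]_p) : \tr (hadj M) = conjc (\tr M).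
  by rewrite /mxtrace rmorph_sum /=; apply: eq_bigr => i _; rewrite hadjE.
have -> : \tr (cmx C0 *m Rs *m cmx P *m cmx C0^T) = \tr (Rs *m cmx (P *m C0^T *m C0)).
  by rewrite -!mulmxA mxtrace_mulC !cmxM !mulmxA.
rewrite addrC addcJ real_complexM; congr (_ * _).
by rewrite rmorphMn rmorph1.
Qed.

Lemma mxcdiff_freqresp m p n (S : lti R m p n) : hurwitz (ssA S) ->
  mxcdiff (freqresp S).
Proof.
move=> hA; apply: mxcdiffM; last exact: mxcdiff_cst.
by apply: mxcdiffM; [exact: mxcdiff_cst|exact: mxcdiff_resolvent].
Qed.

Lemma integral_freqresp m p n (S : lti R m p n) (P : 'M[R]_n) :
  hurwitz (ssA S) -> P^T = P ->
  ssA S *m P + P *m (ssA S)^T + ssB S *m (ssB S)^T = 0 ->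
  (\int[lebesgue_measure]_(w in [set: R]) (fro2 (freqresp S w))%:E)%E =
  (2 * pi * \tr (ssC S *m P *m (ssC S)^T))%:E.
Proof.
move=> hA PT hP.
pose Z := cmx (P *m (ssC S)^T *m ssC S).
have : symint (fun w : R => \sum_i \sum_j (Z j i * resolvent (ssA S) (0 +i* w) i j))
    (\sum_i \sum_j (Z j i * ((pi : R)%:C * (i == j)%:R))).
  by do 2![apply: symint_sum => ?]; apply: symintZ; exact: symint_resolvent.
have -> : \sum_i \sum_j (Z j i * ((pi : R)%:C * (i == j)%:R)) =
    (pi * \tr (ssC S *m P *m (ssC S)^T))%:C.
  rewrite -mulmxA mxtrace_mulC /mxtrace real_complexM real_complex_sum mulr_sumr.
  apply: eq_bigr => i _; rewrite (bigD1 i)//= big1 ?addr0; last first.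
    by move=> j ji; rewrite eq_sym (negbTE ji) !mulr0.
  by rewrite eqxx mulr1 mulrC /Z /cmx [in LHS]mxE.
move=> [F [dF Fl _]].
apply: (@ge0_even_integral _ _ (fun x => 2 * complex.Re (F x))).
- by move=> x; exact: fro2_ge0.
- exact: mxcdiff_fro2 (mxcdiff_freqresp hA).
- by move=> x; rewrite freqrespN fro2_conj.
- move=> x; have [d _] := dF x.
  rewrite (fro2_freqresp _ hA PT hP).
  rewrite (_ : \tr _ = \sum_i \sum_j (Z j i * resolvent (ssA S) (0 +i* x) i j)).
    exact: is_deriveZ.
  rewrite /mxtrace; apply: eq_bigr => i _; rewrite mxE.
  by apply: eq_bigr => j _; rewrite mulrC.
- under eq_fun do rewrite -mulrBr.
  by rewrite -mulrA; apply: cvgMr.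
Qed.

End Lyapunov.

(** * Evaluation of rational matrices *)

Section RationalEvaluation.
Local Open Scope quotient_scope.
Variable R : realType.
Local Notation C := R[i].
Local Notation F := {fraction {poly R}}.
Local Notation tofrac := (@FracField.tofrac {poly R}).

Lemma frac_reprE (x : F) :
  x * tofrac (frac (repr x)).2 = tofrac (frac (repr x)).1.
Proof.
rewrite -{1}[x]reprK; move: (repr x) => r; unlock FracField.tofrac.
rewrite -[LHS]FracField.pi_mul; apply/eqmodP; rewrite /= FracField.equivfE.
have h : (frac r).2 * 1 != 0 by rewrite mulr1 denom_ratioP.
by rewrite /FracField.mulf !numden_Ratio ?oner_eq0//; apply/eqP; ring.
Qed.

Local Notation cpoly := (map_poly (real_complex R)).

(** f has value v at s through some fraction whose denominator does not vanish there. No reduction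
    to lowest terms is asked for, which makes the relation stable under the field operations. *)
Definition evrel (s : C) (f : F) (v : C) : Prop := exists n d : {poly R},
  [/\ (cpoly d).[s] != 0, f * tofrac d = tofrac n & v = (cpoly n).[s] / (cpoly d).[s]].

(** By Gauss's lemma the reduced denominator divides every other one, so it does not vanish at s
    either. *)
Lemma evrel_ratval s f v : evrel s f v -> ratval s f = v.
Proof.
move=> [n [d [ds fE ->]]]; rewrite /ratval.
set num := (frac _).1; set den := (frac _).2; set g := gcdp num den.
have den0 : den != 0 by exact: denom_ratioP.
have d0 : d != 0 by apply: contraNneq ds => ->; rewrite map_poly0 horner0.
have fr : f * tofrac den = tofrac num by exact: frac_reprE.
have E : num * d = n * den.
  apply/eqP; rewrite -tofrac_eq !tofracM -fr -fE; apply/eqP; ring.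
have g0 : g != 0 by rewrite gcdp_eq0 negb_and den0 orbT.
have nE : num = num %/ g * g by rewrite divpK// dvdp_gcdl.
have dE : den = den %/ g * g by rewrite divpK// dvdp_gcdr.
have cop : coprimep (den %/ g) (num %/ g).
  by rewrite coprimep_sym coprimep_div_gcd// den0 orbT.
have E' : num %/ g * d = n * (den %/ g).
  by apply: (mulIf g0); rewrite -mulrA [d * g]mulrC mulrA -nE E {1}dE mulrA.
have dv : den %/ g %| d by rewrite -(Gauss_dvdpr _ cop) E' dvdp_mull.
have dens : (cpoly (den %/ g)).[s] != 0.
  apply: contraNneq ds => h; move/dvdpP: dv => [q ->].
  by rewrite rmorphM /= hornerM h mulr0.
apply/eqP; rewrite eqr_div// -!hornerM -!rmorphM /= E'.
by [].
Qed.

Lemma evrelD s f g v w : evrel s f v -> evrel s g w -> evrel s (f + g) (v + w).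
Proof.
move=> [n [d [ds fE ->]]] [n' [d' [ds' gE ->]]]; exists (n * d' + n' * d), (d * d').
rewrite !rmorphD !rmorphM /= !hornerD !hornerM mulf_neq0//; split => //.
  by rewrite -fE -gE; ring.
by field; rewrite ds ds'.
Qed.

Lemma evrelM s f g v w : evrel s f v -> evrel s g w -> evrel s (f * g) (v * w).
Proof.
move=> [n [d [ds fE ->]]] [n' [d' [ds' gE ->]]]; exists (n * n'), (d * d').
rewrite !rmorphM /= !hornerM mulf_neq0//; split => //.
  by rewrite -fE -gE; ring.
by field; rewrite ds ds'.
Qed.

Lemma evrelV s f v : evrel s f v -> v != 0 -> evrel s f^-1 v^-1.
Proof.
move=> [n [d [ds fE ->]]] v0.
have ns : (cpoly n).[s] != 0 by apply: contraNneq v0 => ->; rewrite mul0r.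
exists d, n; split => //; last by rewrite invf_div.
have n0 : tofrac n != 0.
  by rewrite tofrac_eq0; apply: contraNneq ns => ->; rewrite map_poly0 horner0.
have f0 : f != 0 by apply: contraNneq n0 => f0; rewrite -fE f0 mul0r.
by rewrite -fE (mulKf f0).
Qed.

Lemma evrel_poly s (p : {poly R}) : evrel s (tofrac p) (cpoly p).[s].
Proof. by exists p, 1; rewrite rmorph1 hornerE oner_eq0 divr1 mulr1. Qed.

Lemma evrel_cst s (c : R) : evrel s (tofrac c%:P) c%:C.
Proof. by have := evrel_poly s c%:P; rewrite map_polyC hornerC. Qed.

Lemma evrel0 s : evrel s 0 0.
Proof. by have := evrel_cst s 0; rewrite tofrac0. Qed.

Lemma evrel1 s : evrel s 1 1.
Proof. by have := evrel_cst s 1; rewrite tofrac1. Qed.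

Lemma evrel_sum s (I : Type) (r : seq I) f v : (forall i : I, evrel s (f i) (v i)) ->
  evrel s (\sum_(i <- r) f i) (\sum_(i <- r) v i).
Proof.
by move=> h; elim/big_ind2: _ => [|? ? ? ?|i _]; [exact: evrel0|exact: evrelD|exact: h].
Qed.

Lemma evrel_prod s (I : Type) (r : seq I) f v : (forall i : I, evrel s (f i) (v i)) ->
  evrel s (\prod_(i <- r) f i) (\prod_(i <- r) v i).
Proof.
by move=> h; elim/big_ind2: _ => [|? ? ? ?|i _]; [exact: evrel1|exact: evrelM|exact: h].
Qed.

Lemma evrelN s f v : evrel s f v -> evrel s (- f) (- v).
Proof.
move=> h; rewrite -mulN1r -[- v]mulN1r; apply: evrelM h.
by have := evrel_cst s (-1); rewrite polyCN tofracN tofrac1 rmorphN rmorph1.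
Qed.

Definition mxev m n s (A : 'M[F]_(m, n)) (V : 'M[C]_(m, n)) : Prop :=
  forall i j, evrel s (A i j) (V i j).

Lemma mxev_freq m n w (A : 'M[F]_(m, n)) V : mxev (0 +i* w) A V -> freq A w = V.
Proof. by move=> h; apply/matrixP => i j; rewrite mxE; exact: evrel_ratval. Qed.

Lemma mxevM m n k s (A : 'M[F]_(m, n)) (B : 'M[F]_(n, k)) V W :
  mxev s A V -> mxev s B W -> mxev s (A *m B) (V *m W).
Proof.
by move=> hA hB i j; rewrite !mxE; apply: evrel_sum => l; exact: evrelM.
Qed.

Lemma mxevD m n s (A B : 'M[F]_(m, n)) V W :
  mxev s A V -> mxev s B W -> mxev s (A + B) (V + W).
Proof. by move=> hA hB i j; rewrite !mxE; exact: evrelD. Qed.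

Lemma mxevN m n s (A : 'M[F]_(m, n)) V : mxev s A V -> mxev s (- A) (- V).
Proof. by move=> hA i j; rewrite !mxE; exact: evrelN. Qed.

Lemma mxev1 n s : mxev s (1%:M : 'M[F]_n) 1%:M.
Proof.
by move=> i j; rewrite !mxE; case: (i == j); [exact: evrel1|exact: evrel0].
Qed.

Lemma evrel_det n s (A : 'M[F]_n) V : mxev s A V -> evrel s (\det A) (\det V).
Proof.
move=> h; apply: evrel_sum => p; apply: evrelM; last by apply: evrel_prod => i.
case: (perm.odd_perm p); rewrite ?expr1 ?expr0; last exact: evrel1.
by apply: evrelN; exact: evrel1.
Qed.

(** Invertibility at one point makes the determinant a nonzero rational function; the inverse is
    then evaluated by the adjugate formula. *)
Lemma mxevV n s (A : 'M[F]_n) V : mxev s A V -> V \in unitmx ->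
  A \in unitmx /\ mxev s (invmx A) (invmx V).
Proof.
move=> h VU; have hd := evrel_det h.
have dV : \det V != 0 by rewrite -unitfE -unitmxE.
have dA : \det A != 0.
  by apply: contraNneq dV => d0; move: (evrel_ratval hd); rewrite d0 (evrel_ratval (evrel0 s)) => <-.
have AU : A \in unitmx by rewrite unitmxE unitfE.
split=> // i j; rewrite /invmx AU VU !mxE; apply: evrelM; first exact: evrelV.
apply: evrelM; last by apply: evrel_det => a b; rewrite !mxE.
rewrite -signr_odd -[X in evrel _ _ X]signr_odd; case: (odd _); rewrite ?expr1 ?expr0; last exact: evrel1.
by apply: evrelN; exact: evrel1.
Qed.

Definition cstmx m n (M : 'M[R]_(m, n)) : 'M[F]_(m, n) :=
  map_mx (fun c => tofrac c%:P) M.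
Definition resmx n (A : 'M[R]_n) : 'M[F]_n := map_mx tofrac (char_poly_mx A).

Lemma tfE m p n (S : lti R m p n) :
  tf S = cstmx (ssC S) *m invmx (resmx (ssA S)) *m cstmx (ssB S).
Proof. by []. Qed.

Lemma mxev_cst m n s (M : 'M[R]_(m, n)) : mxev s (cstmx M) (cmx M).
Proof. by move=> i j; rewrite !mxE; exact: evrel_cst. Qed.

Lemma mxev_res n s (A : 'M[R]_n) : mxev s (resmx A) (s%:M - cmx A).
Proof.
move=> i j; rewrite [resmx A i j]mxE.
have := evrel_poly s (char_poly_mx A i j); set p := char_poly_mx A i j.
suff -> : (cpoly p).[s] = (s%:M - cmx A) i j by [].
rewrite /p !mxE [cpoly _]rmorphB /= map_polyC hornerD hornerN hornerC.
by case: (i == j); rewrite ?mulr1n ?mulr0n ?map_polyX ?map_poly0 ?hornerX ?horner0.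
Qed.

Lemma resmx_unit n (A : 'M[R]_n) : resmx A \in unitmx.
Proof.
rewrite unitmxE det_map_mx unitfE tofrac_eq0 -/(char_poly A).
exact/monic_neq0/char_poly_monic.
Qed.

Lemma mxev_tf m p n (S : lti R m p n) s : (s%:M - cmx (ssA S)) \in unitmx ->
  mxev s (tf S) (cmx (ssC S) *m resolvent (ssA S) s *m cmx (ssB S)).
Proof.
move=> U; rewrite tfE; apply: mxevM; last exact: mxev_cst.
apply: mxevM; first exact: mxev_cst.
exact: (mxevV (mxev_res s _) U).2.
Qed.

Lemma mxev_tf_hurwitz m p n (S : lti R m p n) w : hurwitz (ssA S) ->
  mxev (0 +i* w) (tf S) (freqresp S w).
Proof. by move=> hA; apply: mxev_tf; exact: hurwitz_unit. Qed.

Lemma freq_tf m p n (S : lti R m p n) w : hurwitz (ssA S) ->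
  freq (tf S) w = freqresp S w.
Proof. by move=> hA; apply: mxev_freq; exact: mxev_tf_hurwitz. Qed.

End RationalEvaluation.

(** * Closed-loop transfer functions *)

Section LoopAlgebra.
Variables (F : fieldType) (m p nx nk : nat).
Variables (a : 'M[F]_nx) (k : 'M[F]_nk) (b : 'M[F]_(nx, m)) (c : 'M[F]_(p, nx)).
Variables (bk : 'M[F]_(nk, p)) (ck : 'M[F]_(m, nk)).
Let M := block_mx a (- (b *m ck)) (- (bk *m c)) k.
Let G := c *m invmx a *m b.
Let K := ck *m invmx k *m bk.
Let Y := invmx (1%:M - G *m K).
Hypotheses (aU : a \in unitmx) (kU : k \in unitmx) (MU : M \in unitmx).

(** M plays the role of s - A for the closed loop: P and Q are the plant and controller states under
    the inputs u and v, and the block rows of M are the loop equations. *)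
Lemma loop_solution q (u : 'M[F]_(nx, q)) (v : 'M[F]_(nk, q)) :
  exists P Q, [/\ row_mx c 0 *m invmx M *m col_mx u v = c *m P,
      row_mx 0 ck *m invmx M *m col_mx u v = ck *m Q,
      c *m P = c *m invmx a *m u + G *m (ck *m Q) &
      ck *m Q = ck *m invmx k *m v + K *m (c *m P)].
Proof.
pose P := usubmx (invmx M *m col_mx u v); pose Q := dsubmx (invmx M *m col_mx u v).
exists P, Q; have E : invmx M *m col_mx u v = col_mx P Q by rewrite vsubmxK.
have : M *m col_mx P Q = col_mx u v by rewrite -E mulKVmx.
clearbody P Q; rewrite -!mulmxA E !mul_row_col !mul0mx addr0 add0r.
rewrite mul_block_col => /eq_col_mx[].
rewrite !mulNmx => /eqP; rewrite subr_eq => /eqP e1.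
rewrite addrC => /eqP; rewrite subr_eq => /eqP e2; split=> //.
  by rewrite -[P in LHS](mulKmx aU) e1 !mulmxDr /G !mulmxA.
by rewrite -[Q in LHS](mulKmx kU) e2 !mulmxDr /K !mulmxA.
Qed.

(** The response to a disturbance entering the controller gives 1 + c P1 as a right inverse of 1 - G
    K, so well-posedness of the loop is obtained from the invertibility of M. *)
Lemma loop_algebra :
  [/\ (1%:M - G *m K) \in unitmx,
      Y = 1%:M + row_mx c 0 *m invmx M *m col_mx 0 bk,
      Y *m G = row_mx c 0 *m invmx M *m col_mx b 0 &
      [/\ Y *m G *m K = row_mx c 0 *m invmx M *m col_mx 0 bk,
          K *m (Y *m G) = row_mx 0 ck *m invmx M *m col_mx b 0
        & K *m Y = row_mx 0 ck *m invmx M *m col_mx 0 bk]].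
Proof.
have [P1 [Q1 [-> -> p1 q1]]] := loop_solution 0 bk.
have [P2 [Q2 [-> -> p2 q2]]] := loop_solution b 0.
rewrite mulmx0 add0r in p1; rewrite mulmx0 add0r in q2.
rewrite -/G in p2; rewrite -/K in q1.
have N : (1%:M - G *m K) *m (1%:M + c *m P1) = 1%:M.
  by rewrite mulmxBl mul1mx -[_ *m _ *m (1%:M + _)]mulmxA mulmxDr mulmx1 -q1 -p1 addrK.
have [U _] := mulmx1_unit N.
have YE : Y = 1%:M + c *m P1 by rewrite /Y -[RHS](mulKmx U) N mulmx1.
have YV : Y *m (1%:M - G *m K) = 1%:M by rewrite /Y mulVmx.
have XE : Y *m G = c *m P2.
  have {1}-> : G = (1%:M - G *m K) *m (c *m P2).
    by rewrite mulmxBl mul1mx -mulmxA -q2 {1}p2 addrK.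
  by rewrite mulmxA YV mul1mx.
split=> //; split.
- rewrite -mulmxA; move/eqP: YV; rewrite mulmxBr mulmx1 subr_eq YE.
  by rewrite (inj_eq (addrI _)) => /eqP <-.
- by rewrite XE -q2.
- by rewrite q1 YE mulmxDr mulmx1.
Qed.

End LoopAlgebra.

(* The relations follow from Yr = Y + X D Yr, i.e. from
   1 - G (K + D) = (1 - G K)(1 - X D). *)
Lemma loop_perturbation (F : fieldType) m p (G : 'M[F]_(p, m)) (K D Kr : 'M[F]_(m, p)) (Y Yr : 'M[F]_p) :
  Kr = K + D ->
  Y *m (1%:M - G *m K) = 1%:M -> (1%:M - G *m Kr) *m Yr = 1%:M ->
  [/\ Yr = Y + Y *m G *m D *m Yr,
      Yr *m G = Y *m G + Y *m G *m D *m (Yr *m G),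
      Kr *m Yr = K *m Y + (1%:M + K *m (Y *m G)) *m D *m Yr &
      Kr *m (Yr *m G) = K *m (Y *m G) + (1%:M + K *m (Y *m G)) *m D *m (Yr *m G)].
Proof.
move=> -> hY hYr.
have e1 : Yr = Y + Y *m G *m D *m Yr.
  have E : 1%:M - G *m (K + D) = 1%:M - G *m K - G *m D by rewrite mulmxDr opprD addrA.
  have e : Yr - Y *m G *m D *m Yr = Y.
    by rewrite -[RHS]mulmx1 -hYr E mulmxA mulmxBr hY mulmxBl mul1mx !mulmxA.
  by apply/eqP; rewrite -subr_eq e.
have e3 : (K + D) *m Yr = K *m Y + (1%:M + K *m (Y *m G)) *m D *m Yr.
  by rewrite [in LHS]mulmxDl {1}e1 mulmxDr !mulmxDl mul1mx !mulmxA -addrA [X in _ + X]addrC.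
split => //.
  by rewrite {1}e1 mulmxDl !mulmxA.
by rewrite mulmxA e3 mulmxDl !mulmxA.
Qed.

Lemma invmx_unique (F : fieldType) n (M N : 'M[F]_n) : M *m N = 1%:M -> invmx M = N.
Proof. by move=> MN; have [MU _] := mulmx1_unit MN; rewrite -[RHS](mulKmx MU) MN mulmx1. Qed.

Lemma invmx_diag_block (F : fieldType) n1 n2 (A : 'M[F]_n1) (B : 'M[F]_n2) :
  A \in unitmx -> B \in unitmx ->
  invmx (block_mx A 0 0 B) = block_mx (invmx A) 0 0 (invmx B).
Proof.
move=> AU BU; apply: invmx_unique.
by rewrite mulmx_block !mulmx0 !mul0mx !addr0 !add0r !mulmxV// -scalar_mx_block.
Qed.

(** * Transfer functions of interconnections *)

Section ClosedLoopTransfer.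
Variable R : realType.
Local Notation F := {fraction {poly R}}.
Local Notation tofrac := (@FracField.tofrac {poly R}).

Lemma resmxE n (A : 'M[R]_n) : resmx A = (tofrac 'X)%:M - cstmx A.
Proof.
apply/matrixP => i j; rewrite !mxE rmorphB /=.
by case: (i == j); rewrite ?mulr1n ?mulr0n ?rmorph0.
Qed.

Lemma cstmxM m n k (A : 'M[R]_(m, n)) (B : 'M[R]_(n, k)) :
  cstmx (A *m B) = cstmx A *m cstmx B.
Proof.
apply/matrixP => i j; rewrite !mxE rmorph_sum rmorph_sum /=.
by apply: eq_bigr => l _; rewrite !mxE polyCM tofracM.
Qed.

Lemma cstmxN m n (A : 'M[R]_(m, n)) : cstmx (- A) = - cstmx A.
Proof. by apply/matrixP => i j; rewrite !mxE polyCN tofracN. Qed.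

Lemma cstmx0 m n : cstmx (0 : 'M[R]_(m, n)) = 0.
Proof. by apply/matrixP => i j; rewrite !mxE polyC0 tofrac0. Qed.

Lemma cstmx1 n : cstmx (1%:M : 'M[R]_n) = 1%:M.
Proof.
apply/matrixP => i j; rewrite !mxE.
by case: (i == j); rewrite ?polyC0 ?tofrac0 ?polyC1 ?tofrac1.
Qed.

Lemma resmx_block n1 n2 (A : 'M[R]_n1) B C (D : 'M[R]_n2) :
  resmx (block_mx A B C D) = block_mx (resmx A) (- cstmx B) (- cstmx C) (resmx D).
Proof.
by rewrite !resmxE /cstmx map_block_mx scalar_mx_block opp_block_mx add_block_mx !add0r.
Qed.

Lemma tf_parallel m p n1 n2 (S1 : lti R m p n1) (S2 : lti R m p n2) :
  tf (parallel S1 S2) = tf S1 + tf S2.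
Proof.
rewrite !tfE /= resmx_block !cstmx0 !oppr0 /cstmx map_col_mx map_row_mx.
rewrite -!/(cstmx _).
rewrite invmx_diag_block ?resmx_unit//.
by rewrite mul_row_block !mulmx0 addr0 add0r mul_row_col.
Qed.

Lemma tf_change_coordinates m p n (T : 'M[R]_n) (S : lti R m p n) :
  T \in unitmx -> tf (change_coordinates T S) = tf S.
Proof.
move=> TU; rewrite !tfE /= !cstmxM.
have cT : cstmx T *m cstmx (invmx T) = 1%:M by rewrite -cstmxM mulmxV// cstmx1.
have cT' : cstmx (invmx T) *m cstmx T = 1%:M by rewrite -cstmxM mulVmx// cstmx1.
have -> : resmx (T *m ssA S *m invmx T) = cstmx T *m resmx (ssA S) *m cstmx (invmx T).
  by rewrite !resmxE !cstmxM mulmxBr mulmxBl mul_mx_scalar -scalemxAl cT scalemx1.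
have -> : invmx (cstmx T *m resmx (ssA S) *m cstmx (invmx T)) =
    cstmx T *m invmx (resmx (ssA S)) *m cstmx (invmx T).
  apply: invmx_unique; move: (resmx_unit (ssA S)); move: (resmx _) => r rU.
  rewrite !mulmxA -[_ *m cstmx (invmx T) *m cstmx T]mulmxA cT' mulmx1.
  by rewrite mulmxK.
move: (invmx (resmx _)) => r.
rewrite !mulmxA -[_ *m cstmx (invmx T) *m cstmx T]mulmxA cT' mulmx1.
by rewrite -[_ *m cstmx (invmx T) *m cstmx T]mulmxA cT' mulmx1.
Qed.

Section Loop.
Variables (m p nx nk : nat) (G : lti R m p nx) (K : lti R p m nk).

(** The four closed-loop maps, from the noise w or v to C x or u. The output is C x without the
    measurement noise, so Y is 1 plus [loop_vy]. All share the closed-loop state matrix, so internal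
    stability covers the four at once. *)
Definition loop_wy := Lti (closed_loopA G K) (col_mx (ssB G) 0) (row_mx (ssC G) 0).
Definition loop_vy := Lti (closed_loopA G K) (col_mx 0 (ssB K)) (row_mx (ssC G) 0).
Definition loop_wu := Lti (closed_loopA G K) (col_mx (ssB G) 0) (row_mx 0 (ssC K)).
Definition loop_vu := Lti (closed_loopA G K) (col_mx 0 (ssB K)) (row_mx 0 (ssC K)).

Let Y := invmx (1%:M - tf G *m tf K).

Lemma loop_tf :
  [/\ (1%:M - tf G *m tf K) \in unitmx, Y = 1%:M + tf loop_vy, Y *m tf G = tf loop_wy &
      [/\ Y *m tf G *m tf K = tf loop_vy, tf K *m (Y *m tf G) = tf loop_wu
        & tf K *m Y = tf loop_vu]].
Proof.
have MU := resmx_unit (closed_loopA G K).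
have ME : resmx (closed_loopA G K) = block_mx (resmx (ssA G)) (- (cstmx (ssB G) *m cstmx (ssC K)))
    (- (cstmx (ssB K) *m cstmx (ssC G))) (resmx (ssA K)).
  by rewrite /closed_loopA resmx_block !cstmxM.
rewrite ME in MU.
have := loop_algebra (resmx_unit (ssA G)) (resmx_unit (ssA K)) MU.
rewrite -ME -!tfE.
have cmxE n1 n2 q (U : 'M[R]_(n1, q)) (V : 'M[R]_(n2, q)) :
  cstmx (col_mx U V) = col_mx (cstmx U) (cstmx V) by exact: map_col_mx.
have rmxE n1 n2 q (U : 'M[R]_(q, n1)) (V : 'M[R]_(q, n2)) :
  cstmx (row_mx U V) = row_mx (cstmx U) (cstmx V) by exact: map_row_mx.
rewrite (tfE loop_vy) (tfE loop_wy) (tfE loop_wu) (tfE loop_vu).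
by rewrite [ssA _]/= [ssB _]/= [ssC _]/= !cmxE !rmxE !cstmx0.
Qed.

End Loop.

End ClosedLoopTransfer.

(** * H-infinity and H2 norms *)

Section Norms.
Variable R : realType.
Local Notation C := R[i].
Local Notation mu := (@lebesgue_measure R).

Lemma opbound_le m n c d (M : 'M[C]_(m, n)) : c <= d -> opbound c M -> opbound d M.
Proof. by move=> cd hM x; apply: le_trans (hM x) _; rewrite ler_wpM2r ?fro_ge0. Qed.

Lemma freqresp_bounded m p n (S : lti R m p n) : hurwitz (ssA S) ->
  exists2 c, 0 <= c & forall w, opbound c (freqresp S w).
Proof.
move=> /resolvent_bounded[c c0 hc].
exists (fro (cmx (ssC S)) * c * fro (cmx (ssB S))); first by rewrite !mulr_ge0 ?fro_ge0.
move=> w; apply: opboundM; [by rewrite mulr_ge0 ?fro_ge0| |exact: opbound_fro].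
apply: opboundM; [exact: fro_ge0|exact: opbound_fro|].
by apply: (opbound_le _ (opbound_fro _)); exact: hc.
Qed.

Section Hinf.
Variables (m p : nat) (F : 'M[{fraction {poly R}}]_(p, m)) (c : R).
Hypotheses (c0 : 0 <= c) (hF : forall w, opbound c (freq F w)).

Lemma hinf_norm_le : hinf_norm F <= c.
Proof.
apply: ge_sup; first by exists (sigma_max (freq F 0)); exists 0.
by move=> _ [w _ <-]; exact: sigma_max_le.
Qed.

Lemma sigma_max_hinf_norm w : sigma_max (freq F w) <= hinf_norm F.
Proof.
apply: ub_le_sup; last by exists w.
by exists c => _ [v _ <-]; exact: sigma_max_le.
Qed.

Lemma hinf_norm_ge0 : 0 <= hinf_norm F.
Proof. exact: le_trans (sigma_max_ge0 _) (sigma_max_hinf_norm 0). Qed.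

Lemma opbound_hinf_norm w : opbound (hinf_norm F) (freq F w).
Proof. exact: opbound_le (sigma_max_hinf_norm w) (opbound_sigma_max _). Qed.

End Hinf.

Lemma hinf_norm_tf m p n (S : lti R m p n) : hurwitz (ssA S) ->
  0 <= hinf_norm (tf S) /\ forall w, opbound (hinf_norm (tf S)) (freqresp S w).
Proof.
move=> hS; have [c c0 hc] := freqresp_bounded hS.
have hc' w : opbound c (freq (tf S) w) by rewrite freq_tf.
split; first exact: hinf_norm_ge0 c0 hc'.
by move=> w; rewrite -freq_tf//; exact: opbound_hinf_norm hc' w.
Qed.

Lemma h2_norm_integral m p n (S : lti R m p n) : hurwitz (ssA S) ->
  mu.-integrable [set: R] (fun w => (fro2 (freqresp S w))%:E) /\
  h2_norm (tf S) ^+ 2 = (2 * pi)^-1 * \int[mu]_w fro2 (freqresp S w).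
Proof.
move=> hS; split.
  (* The Gramian serves to show that the integral is finite. *)
  have QT : (ssB S *m (ssB S)^T)^T = ssB S *m (ssB S)^T by rewrite trmx_mul trmxK.
  have [P PT hP] := lyapunov_solution hS QT.
  have I := integral_freqresp hS PT hP.
  apply/integrableP; split.
    apply/measurable_EFinP; apply: continuous_measurable_fun.
    exact: (mxcdiff_fro2 (mxcdiff_freqresp hS)).
  under eq_integral do rewrite gee0_abs ?lee_fin ?fro2_ge0//.
  by rewrite I ltry.
rewrite /h2_norm (_ : (fun w : R => _) = (fun w => fro2 (freqresp S w))).
  rewrite sqr_sqrtr// mulr_ge0 ?invr_ge0 ?mulr_ge0 ?pi_ge0//.
  by apply: Rintegral_ge0 => // w _; exact: fro2_ge0.
apply/funext => w; rewrite !freq_tf// freqrespN map_trmx -[map_mx _ _]/(hadj _) -fro2_tr.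
by [].
Qed.

Lemma h2_norm_gramian m p n (S : lti R m p n) (P : 'M[R]_n) :
  hurwitz (ssA S) -> P^T = P ->
  ssA S *m P + P *m (ssA S)^T + ssB S *m (ssB S)^T = 0 ->
  h2_norm (tf S) ^+ 2 = \tr (ssC S *m P *m (ssC S)^T).
Proof.
move=> hS PT hP; have [_ ->] := h2_norm_integral hS.
by rewrite /Rintegral (integral_freqresp hS PT hP)/= mulKf// gt_eqF// mulr_gt0// pi_gt0.
Qed.

(** Minkowski's inequality by way of (x + c y)^2 <= (1 + c e) x^2 + (c^2 + c / e) y^2, valid for
    every e > 0: only integrals of squares occur, and e is optimized after integration. *)
Lemma h2_norm_minkowski m p n m1 p1 n1 m2 p2 n2 (S : lti R m p n)
    (S1 : lti R m1 p1 n1) (S2 : lti R m2 p2 n2) (g c : R) :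
  hurwitz (ssA S) -> hurwitz (ssA S1) -> hurwitz (ssA S2) -> 0 <= g -> 0 <= c ->
  (forall w, fro (freqresp S w) <= g * (fro (freqresp S1 w) + c * fro (freqresp S2 w))) ->
  h2_norm (tf S) ^+ 2 <= g ^+ 2 * (h2_norm (tf S1) + c * h2_norm (tf S2)) ^+ 2.
Proof.
move=> hS hS1 hS2 g0 c0 hle.
have [i0 e0] := h2_norm_integral hS; have [i1 e1] := h2_norm_integral hS1.
have [i2 e2] := h2_norm_integral hS2.
have b0 : 0 <= h2_norm (tf S1) by exact: sqrtr_ge0.
have d0 : 0 <= h2_norm (tf S2) by exact: sqrtr_ge0.
set a := h2_norm _ in e0 *; set b := h2_norm _ in e1 b0 *; set d := h2_norm _ in e2 d0 *.
have pi0 : 0 <= (2 * pi : R)^-1 by rewrite invr_ge0 mulr_ge0 ?pi_ge0.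
have weighted e : 0 < e ->
    a ^+ 2 <= g ^+ 2 * (1 + c * e) * b ^+ 2 + g ^+ 2 * (c ^+ 2 + c / e) * d ^+ 2.
  move=> e_gt0; set u := g ^+ 2 * _; set v := g ^+ 2 * (_ + _).
  rewrite e0 e1 e2 [u * _]mulrCA [v * _]mulrCA -mulrDr ler_wpM2l//.
  have iu : mu.-integrable [set: R] (EFin \o (fun w => u * fro2 (freqresp S1 w))).
    by have := integrableZl measurableT u i1.
  have iv : mu.-integrable [set: R] (EFin \o (fun w => v * fro2 (freqresp S2 w))).
    by have := integrableZl measurableT v i2.
  rewrite -!RintegralZl// -RintegralD//.
  apply: le_Rintegral => //.
    by have := integrableD measurableT iu iv.
  move=> w _; rewrite -!fro_sq; set x := fro (freqresp S1 w); set y := fro (freqresp S2 w).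
  have := hle w; rewrite -/x -/y => h.
  have x0 : 0 <= x by exact: fro_ge0.
  have y0 : 0 <= y by exact: fro_ge0.
  apply: (@le_trans _ _ ((g * (x + c * y)) ^+ 2)).
    by rewrite ler_pXn2r ?nnegrE ?fro_ge0// mulr_ge0// addr_ge0// mulr_ge0.
  have -> : u * x ^+ 2 + v * y ^+ 2 =
      (g * (x + c * y)) ^+ 2 + g ^+ 2 * c * ((e * x - y) ^+ 2 / e).
    by rewrite /u /v; field; rewrite gt_eqF.
  rewrite lerDl; apply: mulr_ge0; first by rewrite mulr_ge0 ?sqr_ge0.
  by apply: divr_ge0; [exact: sqr_ge0|exact: ltW].
(* Use [weighted] at e = (d + s) / (b + s), which stays meaningful when b or d
   vanishes, and let s tend to 0. *)
apply/ler_addgt0Pr => r r0.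
(* Shifting b and d by s costs g^2 c s (b + d) = s K - s, which is below s K = r. *)
pose K := g ^+ 2 * c * (b + d) + 1.
have K0 : 0 < K by rewrite ltr_wpDl// !mulr_ge0 ?sqr_ge0 ?addr_ge0.
pose s := r / K; have s0 : 0 < s by rewrite divr_gt0.
have bs : 0 < b + s by rewrite ltr_wpDl.
have ds : 0 < d + s by rewrite ltr_wpDl.
apply: le_trans (weighted ((d + s) / (b + s)) (divr_gt0 ds bs)) _.
have h x y : 0 <= x -> 0 <= y -> y / (x + s) * x ^+ 2 <= y * x.
  move=> x0 y0; rewrite mulrAC ler_pdivrMr ?ltr_wpDl// mulrDr expr2 mulrA lerDl.
  by apply: mulr_ge0; [exact: mulr_ge0|exact: ltW].
have h1 := h b (d + s) b0 (ltW ds); have h2 := h d (b + s) d0 (ltW bs).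
have gc : 0 <= g ^+ 2 * c by rewrite mulr_ge0 ?sqr_ge0.
have -> : g ^+ 2 * (1 + c * ((d + s) / (b + s))) * b ^+ 2 +
    g ^+ 2 * (c ^+ 2 + c / ((d + s) / (b + s))) * d ^+ 2 =
    g ^+ 2 * (b ^+ 2 + c ^+ 2 * d ^+ 2) +
    g ^+ 2 * c * ((d + s) / (b + s) * b ^+ 2 + (b + s) / (d + s) * d ^+ 2).
  by field; rewrite !gt_eqF.
apply: (@le_trans _ _ (g ^+ 2 * (b ^+ 2 + c ^+ 2 * d ^+ 2) +
    g ^+ 2 * c * ((d + s) * b + (b + s) * d))).
  by rewrite lerD2l ler_wpM2l// lerD.
have -> : r = s * K by rewrite /s mulfVK// gt_eqF.
have -> : g ^+ 2 * (b ^+ 2 + c ^+ 2 * d ^+ 2) + g ^+ 2 * c * ((d + s) * b + (b + s) * d)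
  = g ^+ 2 * (b + c * d) ^+ 2 + s * K - s by rewrite /K; ring.
by rewrite gerBl ltW.
Qed.

End Norms.

(** * Balanced truncation error bound *)

Section BalancedTruncation.
Variable R : realType.
Local Notation C := R[i].

(* The derivative of v^H W v along s v = A v + g vanishes on the imaginary axis. *)
Lemma quadratic_rate n (A W : 'M[R]_n) (w : R) (v g : 'cV[C]_n) : W^T = W ->
  (0 +i* w) *: v = cmx A *m v + g ->
  complex.Re ((hadj v *m cmx (A^T *m W + W *m A) *m v) 0 0) +
    2 * complex.Re ((hadj v *m cmx W *m g) 0 0) = 0.
Proof.
move=> WT h.
set t := (hadj v *m cmx W *m g) 0 0.
have E1 : hadj v *m cmx W *m ((0 +i* w) *: v) = hadj v *m cmx (W *m A) *m v + hadj v *m cmx W *m g.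
  by rewrite h mulmxDr cmxM !mulmxA.
have E2 : hadj ((0 +i* w) *: v) *m cmx W *m v = hadj v *m cmx (A^T *m W) *m v + hadj g *m cmx W *m v.
  by rewrite h hadjD hadjM hadj_cmx !mulmxDl cmxM !mulmxA.
have tE : (hadj g *m cmx W *m v) 0 0 = conjc t.
  have -> : hadj g *m cmx W *m v = hadj (hadj v *m cmx W *m g).
    by rewrite !hadjM hadj_cmx hadjK WT !mulmxA.
  by rewrite hadjE.
have S : hadj v *m cmx W *m ((0 +i* w) *: v) + hadj ((0 +i* w) *: v) *m cmx W *m v = 0.
  by rewrite hadjZ conj_jw -scalemxAr -!scalemxAl scaleNr subrr.
have /matrixP/(_ 0 0) := S; rewrite E1 E2 addrACA addrC -mulmxDl -mulmxDr -cmxD.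
rewrite [W *m A + _]addrC [LHS]mxE [X in X + _]mxE -/t tE [in RHS]mxE => h0.
have /(congr1 (@complex.Re R)) := h0; rewrite /= !ReD.
have -> : complex.Re (conjc t) = complex.Re t by case: (t).
by move=> e; lra.
Qed.

(** Expand |q - 2 u|^2 >= 0. *)
Lemma Re_dot_le n (q u : 'cV[C]_n) :
  4 * complex.Re ((hadj q *m u) 0 0) <= fro2 q + 4 * fro2 u.
Proof.
have h : 0 <= fro2 (q - 2%:R *: u) by exact: fro2_ge0.
suff E : fro2 (q - 2%:R *: u) = fro2 q - 4 * complex.Re ((hadj q *m u) 0 0) + 4 * fro2 u by lra.
have -> : fro2 (q - 2%:R *: u) = complex.Re ((hadj (q - 2%:R *: u) *m (q - 2%:R *: u)) 0 0).
  by rewrite -fro2_col.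
have -> : fro2 q = complex.Re ((hadj q *m q) 0 0) by rewrite -fro2_col.
have -> : fro2 u = complex.Re ((hadj u *m u) 0 0) by rewrite -fro2_col.
rewrite hadjB hadjZ rmorph_nat mulmxBl !mulmxBr -!scalemxAl -!scalemxAr.
have -> : hadj u *m q = hadj (hadj q *m u) by rewrite hadjM hadjK.
rewrite !mxE.
set x := \sum_j _; set y := \sum_j _; set z := \sum_j _.
by case: x y z => x1 x2 [y1 y2] [z1 z2] /=; ring.
Qed.

Let e11B (X Y : 'M[C]_1) : (X - Y) 0 0 = X 0 0 - Y 0 0.
Proof. by rewrite !mxE. Qed.
Let e11D (X Y : 'M[C]_1) : (X + Y) 0 0 = X 0 0 + Y 0 0.
Proof. by rewrite !mxE. Qed.
Let e11N (X : 'M[C]_1) : (- X) 0 0 = - X 0 0.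
Proof. by rewrite !mxE. Qed.
Let e11Z a (X : 'M[C]_1) : (a *: X) 0 0 = a * X 0 0.
Proof. by rewrite !mxE. Qed.

Section Balanced.
Variables (m p n : nat) (A : 'M[R]_n) (B : 'M[R]_(n, m)) (Co : 'M[R]_(p, n)).
Variable sg : 'rV[R]_n.
Hypothesis sg_gt0 : forall i, 0 < sg 0 i.
Hypothesis lyapc : A *m diag_mx sg + diag_mx sg *m A^T + B *m B^T = 0.
Hypothesis lyapo : A^T *m diag_mx sg + diag_mx sg *m A + Co^T *m Co = 0.

(* [r] is the state, padded with zeros, of the truncation to the first [k]
   coordinates driven by [u] at frequency [w]. *)
Definition truncated_state (w : R) (u : 'cV[C]_m) (k : nat) (r : 'cV[C]_n) : Prop :=
  (forall i : 'I_n, (k <= i)%N -> r i 0 = 0) /\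
  (forall i : 'I_n, (i < k)%N ->
     ((0 +i* w) *: r) i 0 = (cmx A *m r + cmx B *m u) i 0).

(* By the Lyapunov equation a left null vector of the truncated system annihilates
   [B], so the system is consistent even if the truncation has eigenvalue i w. *)
Lemma truncated_state_exists w u k : exists r, truncated_state w u k r.
Proof.
pose e : 'rV[C]_n := \row_i (i < k)%:R.
pose E := diag_mx e; set s := 0 +i* w.
have [E' E'E] : exists E', E' = 1%:M - E by exists (1%:M - E).
(* E projects onto the first k coordinates. M is s - A compressed to them, completed by the identity
   on the others. *)
pose M := s *: E - E *m cmx A *m E + E'.
have EE : E *m E = E.
  apply/matrixP => i j; rewrite mul_diag_mx !mxE.
  by case: (i == j); rewrite ?mulr1n ?mulr0n ?mulr0//; case: (_ < _)%N; rewrite ?mulr1 ?mulr0.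
have EC : E *m E' = 0 by rewrite E'E mulmxBr mulmx1 EE subrr.
have CE : E' *m E = 0 by rewrite E'E mulmxBl mul1mx EE subrr.
have CC : E' *m E' = E' by rewrite {1}E'E mulmxBl mul1mx EC subr0.
have EH : hadj E = E.
  apply/matrixP => i j; rewrite !mxE eq_sym; case: eqP => [->|_]; rewrite ?mulr1n ?mulr0n ?rmorph0//.
  by rewrite rmorph_nat.
(* The rows of V span the left kernel of M. *)
pose V := (cokermx M^T)^T.
have VM : V *m M = 0.
  by apply: trmx_inj; rewrite trmx_mul trmxK trmx0 mulmx_coker.
have VE : V *m E = V.
  have : V *m M *m E' = 0 by rewrite VM mul0mx.
  rewrite -mulmxA /M !mulmxDl mulNmx -!scalemxAl EC scaler0 -[_ *m E *m E']mulmxA EC mulmx0.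
  rewrite subrr add0r CC E'E mulmxBr mulmx1 => /eqP.
  by rewrite subr_eq0 => /eqP.
have VA : V *m cmx A *m E = s *: V.
  have : V *m M *m E = 0 by rewrite VM mul0mx.
  rewrite -mulmxA /M !mulmxDl mulNmx -!scalemxAl EE CE addr0 -[_ *m E *m E]mulmxA EE.
  rewrite mulmxBr -scalemxAr VE !mulmxA VE => /eqP.
  by rewrite subr_eq0 => /eqP.
pose S := cmx (diag_mx sg).
have SE : S *m E = E *m S.
  apply/matrixP => i j; rewrite mul_mx_diag mul_diag_mx !mxE.
  by case: eqP => [->|_]; rewrite ?mulr1n ?mulr0n ?mulr0 ?mul0r// mulrC.
have SH : hadj S = S by rewrite hadj_cmx tr_diag_mx.
(* Since V A E = s V, the Lyapunov equation between V and V^H reduces to (s + conj s) V S V^H + V B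
   B^T V^H = 0, and s is imaginary. *)
have VB : V *m cmx B = 0.
  apply: fro2_eq0; apply: complexI; rewrite -fro2_hadj fro2_tr hadjK hadjM hadj_cmx.
  rewrite mulmxA -[V *m _ *m _]mulmxA -cmxM.
  have -> : B *m B^T = - (A *m diag_mx sg + diag_mx sg *m A^T).
    by apply/eqP; rewrite -addr_eq0 addrC lyapc.
  have h1 : V *m cmx (A *m diag_mx sg) *m hadj V = s *: (V *m S *m hadj V).
    have hV : hadj V = E *m hadj V by rewrite -{2}VE hadjM EH mulmxA EE -{1}VE hadjM EH.
    rewrite cmxM -/S hV !mulmxA -[_ *m S *m E]mulmxA SE !mulmxA VA.
    by rewrite -!scalemxAl -[_ *m S *m E]mulmxA SE !mulmxA VE.
  have h2 : V *m cmx (diag_mx sg *m A^T) *m hadj V = hadj (V *m cmx (A *m diag_mx sg) *m hadj V).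
    by rewrite !hadjM hadjK hadj_cmx trmx_mul tr_diag_mx !mulmxA.
  have -> : cmx (- (A *m diag_mx sg + diag_mx sg *m A^T)) =
      - (cmx (A *m diag_mx sg) + cmx (diag_mx sg *m A^T)).
    by rewrite cmxN cmxD.
  rewrite mulmxN mulNmx mulmxDr mulmxDl h2 h1 hadjZ conj_jw.
  rewrite !hadjM hadjK SH mulmxA scaleNr subrr oppr0.
  by rewrite /mxtrace big1// => i _; rewrite mxE.
have sub : ((E *m cmx B *m u)^T <= M^T)%MS.
  rewrite submxE -[cokermx _]trmxK -trmx_mul -/V !mulmxA VE VB mul0mx trmx0 eqxx//.
have /submxP[D hD] := sub.
pose r := D^T; exists r.
have hr : M *m r = E *m cmx B *m u.
  by apply: trmx_inj; rewrite trmx_mul hD /r trmxK.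
have r0 : E' *m r = 0.
  have : E' *m (M *m r) = 0 by rewrite hr !mulmxA CE !mul0mx.
  rewrite mulmxA /M !mulmxDr mulmxN -scalemxAr CE scaler0 !mulmxA CE !mul0mx subr0 add0r CC.
  by [].
have Er : E *m r = r by move/eqP: r0; rewrite E'E mulmxBl mul1mx subr_eq0 => /eqP.
have dE (y : 'cV[C]_n) (i : 'I_n) : (E *m y) i 0 = (i < k)%:R * y i 0.
  by rewrite mul_diag_mx !mxE.
split=> i ik; first by rewrite -Er dE ltnNge ik mul0r.
have : E *m (M *m r) = E *m (cmx B *m u) by rewrite hr !mulmxA EE.
rewrite mulmxA /M mulmxDr EC addr0 mulmxBr -scalemxAr EE !mulmxA EE mulmxBl -scalemxAl.
rewrite -[_ *m E *m r]mulmxA Er => /eqP; rewrite subr_eq addrC -!mulmxA -mulmxDr => /eqP/matrixP/(_ i 0).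
by rewrite dE ik mul1r => <-.
Qed.

(* The storage function is sg_k^2 z^H S^-1 z + d^H S d with z = x + r, d = x - r and
   S the balanced Gramian. *)
Lemma truncated_state_step w u k (ik : (k < n)%N) x r :
  truncated_state w u k.+1 x -> truncated_state w u k r ->
  fro (cmx Co *m x - cmx Co *m r) <= 2 * sg 0 (Ordinal ik) * fro u.
Proof.
move=> [x0 hx] [r0 hr]; set i0 := Ordinal ik; set s := 0 +i* w.
(* Equation residuals: rx vanishes on the first k + 1 coordinates, rr on the first k. *)
pose rx := s *: x - (cmx A *m x + cmx B *m u).
pose rr := s *: r - (cmx A *m r + cmx B *m u).
pose d := x - r; pose z := x + r.
have ed : s *: d = cmx A *m d + (rx - rr).
  by rewrite /rx /rr /d scalerBr mulmxBr; set a := cmx A *m x; set b := cmx A *m r;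
   apply/matrixP => i j; rewrite !mxE; ring.
have ez : s *: z = cmx A *m z + (2%:R *: (cmx B *m u) + (rx + rr)).
  by rewrite /rx /rr /z scalerDr mulmxDr; set a := cmx A *m x; set b := cmx A *m r;
   apply/matrixP => i j; rewrite !mxE; ring.
have rx0 (i : 'I_n) : (i < k.+1)%N -> rx i 0 = 0.
  by move=> h; rewrite mxE hx// [X in _ + X]mxE subrr.
have rr0 (i : 'I_n) : (i < k)%N -> rr i 0 = 0.
  by move=> h; rewrite mxE hr// [X in _ + X]mxE subrr.
(* d and z vanish beyond coordinate k and both equal x at k. Against them rx contributes nothing and
   rr contributes only at k, through h. *)
pose h := conjc (x i0 0) * rr i0 0.
have key (g : 'rV[R]_n) (y : 'cV[C]_n) : (forall i : 'I_n, (k < i)%N -> y i 0 = 0) -> y i0 0 = x i0 0 ->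
   (hadj y *m cmx (diag_mx g) *m rr) 0 0 = (g 0 i0)%:C * h /\
   (hadj y *m cmx (diag_mx g) *m rx) 0 0 = 0.
  move=> y0 yi; have E (t : 'cV[C]_n) : (hadj y *m cmx (diag_mx g) *m t) 0 0 =
      \sum_i conjc (y i 0) * (g 0 i)%:C * t i 0.
    by rewrite /cmx map_diag_mx mul_mx_diag mxE; apply: eq_bigr => i _; rewrite !mxE.
  split; rewrite E.
    rewrite (bigD1 i0)//= big1 ?addr0; first by rewrite yi /h; ring.
    move=> i ii0; have [ki|] := ltnP k i; first by rewrite y0// rmorph0 !mul0r.
    rewrite leq_eqVlt => /orP[/eqP ki|ki]; last by rewrite rr0// mulr0.
    by move: ii0; rewrite -(inj_eq val_inj)/= ki eqxx.
  rewrite big1// => i _; have [ki|ki] := ltnP k i; first by rewrite y0// rmorph0 !mul0r.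
  by rewrite rx0// mulr0.
have dz (i : 'I_n) : (k < i)%N -> d i 0 = 0 /\ z i 0 = 0.
  by move=> ki; rewrite /d /z !mxE x0// r0 ?(ltnW ki)// subrr addr0.
have dzi : d i0 0 = x i0 0 /\ z i0 0 = x i0 0.
  by rewrite /d /z !mxE r0//= subr0 addr0.
have sgT : (diag_mx sg)^T = diag_mx sg by rewrite tr_diag_mx.
pose iv : 'rV[R]_n := \row_i (sg 0 i)^-1.
have ivT : (diag_mx iv)^T = diag_mx iv by rewrite tr_diag_mx.
have ivs : diag_mx iv *m diag_mx sg = 1%:M.
  apply/matrixP => i j; rewrite mul_diag_mx !mxE.
  by case: eqP => [->|_]; rewrite ?mulr1n ?mulr0n ?mulr0// mulVf// gt_eqF.
have siv : diag_mx sg *m diag_mx iv = 1%:M by exact: mulmx1C.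
have CdE : cmx Co *m x - cmx Co *m r = cmx Co *m d by rewrite mulmxBr.
clearbody d z rx rr h.
have Q1 := quadratic_rate sgT ed.
have [k1 k2] := key sg d (fun i hi => (dz i hi).1) dzi.1.
have [k3 k4] := key iv z (fun i hi => (dz i hi).2) dzi.2.
(* The observability equation along d: rr enters with a minus sign and weight sg_k. *)
have P1 : fro2 (cmx Co *m x - cmx Co *m r) = - 2 * sg 0 i0 * complex.Re h.
  have L : A^T *m diag_mx sg + diag_mx sg *m A = - (Co^T *m Co).
    by apply/eqP; rewrite -addr_eq0 lyapo.
  move: Q1; rewrite L mulmxBr e11B k1 k2 sub0r.
  have -> : hadj d *m cmx (- (Co^T *m Co)) *m d = - (hadj (cmx Co *m d) *m (cmx Co *m d)).
    by rewrite cmxN cmxM mulmxN mulNmx hadjM hadj_cmx !mulmxA.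
  rewrite e11N -fro2_col CdE.
  by case: (h) => h1 h2 /= e; rewrite -(opprK (fro2 _)); apply/eqP; rewrite eqr_oppLR; apply/eqP; nra.
have Q2 := quadratic_rate ivT ez.
pose q := cmx (B^T *m diag_mx iv) *m z.
(* The controllability equation, multiplied by S^-1 on both sides, along z: rr enters with a plus
   sign and weight sg_k^-1. Scaling by sg_k^2 matches the two expressions in h, and the 4 here
   yields the factor 2 of the bound. *)
have P2 : - 2 * (sg 0 i0)^-1 * complex.Re h <= 4 * fro2 u.
  have L : A^T *m diag_mx iv + diag_mx iv *m A = - (diag_mx iv *m B *m (B^T *m diag_mx iv)).
    apply/eqP; rewrite -addr_eq0 !mulmxA; apply/eqP.
    have : diag_mx iv *m (A *m diag_mx sg + diag_mx sg *m A^T + B *m B^T) *m diag_mx iv = 0.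
      by rewrite lyapc mulmx0 mul0mx.
    rewrite !mulmxDr !mulmxDl -!mulmxA siv mulmx1 [diag_mx iv *m (diag_mx sg *m _)]mulmxA ivs mul1mx.
    by rewrite [X in X + _ = _]addrC.
  move: Q2; rewrite L !mulmxDr.
  have -> : hadj z *m cmx (- (diag_mx iv *m B *m (B^T *m diag_mx iv))) *m z = - (hadj q *m q).
    rewrite cmxN (cmxM (diag_mx iv *m B)) mulmxN mulNmx /q hadjM hadj_cmx trmx_mul trmxK ivT.
    by rewrite !mulmxA.
  have -> : hadj z *m cmx (diag_mx iv) *m (2%:R *: (cmx B *m u)) = 2%:R *: (hadj q *m u).
    by rewrite -scalemxAr /q hadjM hadj_cmx trmx_mul trmxK ivT cmxM !mulmxA.
  rewrite e11N -fro2_col !e11D e11Z k3 k4.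
  have := Re_dot_le q u.
  set t := (hadj q *m u) 0 0; rewrite !ReD.
  have -> : complex.Re (2%:R * t) = 2 * complex.Re t by case: (t) => ? ? /=; ring.
  rewrite (_ : iv 0 i0 = (sg 0 i0)^-1); last by rewrite mxE.
  rewrite !ReM /=; case: (h) => h1 h2 /=; lra.
rewrite -(ler_pXn2r (n := 2)) ?nnegrE ?mulr_ge0 ?fro_ge0// ?(ltW (sg_gt0 _))//.
rewrite fro_sq P1 !exprMn fro_sq.
have sp := sg_gt0 i0.
have -> : - 2 * sg 0 i0 * complex.Re h = sg 0 i0 ^+ 2 * (- 2 * (sg 0 i0)^-1 * complex.Re h).
  by field; rewrite gt_eqF.
have -> : 2 ^+ 2 * sg 0 i0 ^+ 2 * fro2 u = sg 0 i0 ^+ 2 * (4 * fro2 u) by ring.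
by rewrite ler_pM2l// exprn_gt0.
Qed.

Lemma truncated_state_error w u k l x : (k + l <= n)%N ->
  truncated_state w u (k + l) x -> exists2 r, truncated_state w u k r &
  fro (cmx Co *m x - cmx Co *m r) <=
    2 * (\sum_(i < n | (k <= i < k + l)%N) sg 0 i) * fro u.
Proof.
elim: l x => [|l IH] x; rewrite ?addn0 ?addnS.
  move=> _ hx; exists x => //; rewrite subrr fro_0 big1 ?mulr0 ?mul0r// => i.
  by case/andP => h1 h2; move: (leq_ltn_trans h1 h2); rewrite ltnn.
move=> kn hx; have [y hy] := truncated_state_exists w u (k + l).
have [r hr ler] := IH y (ltnW kn) hy; exists r => //.
have h := truncated_state_step kn hx hy.
have -> : cmx Co *m x - cmx Co *m r = (cmx Co *m x - cmx Co *m y) + (cmx Co *m y - cmx Co *m r).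
  by rewrite addrA subrK.
apply: le_trans (froD _ _) _; apply: le_trans (lerD h ler) _.
rewrite -mulrDl -mulrDr [X in _ <= _ * X * _](bigD1 (Ordinal kn))/=; last by rewrite leq_addr/=.
rewrite ler_wpM2r ?fro_ge0// ler_pM2l// lerD2l le_eqVlt; apply/orP; left; apply/eqP.
apply: eq_bigl => i; rewrite -(inj_eq val_inj)/= ltnS [(i <= k + l)%N]leq_eqVlt.
by case: ltngtP => //=; rewrite ?andbT ?andbF//; case: (k <= i)%N.
Qed.

End Balanced.

Lemma linprod_diag n k (g : 'rV[C]_n) ls (y : 'M[C]_(n, k)) i j :
  linprod (diag_mx g) ls y i j = \prod_(l <- ls) (g 0 i - l) * y i j.
Proof.
elim: ls y => [|l ls IH] y /=; first by rewrite big_nil mul1r.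
rewrite IH big_cons mulmxBl mul_diag_mx mul_scalar_mx !mxE; ring.
Qed.

(* If A11 v = i w v then S2^2 A21 v = A21 S1^2 v, where S1 and S2 are the diagonal
   blocks of the Gramian; hence the characteristic polynomial of S2^2, evaluated at
   S1^2 and applied to v, gives an eigenvector of A. *)
Lemma balanced_truncation_stable m p n1 n2 (A : 'M[R]_(n1 + n2)) (B : 'M[R]_(n1 + n2, m))
    (Co : 'M[R]_(p, n1 + n2)) (sg : 'rV[R]_(n1 + n2)) :
  (forall i, 0 < sg 0 i) ->
  A *m diag_mx sg + diag_mx sg *m A^T + B *m B^T = 0 ->
  A^T *m diag_mx sg + diag_mx sg *m A + Co^T *m Co = 0 ->
  (forall i j, sg 0 (lshift n2 i) != sg 0 (rshift n1 j)) ->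
  hurwitz A -> hurwitz (ulsubmx A).
Proof.
move=> sg0 lc lo dis hA lam eig.
rewrite ltNge; apply/negP => lam0.
pose s1 := lsubmx sg; pose s2 := rsubmx sg.
pose A11 := ulsubmx A; pose A12 := ursubmx A; pose A21 := dlsubmx A; pose A22 := drsubmx A.
pose B1 := usubmx B; pose B2 := dsubmx B; pose C1 := lsubmx Co; pose C2 := rsubmx Co.
have sgE : diag_mx sg = block_mx (diag_mx s1) 0 0 (diag_mx s2).
  by rewrite -[sg]hsubmxK diag_mx_row.
have AE : A = block_mx A11 A12 A21 A22 by rewrite submxK.
have BE : B = col_mx B1 B2 by rewrite vsubmxK.
have CE : Co = row_mx C1 C2 by rewrite hsubmxK.
have := lc; rewrite {1 2}AE BE sgE tr_block_mx tr_col_mx !mulmx_block mul_col_row.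
rewrite !mulmx0 !mul0mx !addr0 !add0r !add_block_mx => /eqP; rewrite block_mx_eq0.
move=> /and4P[/eqP c11 _ /eqP c21 _].
have := lo; rewrite {1 2}AE CE sgE tr_block_mx tr_row_mx !mulmx_block mul_col_row.
rewrite !mulmx0 !mul0mx !addr0 !add0r !add_block_mx => /eqP; rewrite block_mx_eq0.
move=> /and4P[/eqP o11 _ /eqP o21 _].
have s1p i : 0 < s1 0 i by rewrite mxE sg0.
pose S1 := cmx (diag_mx s1); pose S2 := cmx (diag_mx s2).
have S1H : hadj S1 = S1 by rewrite hadj_cmx tr_diag_mx.
have lin0 q k l (X Y : 'M[R]_(q, k)) (U : 'M[R]_(q, l)) (Z : 'M[R]_(l, k)) (v : 'cV[C]_k) :
    X + Y + U *m Z = 0 -> cmx X *m v + cmx Y *m v = - (cmx U *m (cmx Z *m v)).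
  move=> /(congr1 (fun M => cmx M *m v)).
  rewrite !cmxD !mulmxDl cmxM -mulmxA => e; apply/eqP; rewrite -addr_eq0 e.
  by rewrite /cmx map_mx0 mul0mx.
have SqE (v : 'cV[C]_n1) : (hadj v *m S1 *m v) 0 0 = (\sum_i s1 0 i * nsq (v i 0))%:C.
  rewrite /S1 /cmx map_diag_mx mul_mx_diag mxE real_complex_sum.
  by apply: eq_bigr => i _; rewrite real_complexM nsqE !mxE; ring.
(* The observability equation tested on an eigenvector gives Re lam <= 0, so lam lies on the axis
   and C1 v = 0. *)
have quad (v : 'cV[C]_n1) : cmx A11 *m v = lam *: v ->
    2 * complex.Re lam * (\sum_i s1 0 i * nsq (v i 0)) = - fro2 (cmx C1 *m v).
  move=> hv; set t := \sum_i _.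
  have /(congr1 (fun M => (hadj v *m M) 0 0)) := lin0 _ _ _ _ _ _ _ v o11.
  rewrite mulmxN e11N mulmxDr e11D !cmxM -!mulmxA hv -!scalemxAr e11Z.
  have -> : (hadj v *m (cmx C1^T *m (cmx C1 *m v))) 0 0 = (fro2 (cmx C1 *m v))%:C.
    by rewrite fro2_col hadjM hadj_cmx !mulmxA.
  have -> : (hadj v *m (cmx A11^T *m (cmx (diag_mx s1) *m v))) 0 0 = conjc lam * t%:C.
    rewrite mulmxA -hadj_cmx -hadjM hv hadjZ -scalemxAl e11Z.
    by rewrite mulmxA SqE.
  rewrite mulmxA SqE -/t => /(congr1 (@complex.Re R)).
  by case: (lam) => a b /=; lra.
have [v hv v0] := eigenvalue_colP _ _ eig.
have nsum : 0 < \sum_i s1 0 i * nsq (v i 0).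
  have ge0 i : 0 <= s1 0 i * nsq (v i 0) by rewrite mulr_ge0 ?nsq_ge0 ?ltW.
  rewrite lt_neqAle sumr_ge0// andbT eq_sym; apply: contra v0.
  rewrite psumr_eq0// => /allP h; apply/eqP/matrixP => i j; rewrite ord1 mxE.
  have := h i (mem_index_enum _); rewrite /= mulf_eq0 gt_eqF//= nsq_eq0.
  by move/eqP.
have lamR : complex.Re lam = 0.
  have q := quad v hv; have := fro2_ge0 (cmx C1 *m v) => f0.
  by apply/eqP; rewrite eq_le lam0 andbT; nra.
have lamN : conjc lam = - lam.
  by case: (lam) lamR => a b /= ->; apply/eqP; rewrite eq_complex /= oppr0 !eqxx.
have lamN' : conjc (- lam) = lam.
  by case: (lam) lamR => a b /= ->; apply/eqP; rewrite eq_complex /= oppr0 opprK !eqxx.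
(* From C1 x = 0, S1 x is an eigenvector of A11^T at - lam; then B1^T S1 x = 0. With both sources
   gone, the Lyapunov equations become homogeneous along x and S1 x, and their off-diagonal blocks
   commute S^2 past A21. *)
have step (x : 'cV[C]_n1) : cmx A11 *m x = lam *: x ->
   cmx A11 *m (S1 *m (S1 *m x)) = lam *: (S1 *m (S1 *m x)) /\
   cmx A21 *m (S1 *m (S1 *m x)) = S2 *m (S2 *m (cmx A21 *m x)).
  move=> hx; have C1x : cmx C1 *m x = 0.
    by apply: fro2_eq0; apply/eqP; rewrite -oppr_eq0 -quad// lamR mulr0 mul0r.
  set y := S1 *m x.
  have Ay : cmx A11^T *m y = - lam *: y.
    have := lin0 _ _ _ _ _ _ _ x o11; rewrite C1x mulmx0 oppr0 !cmxM -!mulmxA hx => /eqP.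
    by rewrite addr_eq0 => /eqP->; rewrite -scalemxAr scaleNr.
  have B1y : cmx B1^T *m y = 0.
    apply: fro2_eq0; apply: complexI; rewrite fro2_col hadjM hadj_cmx trmxK.
    have /(congr1 (fun M => hadj y *m M)) := lin0 _ _ _ _ _ _ _ y c11.
    rewrite mulmxDr mulmxN !cmxM -!mulmxA Ay -!scalemxAr !mulmxA.
    have -> : hadj y *m cmx A11 = lam *: hadj y.
      by rewrite -[cmx A11]hadjK -hadjM hadj_cmx Ay hadjZ lamN'.
    rewrite -!scalemxAl -/S1 scaleNr subrr => /eqP; rewrite eq_sym oppr_eq0 => /eqP->.
    by rewrite mxE.
  have e1 := lin0 _ _ _ _ _ _ _ y c11; rewrite B1y mulmx0 oppr0 !cmxM -!mulmxA Ay in e1.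
  have e2 := lin0 _ _ _ _ _ _ _ y c21; rewrite B1y mulmx0 oppr0 !cmxM -!mulmxA in e2.
  have e3 := lin0 _ _ _ _ _ _ _ x o21; rewrite C1x mulmx0 oppr0 !cmxM -!mulmxA in e3.
  split.
    by move/eqP: e1; rewrite addr_eq0 => /eqP->; rewrite -scalemxAr scaleNr opprK.
  move/eqP: e2; rewrite addr_eq0 => /eqP->; move/eqP: e3; rewrite addr_eq0 => /eqP->.
  by rewrite mulmxN opprK.
pose g1 : 'rV[C]_n1 := \row_i (s1 0 i ^+ 2)%:C.
pose g2 : 'rV[C]_n2 := \row_i (s2 0 i ^+ 2)%:C.
have g1E (x : 'cV[C]_n1) : diag_mx g1 *m x = S1 *m (S1 *m x).
  apply/matrixP => i j; rewrite /S1 /cmx map_diag_mx !mul_diag_mx !mxE expr2 real_complexM; ring.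
have g2E (x : 'cV[C]_n2) : diag_mx g2 *m x = S2 *m (S2 *m x).
  apply/matrixP => i j; rewrite /S2 /cmx map_diag_mx !mul_diag_mx !mxE expr2 real_complexM; ring.
pose ls := [seq (s2 0 j ^+ 2)%:C | j <- enum 'I_n2].
have main (l : seq C) (x : 'cV[C]_n1) : cmx A11 *m x = lam *: x ->
   cmx A11 *m linprod (diag_mx g1) l x = lam *: linprod (diag_mx g1) l x /\
   cmx A21 *m linprod (diag_mx g1) l x = linprod (diag_mx g2) l (cmx A21 *m x).
  elim: l x => [|a l IH] x hx //=.
  have [h1 h2] := step x hx.
  have hx' : cmx A11 *m ((diag_mx g1 - a%:M) *m x) = lam *: ((diag_mx g1 - a%:M) *m x).
    by rewrite mulmxBl mulmxBr g1E h1 mul_scalar_mx -scalemxAr hx scalerBr !scalerA [a * _]mulrC.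
  have [h3 h4] := IH _ hx'; split=> //.
  by rewrite h4 mulmxBl g1E mulmxBr h2 mul_scalar_mx -scalemxAr mulmxBl g2E mul_scalar_mx.
have [f1 f2] := main ls v hv.
set vs := linprod (diag_mx g1) ls v in f1 f2.
(* Each factor is a difference of squares of distinct positive Gramian entries. *)
have vs0 : vs != 0.
  apply: contra v0 => /eqP h; apply/eqP/matrixP => i j; have /matrixP/(_ i j) := h.
  rewrite linprod_diag !mxE => /eqP; rewrite mulf_eq0 => /orP[|/eqP//].
  rewrite big_map prodf_seq_eq0 => /hasP[k _ /=]; rewrite subr_eq0 => /eqP /complexI /eqP.
  rewrite eqrXn2 ?ltW//; last by rewrite mxE sg0.
  by rewrite !mxE (negbTE (dis _ _)).
(* [ls] contains every diagonal entry of S2^2, so the product annihilates it. *)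
have f3 : cmx A21 *m vs = 0.
  rewrite f2; apply/matrixP => i j; rewrite linprod_diag big_map (bigD1_seq i) ?mem_enum ?enum_uniq//=.
  by rewrite !mxE subrr !mul0r.
have /hurwitzN : hurwitz A by [].
move=> /(_ lam lam0)/negP; apply; apply/eigenvalue_colP; exists (col_mx vs 0).
  have -> : cmx A = block_mx (cmx A11) (cmx A12) (cmx A21) (cmx A22).
    by rewrite {1}AE /cmx map_block_mx.
  by rewrite mul_block_col !mulmx0 !addr0 f1 f3 scale_col_mx scaler0.
by rewrite col_mx_eq0 negb_and vs0.
Qed.
End BalancedTruncation.

(** * From the balancing transformation to the error bound *)

Section BalancedTruncationError.
Variable R : realType.
Local Notation C := R[i].

Lemma cmx_invmx n (T : 'M[R]_n) : cmx (invmx T) = invmx (cmx T).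
Proof. exact: map_invmx. Qed.

Lemma cmx_unit n (T : 'M[R]_n) : (cmx T \in unitmx) = (T \in unitmx).
Proof. exact: map_unitmx. Qed.

Lemma hurwitz_similar n (T A : 'M[R]_n) : T \in unitmx -> hurwitz A ->
  hurwitz (T *m A *m invmx T).
Proof.
move=> TU hA l /eigenvalue_colP[x hx x0]; apply: hA; apply/eigenvalue_colP.
have TU' : cmx T \in unitmx by rewrite cmx_unit.
exists (invmx (cmx T) *m x).
  have e : cmx T *m (cmx A *m (invmx (cmx T) *m x)) = l *: x.
    by rewrite -cmx_invmx !mulmxA -!cmxM; exact: hx.
  by rewrite -[LHS](mulKmx TU') e scalemxAr.
apply: contra x0 => /eqP h; by rewrite -[x](mulKVmx TU') h mulmx0.
Qed.

Lemma posdef_factor_unit n (W Q : 'M[R]_n) : posdefmx W -> W = Q *m Q^T -> Q \in unitmx.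
Proof.
move=> [_ hW] WE; rewrite -row_free_unit -kermx_eq0; apply/negPn/negP => /rowV0Pn[v /sub_kermxP vQ v0].
have := hW v^T; rewrite -trmx0 (inj_eq trmx_inj) => /(_ v0).
by rewrite trmxK WE mulmxA vQ !mul0mx mxE ltxx.
Qed.

Lemma balanced_truncationP m p nr nt (S : lti R m p (nr + nt)) sig Sr :
  balanced_truncation S sig Sr ->
  exists2 T, T \in unitmx & let Sb := change_coordinates T S in
  [/\ forall i, 0 < sig 0 i,
      ssA Sb *m diag_mx sig + diag_mx sig *m (ssA Sb)^T + ssB Sb *m (ssB Sb)^T = 0,
      (ssA Sb)^T *m diag_mx sig + diag_mx sig *m ssA Sb + (ssC Sb)^T *m ssC Sb = 0 &
      Sr = Lti (ulsubmx (ssA Sb)) (usubmx (ssB Sb)) (lsubmx (ssC Sb))].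
Proof.
case: S => A B C0 [Wc [Wo [Q [U [lam]]]]] /=.
set D := diag_mx (map_mx Num.sqrt sig); set T := D *m U^T *m invmx Q.
move=> [[Wcp Ec] [Wop Eo] [_ sigE] [WcE UU QE] SrE].
have QU := posdef_factor_unit Wcp WcE.
have UU' : U^T *m U = 1%:M by exact: mulmx1C.
have [UuT UtU] : U \in unitmx /\ U^T \in unitmx by exact: mulmx1_unit.
have sig0 i : 0 <= sig 0 i by rewrite sigE mxE sqrtr_ge0.
(* Being square roots, the entries are only known to be nonnegative; a zero entry would give a
   nonzero vector on which the quadratic form of Wo vanishes. *)
have sigp i : 0 < sig 0 i.
  rewrite lt_neqAle sig0 andbT eq_sym; apply/eqP => si.
  pose e : 'cV[R]_(nr + nt) := delta_mx i 0.
  have e0 : Q *m (U *m e) != 0.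
    apply/eqP => h; have : e = invmx U *m (invmx Q *m (Q *m (U *m e))) by rewrite mulKmx// mulKmx.
    rewrite h !mulmx0 => /matrixP/(_ i 0); rewrite !mxE !eqxx => /eqP.
    by rewrite oner_eq0.
  have := Wop.2 _ e0.
  have -> : (Q *m (U *m e))^T *m Wo *m (Q *m (U *m e)) = e^T *m U^T *m (Q^T *m Wo *m Q) *m U *m e.
    by rewrite !trmx_mul !mulmxA.
  rewrite QE !mulmxA -[_ *m U^T *m U]mulmxA UU' mulmx1 -[_ *m U^T *m U]mulmxA UU' mulmx1.
  rewrite -[_ *m diag_mx sig *m e]mulmxA.
  have -> : diag_mx sig *m e = 0.
    apply/matrixP => a b; rewrite mul_diag_mx !mxE; have [->|] := eqVneq a i; first by rewrite si mul0r.
    by rewrite mulr0.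
  by rewrite mulmx0 mxE ltxx.
have DD : D *m D = diag_mx sig.
  rewrite /D mul_diag_mx; apply/matrixP => i j; rewrite !mxE.
  case: eqP => [->|_]; rewrite ?mulr1n ?mulr0n ?mulr0// -expr2 sqr_sqrtr//.
have DT : D^T = D by rewrite /D tr_diag_mx.
have DU : D \in unitmx.
  have : D *m D \in unitmx.
    by rewrite DD unitmxE det_diag unitfE; apply/prodf_neq0 => i _; rewrite gt_eqF.
  by rewrite unitmx_mul => /andP[].
have TU : T \in unitmx by rewrite !unitmx_mul DU UtU unitmx_inv.
have TW : T *m Wc *m T^T = diag_mx sig.
  rewrite /T WcE !trmx_mul trmxK DT !mulmxA mulmxKV//.
  rewrite trmx_inv -[_ *m Q^T *m invmx Q^T]mulmxA mulmxV ?unitmx_tr// mulmx1.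
  by rewrite -[_ *m U^T *m U]mulmxA UU' mulmx1 DD.
have TO : T^T *m diag_mx sig *m T = Wo.
  rewrite /T !trmx_mul trmxK DT !mulmxA -DD trmx_inv.
  have -> : invmx Q^T *m U *m D *m (D *m D) *m D *m U^T *m invmx Q =
     invmx Q^T *m (U *m (D *m D) *m (D *m D) *m U^T) *m invmx Q by rewrite !mulmxA.
  by rewrite DD -QE !mulmxA mulVmx ?unitmx_tr// mul1mx mulmxK.
have TTU : T^T \in unitmx by rewrite unitmx_tr.
clearbody T; exists T => //; split=> //=.
  have -> : (T *m A *m invmx T)^T = invmx T^T *m A^T *m T^T.
    by rewrite !trmx_mul trmx_inv mulmxA.
  have -> : diag_mx sig *m (invmx T^T *m A^T *m T^T) = T *m (Wc *m A^T) *m T^T.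
    by rewrite -TW !mulmxA mulmxK.
  have -> : T *m A *m invmx T *m diag_mx sig = T *m (A *m Wc) *m T^T.
    by rewrite -TW !mulmxA mulmxKV.
  have -> : T *m B *m (T *m B)^T = T *m (B *m B^T) *m T^T by rewrite trmx_mul !mulmxA.
  by rewrite -!mulmxDl -!mulmxDr Ec mulmx0 mul0mx.
have -> : (T *m A *m invmx T)^T = invmx T^T *m A^T *m T^T.
  by rewrite !trmx_mul trmx_inv mulmxA.
have Dsig : diag_mx sig = invmx T^T *m Wo *m invmx T.
  by rewrite -TO !mulmxA mulVmx// mul1mx mulmxK.
have -> : invmx T^T *m A^T *m T^T *m diag_mx sig = invmx T^T *m (A^T *m Wo) *m invmx T.
  by rewrite Dsig !mulmxA mulmxK.
have -> : diag_mx sig *m (T *m A *m invmx T) = invmx T^T *m (Wo *m A) *m invmx T.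
  by rewrite Dsig !mulmxA mulmxKV.
have -> : (C0 *m invmx T)^T *m (C0 *m invmx T) = invmx T^T *m (C0^T *m C0) *m invmx T.
  by rewrite trmx_mul trmx_inv !mulmxA.
by rewrite -!mulmxDl -!mulmxDr Eo mulmx0 mul0mx.
Qed.

Lemma freqresp_change_coordinates m p n (T : 'M[R]_n) (S : lti R m p n) w :
  T \in unitmx -> hurwitz (ssA S) ->
  freqresp (change_coordinates T S) w = freqresp S w.
Proof.
move=> TU hA; have hT : hurwitz (ssA (change_coordinates T S)) by exact: hurwitz_similar.
by rewrite -(freq_tf w hA) -(freq_tf w hT) tf_change_coordinates.
Qed.

Lemma eigenvalue_diag n (d : 'rV[R]_n) i : eigenvalue (diag_mx d) (d 0 i).
Proof.
apply/eigenvalueP; exists (delta_mx 0 i).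
  apply/matrixP => a b; rewrite mul_mx_diag !mxE mulrC; case: (eqVneq b i) => [->|_]; rewrite ?andbF ?mulr0//.
apply/eqP => /matrixP/(_ 0 i); rewrite !mxE !eqxx => /eqP; by rewrite oner_eq0.
Qed.

Lemma balanced_truncation_error m p nr nt (S : lti R m p (nr + nt)) sig Sr :
  hurwitz (ssA S) -> balanced_truncation S sig Sr ->
  (forall a : R, ~ (eigenvalue (diag_mx (lsubmx sig)) a /\
                    eigenvalue (diag_mx (rsubmx sig)) a)) ->
  hurwitz (ssA Sr) /\
  forall w, opbound (2 * \sum_(i < nt) sig 0 (rshift nr i)) (freqresp Sr w - freqresp S w).
Proof.
move=> hA /balanced_truncationP[T TU /= [sg0 lc lo SrE]] dis.
have hb : hurwitz (T *m ssA S *m invmx T) by exact: hurwitz_similar.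
have dis' i j : sig 0 (lshift nt i) != sig 0 (rshift nr j).
  apply/eqP => e; apply: (dis (sig 0 (lshift nt i))); split.
    by have := eigenvalue_diag (lsubmx sig) i; rewrite mxE.
  by have := eigenvalue_diag (rsubmx sig) j; rewrite mxE -e.
have hr : hurwitz (ssA Sr) by rewrite SrE; exact: balanced_truncation_stable sg0 lc lo dis' hb.
split=> // w u.
rewrite -(freqresp_change_coordinates w TU hA).
set Sb := change_coordinates T S; set s := 0 +i* w.
pose x := resolvent (ssA Sb) s *m (cmx (ssB Sb) *m u).
have xE : (s%:M - cmx (ssA Sb)) *m x = cmx (ssB Sb) *m u.
  by rewrite mulKVmx//; exact: hurwitz_unit.
(* The full state is the case where nothing is truncated. *)
have hx : truncated_state (ssA Sb) (ssB Sb) w u (nr + nt) x.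
  split=> i; first by rewrite leqNgt ltn_ord.
  move=> _; rewrite -xE mulmxBl mul_scalar_mx; congr (_ i 0).
  by rewrite addrC subrK.
have [y hy ley] := truncated_state_error sg0 lc lo (leqnn _) hx.
have yE : y = col_mx (usubmx y) 0.
  rewrite -[LHS]vsubmxK; congr col_mx; apply/matrixP => i j; rewrite ord1 !mxE.
  by apply: hy.1; rewrite /= leq_addr.
(* The leading part of y solves the state equation of [Sr], whose stability makes it the only
   solution. *)
have uE : (s%:M - cmx (ssA Sr)) *m usubmx y = cmx (ssB Sr) *m u.
  rewrite mulmxBl mul_scalar_mx; apply/eqP; rewrite subr_eq; apply/eqP.
  apply/matrixP => i j; rewrite ord1.
  have := hy.2 (lshift nt i) (ltn_ord i).
  have AE : cmx (ssA Sb) *m y = col_mx (cmx (ssA Sr) *m usubmx y) (cmx (dlsubmx (ssA Sb)) *m usubmx y).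
    rewrite {1}yE SrE -{1}[ssA Sb]submxK /cmx map_block_mx mul_block_col !mulmx0 !addr0 //.
  have BE : cmx (ssB Sb) *m u = col_mx (cmx (ssB Sr) *m u) (cmx (dsubmx (ssB Sb)) *m u).
    by rewrite SrE -{1}[ssB Sb]vsubmxK /cmx map_col_mx mul_col_mx.
  rewrite AE BE add_col_mx [(col_mx _ _) _ _]col_mxEu => e.
  by rewrite addrC -e !mxE.
have E : (freqresp Sr w - freqresp Sb w) *m u = - (cmx (ssC Sb) *m x - cmx (ssC Sb) *m y).
  have -> : cmx (ssC Sb) *m y = cmx (ssC Sr) *m usubmx y.
    by rewrite {1}yE SrE -{1}[ssC Sb]hsubmxK /cmx map_row_mx mul_row_col mulmx0 addr0.
  rewrite opprB mulmxBl /freqresp -!mulmxA; congr (_ *m _ - _).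
  rewrite -uE /resolvent mulKmx//; exact: hurwitz_unit.
have froN k (M : 'M[C]_(k, 1)) : fro (- M) = fro M.
  by rewrite /fro; congr Num.sqrt; apply: eq_bigr => i _; apply: eq_bigr => j _; rewrite mxE nsqN.
rewrite E froN (le_trans ley)// ler_wpM2r ?fro_ge0// ler_pM2l//.
rewrite big_split_ord /= big1 ?add0r; last by move=> i; rewrite leqNgt ltn_ord.
rewrite le_eqVlt; apply/orP; left; apply/eqP; apply: eq_bigl => i.
by rewrite leq_addr /= ltn_add2l ltn_ord.
Qed.

End BalancedTruncationError.

(** * Small gain and internal stability *)

Section SmallGain.
Variable R : realType.
Local Notation C := R[i].

Lemma cdiff_prod (I : Type) (r : seq I) (f : I -> R -> C) :
  (forall i, cdiff (f i)) -> cdiff (fun x => \prod_(i <- r) f i x).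
Proof.
move=> h; elim: r => [|i r IH].
  by apply: cdiff_ext (cdiff_cst 1) => x; rewrite big_nil.
by apply: cdiff_ext (cdiffM (h i) IH) => x; rewrite big_cons.
Qed.

Lemma cdiff_det n (F : R -> 'M[C]_n) : mxcdiff F -> cdiff (fun x => \det (F x)).
Proof.
move=> hF; apply: cdiff_sum => s; apply: cdiffM; first exact: cdiff_cst.
by apply: cdiff_prod => i; exact: hF.
Qed.

Lemma cdiff_real : cdiff (fun x : R => x%:C).
Proof.
exists (fun=> 1) => x; split; first exact: is_derive_id.
exact: is_derive_cst.
Qed.

Lemma cdiff_nsq f : @cdiff R f -> continuous (fun x => nsq (f x)).
Proof.
move=> hf; have := @mxcdiff_fro2 _ 1 1 (fun x => (f x)%:M).
have E : (fun x => fro2 ((f x)%:M : 'M[C]_1)) = (fun x => nsq (f x)).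
  by apply/funext => x; rewrite /fro2 !big_ord1 mxE eqxx mulr1n.
rewrite E; apply=> i j; apply: cdiff_ext hf => x.
by rewrite mxE !ord1 eqxx mulr1n.
Qed.

Lemma mxcdiff_affine n (M N : 'M[R]_n) (s : C) :
  mxcdiff (fun t => s%:M - cmx (M + t *: N)).
Proof.
move=> i j; apply: (@cdiff_ext _ (fun t : R => (s%:M : 'M[C]_n) i j + (- (M i j)%:C + t%:C * (- (N i j)%:C)))).
  by move=> t; rewrite !mxE real_complexD real_complexM; ring.
apply: cdiffD; first exact: cdiff_cst.
by apply: cdiffD; [exact: cdiff_cst|apply: cdiffM; [exact: cdiff_real|exact: cdiff_cst]].
Qed.

(** If Re l > 0, every Hurwitz matrix of size n has |det (l - A)| >= (Re l)^n, since each eigenvalue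
    is farther than Re l from l. By continuity of the determinant this persists at T; no eigenvalue
    has to be followed. *)
Lemma hurwitz_limit n (M N : 'M[R]_n) (T : R) :
  (forall e : R, 0 < e -> exists2 t, `|t - T| < e & hurwitz (M + t *: N)) ->
  forall l : C, eigenvalue (cmx (M + T *: N)) l -> complex.Re l <= 0.
Proof.
move=> h l el; rewrite leNgt; apply/negP => l0.
pose f t := nsq (\det (l%:M - cmx (M + t *: N))).
have cf : continuous f by apply: cdiff_nsq; apply: cdiff_det; exact: mxcdiff_affine.
have fT : f T = 0.
  rewrite /f; move: el; rewrite eigenvalue_unitmx unitmxE unitfE negbK => /eqP->.
  by rewrite /nsq /= expr0n addr0.
pose c := (complex.Re l ^+ 2) ^+ n.
have c0 : 0 < c by rewrite !exprn_gt0.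
have fge t : hurwitz (M + t *: N) -> c <= f t.
  move=> ht; have [ls [sz eig _ dE]] := newton_exists (cmx (M + t *: N)).
  rewrite /f dE /c -sz; have : all (fun z => complex.Re z < 0) ls by apply/allP => z /eig /ht.
  elim: (ls) => [|z s IH] /=; first by rewrite big_nil /nsq /= expr1n expr0n addr0.
  move=> /andP[z0 hs]; rewrite big_cons nsqM exprS.
  apply: ler_pM; [exact: sqr_ge0|by rewrite exprn_ge0 ?sqr_ge0| |exact: IH].
  rewrite /nsq ReB; apply: (@le_trans _ _ ((complex.Re l - complex.Re z) ^+ 2)); last by rewrite lerDl sqr_ge0.
  rewrite ler_pXn2r ?nnegrE ?subr_ge0 ?ltW//; first by rewrite ltrDl oppr_gt0.
  exact: lt_trans l0.
have /cvgrPdist_lt/(_ c c0) := cf T.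
rewrite fT => /nbhs_ballP[e /= e0 he].
have [t te ht] := h e e0.
have := he t; rewrite /ball /= distrC => /(_ te); rewrite sub0r normrN ger0_norm ?nsq_ge0//.
by rewrite ltNge fge.
Qed.

(** An eigenvector x of M + t N at Re l >= 0 satisfies x = t (l - M)^-1 N x, impossible for small t
    because the resolvent is bounded on the whole closed half-plane. *)
Lemma hurwitz_open n (M N : 'M[R]_n) : hurwitz M ->
  exists2 d : R, 0 < d & forall t, `|t| < d -> hurwitz (M + t *: N).
Proof.
move=> hM; have [c c0 hc] := resolvent_bounded hM.
pose k := c * fro (cmx N) + 1.
have k0 : 0 < k by rewrite ltr_wpDl ?mulr_ge0 ?fro_ge0.
exists k^-1; first by rewrite invr_gt0.
move=> t tk l /eigenvalue_colP[x hx x0]; rewrite ltNge; apply/negP => l0.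
have e : (l%:M - cmx M) *m x = t%:C *: (cmx N *m x).
  rewrite mulmxBl mul_scalar_mx -hx; apply/eqP; rewrite subr_eq scalemxAl -mulmxDl; apply/eqP.
  by congr (_ *m _); apply/matrixP => i j; rewrite !mxE real_complexD real_complexM addrC.
have e2 : x = t%:C *: (resolvent M l *m (cmx N *m x)).
  by rewrite scalemxAr -e /resolvent mulKmx// hurwitz_unit.
have x1 : 0 < fro x.
  by rewrite lt_neqAle fro_ge0 andbT eq_sym; apply: contra x0 => /eqP/fro_eq0->.
have : fro x <= `|t| * (c * (fro (cmx N) * fro x)).
  rewrite {1}e2 fro_scale nsq_real sqrtr_sqr ler_wpM2l//.
  apply: (le_trans (opbound_fro _ _)); apply: ler_pM; rewrite ?fro_ge0 ?hc//.
  exact: opbound_fro.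
rewrite 2!mulrA -[leLHS]mul1r ler_pM2r// => h.
have : `|t| * c * fro (cmx N) < 1.
  apply: (@le_lt_trans _ _ (`|t| * k)).
    by rewrite -mulrA ler_wpM2l// /k lerDl.
  by rewrite -ltr_pdivlMr// mul1r.
by rewrite ltNge h.
Qed.

Lemma hurwitz_homotopy n (M N : 'M[R]_n) : hurwitz M ->
  (forall t w : R, 0 <= t <= 1 -> ~~ eigenvalue (cmx (M + t *: N)) (0 +i* w)) ->
  hurwitz (M + N).
Proof.
move=> hM hax.
(* Stability is asked on all of [0, t], so that it holds everywhere below the supremum. There
   [hurwitz_limit] and the hypothesis on the axis give stability, and [hurwitz_open] goes beyond. *)
pose S := [set t : R | 0 <= t <= 1 /\ forall u, 0 <= u <= t -> hurwitz (M + u *: N)].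
have S0 : S 0.
  split; first by rewrite lexx ler01.
  by move=> u /andP[u0 u1]; have -> : u = 0; [by apply/eqP; rewrite eq_le u0 u1|]; rewrite scale0r addr0.
have ubS : has_ubound S by exists 1 => t [/andP[]].
pose T := sup S.
have T0 : 0 <= T by exact: ub_le_sup.
have T1 : T <= 1 by apply: ge_sup; [exists 0|move=> t [/andP[]]].
have ltT u : 0 <= u < T -> hurwitz (M + u *: N).
  move=> /andP[u0 uT]; have hs : has_sup S by split; [exists 0|].
  have Tu : 0 < T - u by rewrite subr_gt0.
  have [v [_ hv]] := sup_adherent Tu hs.
  by rewrite subKr => uv; apply: hv; rewrite u0 ltW.
have hT : hurwitz (M + T *: N).
  have [T00|T00] := eqVneq T 0; first by rewrite T00 scale0r addr0.
  have Tp : 0 < T by rewrite lt_neqAle eq_sym T00.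
  move=> l el; have := @hurwitz_limit _ M N T _ l el; rewrite le_eqVlt => H.
  have /H/orP[/eqP l0|//] : forall e : R, 0 < e -> exists2 t, `|t - T| < e & hurwitz (M + t *: N).
    move=> e e0; exists (Num.max 0 (T - e / 2)).
      rewrite ltr_norml; apply/andP; split.
        by rewrite ltrBrDr addrC lt_max; apply/orP; right; lra.
      by rewrite ltrBlDr gt_max; apply/andP; split; lra.
    apply: ltT; rewrite le_max lexx/= gt_max Tp/=; lra.
  have := hax T (complex.Im l); rewrite T0 T1 => /(_ isT).
  have -> : 0 +i* complex.Im l = l by case: (l) l0 => a b /= ->.
  by rewrite el.
have [d d0 hd] := hurwitz_open N hT.
have [T1'|T1'] := eqVneq T 1; first by move: hT; rewrite T1' scale1r.
have T1'' : T < 1 by rewrite lt_neqAle T1'.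
pose v := Num.min 1 (T + d / 2).
have Tv : T < v by rewrite lt_min T1''/=; lra.
have Sv : S v.
  split; first by rewrite ge_min lexx/= andbT (le_trans T0)// ltW.
  move=> u /andP[u0 uv]; have [uT|Tu] := ltP u T; first by apply: ltT; rewrite u0.
  have -> : M + u *: N = M + T *: N + (u - T) *: N by rewrite -addrA -scalerDl [T + _]addrC subrK.
  apply: hd; rewrite ger0_norm ?subr_ge0// ltrBlDl.
  by apply: (le_lt_trans uv); rewrite gt_min; apply/orP; right; lra.
have vT : v <= T := ub_le_sup ubS Sv.
by have /negP := negbT (ltxx T); case; exact: lt_le_trans Tv vT.
Qed.

Lemma hurwitz_block_lower n1 n2 (A : 'M[R]_n1) (D : 'M[R]_n2) L :
  hurwitz A -> hurwitz D -> hurwitz (block_mx A 0 L D).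
Proof.
move=> hA hD l /eigenvalue_colP[x]; rewrite -[x]vsubmxK.
move: (usubmx x) (dsubmx x) => x1 x2.
rewrite /cmx map_block_mx map_mx0 mul_block_col mul0mx addr0 scale_col_mx => /eq_col_mx[e1 e2] x0.
have [x10|x10] := eqVneq x1 0; last by apply: hA; apply/eigenvalue_colP; exists x1.
apply: hD; apply/eigenvalue_colP; exists x2; first by move: e2; rewrite x10 mulmx0 add0r.
by move: x0; rewrite col_mx_eq0 x10 eqxx.
Qed.

Lemma mulmx_resolvent n k (A : 'M[R]_n) s (x y : 'M[C]_(n, k)) : (s%:M - cmx A) \in unitmx ->
  s *: x = cmx A *m x + y -> x = resolvent A s *m y.
Proof.
move=> U h; have -> : y = (s%:M - cmx A) *m x by rewrite mulmxBl mul_scalar_mx h addrC addKr.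
by rewrite /resolvent mulKmx.
Qed.

(** The homotopy scales the path from D back to X: at t = 0 the loop is cut and the matrix is block
    triangular. An eigenvector on the axis has an output y = t X D y, which the gain forces to 0,
    and then both states vanish. *)
Lemma small_gain m p n1 n2 (X : lti R m p n1) (D : lti R p m n2) (x d : R) :
  hurwitz (ssA X) -> hurwitz (ssA D) -> 0 <= x -> 0 <= d -> x * d < 1 ->
  (forall w, opbound x (freqresp X w)) -> (forall w, opbound d (freqresp D w)) ->
  hurwitz (closed_loopA X D).
Proof.
move=> hX hD x0 d0 xd bX bD.
have -> : closed_loopA X D = block_mx (ssA X) 0 (ssB D *m ssC X) (ssA D) +
    block_mx 0 (ssB X *m ssC D) 0 0.
  by rewrite add_block_mx !addr0 add0r.
apply: hurwitz_homotopy; first exact: hurwitz_block_lower.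
move=> t w /andP[t0 t1]; apply/negP => /eigenvalue_colP[v].
rewrite -[v]vsubmxK; move: (usubmx v) (dsubmx v) => v1 v2.
set s := 0 +i* w.
have -> : cmx (block_mx (ssA X) 0 (ssB D *m ssC X) (ssA D) + t *: block_mx 0 (ssB X *m ssC D) 0 0) =
    block_mx (cmx (ssA X)) (t%:C *: (cmx (ssB X) *m cmx (ssC D)))
      (cmx (ssB D) *m cmx (ssC X)) (cmx (ssA D)).
  rewrite scale_block_mx add_block_mx !scaler0 !addr0 add0r /cmx map_block_mx.
  congr block_mx; last exact: cmxM.
  by rewrite map_mxZ; congr (_ *: _); exact: cmxM.
rewrite mul_block_col scale_col_mx => /eq_col_mx[/esym e1 /esym e2].
apply/negP; rewrite negbK.
rewrite addrC in e2.
have U1 : s%:M - cmx (ssA X) \in unitmx by exact: hurwitz_unit.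
have U2 : s%:M - cmx (ssA D) \in unitmx by exact: hurwitz_unit.
have f1 := mulmx_resolvent U1 e1; have f2 := mulmx_resolvent U2 e2.
pose y := cmx (ssC X) *m v1.
have yE : y = t%:C *: (freqresp X w *m (freqresp D w *m y)).
  have g : cmx (ssC D) *m v2 = freqresp D w *m y by rewrite {1}f2 /freqresp /y !mulmxA.
  rewrite {1}/y {1}f1 -!scalemxAl -[_ *m cmx (ssC D) *m v2]mulmxA g -!scalemxAr.
  by rewrite /freqresp !mulmxA.
have y0 : y = 0.
  apply: fro_eq0; apply/eqP; rewrite eq_le fro_ge0 andbT.
  have : fro y <= t * (x * (d * fro y)).
    rewrite {1}yE fro_scale nsq_real sqrtr_sqr ger0_norm// ler_wpM2l//.
    by apply: (le_trans (bX _ _)); apply: ler_wpM2l => //; exact: bD.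
  have := fro_ge0 y; set q := fro y => q0.
  have : t * (x * (d * q)) <= x * d * q.
    by rewrite -[x * d * q]mulrA ler_piMl// !mulr_ge0.
  move=> h1 h2; have h3 := le_trans h2 h1; nra.
have v20 : v2 = 0 by rewrite f2 -mulmxA -/y y0 !mulmx0.
by rewrite f1 v20 -scalemxAl !mulmx0 scaler0 mulmx0 col_mx0.
Qed.

Lemma closed_loopA_change_coordinates m p nx nk (G : lti R m p nx) (K : lti R p m nk) T :
  T \in unitmx -> hurwitz (closed_loopA G K) ->
  hurwitz (closed_loopA G (change_coordinates T K)).
Proof.
move=> TU hK; pose V := block_mx (1%:M : 'M[R]_nx) 0 0 T.
have VV : V *m block_mx 1%:M 0 0 (invmx T) = 1%:M.
  by rewrite mulmx_block !mulmx0 !mul0mx !addr0 !add0r mul1mx mulmxV// -scalar_mx_block.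
have [VU _] := mulmx1_unit VV.
have -> : closed_loopA G (change_coordinates T K) = V *m closed_loopA G K *m invmx V.
  rewrite (invmx_unique VV) /closed_loopA /= !mulmx_block.
  by rewrite !mulmx0 !mul0mx !addr0 !add0r !mul1mx !mulmx1 !mulmxA.
exact: hurwitz_similar.
Qed.

Definition neg_output m p n (S : lti R m p n) : lti R m p n := Lti (ssA S) (ssB S) (- ssC S).

Lemma tf_neg_output m p n (S : lti R m p n) : tf (neg_output S) = - tf S.
Proof. by rewrite !tfE /= cstmxN !mulNmx. Qed.

(* The loop of G with [Ka + Kb] is contained in the loop of [G / (Kc + Kb)]
   with [Ka - Kc]: run the stable [Kc] alongside. *)
Lemma internally_stabilizes_replace m p nx na nb nc (G : lti R m p nx)
    (Ka : lti R p m na) (Kb : lti R p m nb) (Kc : lti R p m nc) :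
  hurwitz (ssA Kc) ->
  hurwitz (closed_loopA (loop_wy G (parallel Kc Kb)) (parallel Ka (neg_output Kc))) ->
  hurwitz (closed_loopA G (parallel Ka Kb)).
Proof.
move=> hc h l /eigenvalue_colP[v hv v0]; rewrite ltNge; apply/negP => l0.
move: hv v0; rewrite -[v]vsubmxK -[dsubmx v]vsubmxK.
move: (usubmx v) (usubmx (dsubmx v)) (dsubmx (dsubmx v)) => x a b.
have E : cmx (closed_loopA G (parallel Ka Kb)) =
  block_mx (cmx (ssA G)) (row_mx (cmx (ssB G *m ssC Ka)) (cmx (ssB G *m ssC Kb)))
   (col_mx (cmx (ssB Ka *m ssC G)) (cmx (ssB Kb *m ssC G)))
   (block_mx (cmx (ssA Ka)) 0 0 (cmx (ssA Kb))).
  by rewrite /closed_loopA /= mul_mx_row mul_col_mx /cmx !(map_block_mx, map_row_mx, map_col_mx) !map_mx0.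
rewrite -/(cmx _) E mul_block_col mul_row_col mul_col_mx mul_block_col add_col_mx !scale_col_mx.
move=> /eq_col_mx[e1 /eq_col_mx[e2 e3]] v0.
have hc' := hurwitz_unit hc l0.
(* The state of [Kc] driven by the plant output; it exists because [Kc] is stable and Re l >= 0. *)
pose c := resolvent (ssA Kc) l *m (cmx (ssB Kc) *m (cmx (ssC G) *m x)).
have ce : l *: c = cmx (ssA Kc) *m c + cmx (ssB Kc) *m (cmx (ssC G) *m x).
  have : (l%:M - cmx (ssA Kc)) *m c = cmx (ssB Kc) *m (cmx (ssC G) *m x) by rewrite mulKVmx.
  by rewrite mulmxBl mul_scalar_mx => /eqP; rewrite subr_eq addrC => /eqP.
suff /h : eigenvalue (cmx (closed_loopA (loop_wy G (parallel Kc Kb)) (parallel Ka (neg_output Kc)))) l.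
  by rewrite ltNge l0.
(* The two copies of [Kc] share the state c, and their outputs cancel at the plant input, leaving
   [Ka] and [Kb]. *)
apply/eigenvalue_colP; exists (col_mx (col_mx x (col_mx c b)) (col_mx a c)); last first.
  apply: contra v0; rewrite !col_mx_eq0 => /andP[/andP[-> /andP[_ ->]] /andP[-> _]] //.
have -> : cmx (closed_loopA (loop_wy G (parallel Kc Kb)) (parallel Ka (neg_output Kc))) =
  block_mx (block_mx (cmx (ssA G)) (row_mx (cmx (ssB G *m ssC Kc)) (cmx (ssB G *m ssC Kb)))
   (col_mx (cmx (ssB Kc *m ssC G)) (cmx (ssB Kb *m ssC G)))
   (block_mx (cmx (ssA Kc)) 0 0 (cmx (ssA Kb))))
   (col_mx (row_mx (cmx (ssB G *m ssC Ka)) (cmx (ssB G *m (- ssC Kc)))) 0)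
   (row_mx (col_mx (cmx (ssB Ka *m ssC G)) (cmx (ssB Kc *m ssC G))) 0)
   (block_mx (cmx (ssA Ka)) 0 0 (cmx (ssA Kc))).
  rewrite /closed_loopA /=.
  have -> : col_mx (ssB G) 0 *m row_mx (ssC Ka) (- ssC Kc) =
      col_mx (row_mx (ssB G *m ssC Ka) (ssB G *m (- ssC Kc))) 0 :> 'M[R]_(nx + (nc + nb), _).
    by rewrite mul_col_mx mul0mx mul_mx_row.
  have -> : col_mx (ssB Ka) (ssB Kc) *m row_mx (ssC G) 0 =
      row_mx (col_mx (ssB Ka *m ssC G) (ssB Kc *m ssC G)) 0 :> 'M[R]_(_, nx + (nc + nb)).
    by rewrite mul_mx_row mulmx0 mul_col_mx.
  rewrite /closed_loopA /= mul_mx_row mul_col_mx.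
  by rewrite /cmx !(map_block_mx, map_row_mx, map_col_mx) !map_mx0.
rewrite !(mul_block_col, mul_row_col, mul_col_mx, add_col_mx, mul0mx, scale_col_mx, addr0, add0r).
rewrite mul0mx addr0 in e2; rewrite mul0mx add0r in e3.
have ce' : cmx (ssB Kc *m ssC G) *m x + cmx (ssA Kc) *m c = l *: c.
  by rewrite ce addrC cmxM !mulmxA.
rewrite e2 e3 ce' -e1 mulmxN cmxN mulNmx.
congr (col_mx (col_mx _ _) _).
set u1 := cmx _ *m x; set u2 := cmx _ *m c; set u3 := cmx _ *m b; set u4 := cmx _ *m a.
by rewrite -addrA; congr (_ + _); rewrite [u2 + u3]addrC [u4 - u2]addrC addrA addrK addrC.
Qed.

End SmallGain.

(** * Matrix exponential *)

Section MatrixExponential.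
Variable R : realType.

Definition mxderive m n (F F' : R -> 'M[R]_(m, n)) : Prop :=
  forall i j (x : R), is_derive x 1 (fun t => F t i j) (F' x i j).

Lemma mxderive_ext m n (F F' G G' : R -> 'M[R]_(m, n)) :
  F =1 G -> F' =1 G' -> mxderive F F' -> mxderive G G'.
Proof. by move=> /funext-> /funext->. Qed.

Lemma mxderive_cst m n (M : 'M[R]_(m, n)) : mxderive (fun=> M) (fun=> 0).
Proof. by move=> i j x; rewrite mxE; exact: is_derive_cst. Qed.

Lemma is_derive_sumr (I : Type) (r : seq I) (f df : I -> R -> R) (x : R) :
  (forall i, is_derive x 1 (f i) (df i x)) ->
  is_derive x 1 (fun t => \sum_(i <- r) f i t) (\sum_(i <- r) df i x).
Proof.
move=> h; elim: r => [|i r IH].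
  rewrite big_nil (_ : (fun t => _) = cst 0); first exact: is_derive_cst.
  by apply/funext => t; rewrite big_nil.
rewrite big_cons (_ : (fun t => _) = f i + (fun t => \sum_(j <- r) f j t)); first exact: is_deriveD.
by apply/funext => t; rewrite big_cons.
Qed.

Lemma mxderiveM m n k (F F' : R -> 'M[R]_(m, n)) (G G' : R -> 'M[R]_(n, k)) :
  mxderive F F' -> mxderive G G' ->
  mxderive (fun t => F t *m G t) (fun t => F' t *m G t + F t *m G' t).
Proof.
move=> hF hG i j x.
rewrite (_ : (fun t => _) = (fun t => \sum_l F t i l * G t l j)); last first.
  by apply/funext => t; rewrite mxE.
rewrite !mxE -big_split /=.
apply: (@is_derive_sumr _ _ (fun l t => F t i l * G t l j)
  (fun l t => F' t i l * G t l j + F t i l * G' t l j)) => l.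
have hf := hF i l x; have hg := hG l j x.
rewrite (_ : (fun t => _) = (fun t => F t i l) * (fun t => G t l j))//.
by apply: is_derive_eq; rewrite /GRing.scale /=; ring.
Qed.

Lemma mxderive_tr m n (F F' : R -> 'M[R]_(m, n)) : mxderive F F' ->
  mxderive (fun t => (F t)^T) (fun t => (F' t)^T).
Proof.
move=> h i j x; rewrite mxE (_ : (fun t => _) = (fun t => F t j i)); first exact: h.
by apply/funext => t; rewrite mxE.
Qed.

Lemma mxderive_trace n (F F' : R -> 'M[R]_n) (x : R) : mxderive F F' ->
  is_derive x 1 (fun t => \tr (F t)) (\tr (F' x)).
Proof.
move=> h; apply: (@is_derive_sumr _ _ (fun i t => F t i i) (fun i t => F' t i i)) => i.
exact: h.
Qed.

Lemma cvgn_sum (I : Type) (r : seq I) (u : I -> nat -> R) (l : I -> R) :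
  (forall i, u i k @[k --> \oo] --> l i) ->
  \sum_(i <- r) u i k @[k --> \oo] --> \sum_(i <- r) l i.
Proof.
move=> h; elim: r => [|i r IH].
  rewrite big_nil (_ : (fun k => _) = cst 0); first exact: cvg_cst.
  by apply/funext => k; rewrite big_nil.
rewrite big_cons (_ : (fun k => _) = (fun k => u i k + \sum_(j <- r) u j k)).
  exact: cvgD.
by apply/funext => k; rewrite big_cons.
Qed.

Section Expmx.
Variables (n : nat) (A : 'M[R]_n).

Let b := \sum_i \sum_j `|A i j|.

Let b_ge0 : 0 <= b.
Proof. by apply: sumr_ge0 => i _; apply: sumr_ge0 => j _; exact: normr_ge0. Qed.

Lemma expr_entry_bound k i j : `|(A ^+ k) i j| <= b ^+ k.
Proof.
elim: k i j => [|k IH] i j.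
  by rewrite expr0 expr0 mxE; case: (i == j); rewrite ?normr1 ?normr0.
rewrite exprS exprS mxE; apply: (le_trans (ler_norm_sum _ _ _)).
apply: (@le_trans _ _ (\sum_l `|A i l| * b ^+ k)).
  by apply: ler_sum => l _; rewrite normrM ler_wpM2l.
rewrite -mulr_suml ler_wpM2r ?exprn_ge0//.
by rewrite /b [leRHS](bigD1 i)//= lerDl; apply: sumr_ge0 => l _; apply: sumr_ge0 => q _; exact: normr_ge0.
Qed.

Let c i j k : R := (A ^+ k) i j / k`!%:R.

Lemma scalemx_expr t k : (t *: A) ^+ k = t ^+ k *: A ^+ k.
Proof.
elim: k => [|k IH]; first by rewrite !expr0 scale1r.
by rewrite !exprS IH -[LHS]/(_ *m _) -scalemxAl -scalemxAr scalerA.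
Qed.

Lemma expmxE t i j : expmx (t *: A) i j = limn (pseries (c i j) t).
Proof.
rewrite mxE; congr (limn (series _)); apply/funext => k.
by rewrite scalemx_expr mxE /c -mulrA mulrC.
Qed.

(** Coefficients of the l-th derivative of the series. Termwise differentiation uses the cases l =
    0, 1 and 2. *)
Lemma diffs_coef l i j : iter l (@pseries_diffs R) (c i j) =
  (fun k => (A ^+ (k + l)) i j / k`!%:R).
Proof.
elim: l => [|l IH]; first by apply/funext => k; rewrite addn0.
apply/funext => k; rewrite /= IH /pseries_diffs addSnnS factS natrM.
have k0 : (k.+1%:R : R) != 0 by rewrite pnatr_eq0.
by rewrite invfM mulrCA mulVKf.
Qed.

Lemma cvg_expmx_series l i j t : cvgn (pseries (iter l (@pseries_diffs R) (c i j)) t).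
Proof.
rewrite diffs_coef; apply: normed_cvg.
apply: (@series_le_cvg _ _ (fun k => b ^+ l * exp_coeff (b * `|t|) k)).
- by move=> k; exact: normr_ge0.
- by move=> k; rewrite mulr_ge0 ?exprn_ge0// exp_coeff_ge0// mulr_ge0.
- move=> k; rewrite /exp_coeff /= !normrM normrX normfV normr_nat exprMn.
  rewrite [leLHS](_ : _ = `|(A ^+ (k + l)) i j| * (`|t| ^+ k / k`!%:R)); last by ring.
  rewrite [leRHS](_ : _ = b ^+ (k + l) * (`|t| ^+ k / k`!%:R)); last by rewrite exprD; ring.
  by rewrite ler_wpM2r ?expr_entry_bound// divr_ge0 ?exprn_ge0.
have h := @is_cvg_series_exp_coeff _ (b * `|t|).
rewrite (_ : series _ = (fun k => b ^+ l * series (exp_coeff (b * `|t|)) k)).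
  by apply: is_cvgMr.
by apply/funext => k; rewrite /series /= mulr_sumr.
Qed.

Lemma expmx0 : expmx (0 *: A) = 1%:M.
Proof.
apply/matrixP => i j; rewrite mxE; apply: cvg_lim => //.
apply: cvg_near_cst; near=> k.
have k0 : (0 < k)%N by near: k; exists 1%N.
rewrite /series /= -(prednK k0) big_nat_recl// big1 ?addr0.
  by rewrite expr0 fact0 divr1.
by move=> l _; rewrite scalemx_expr expr0n /= scale0r mxE mul0r.
Unshelve. all: by end_near. Qed.

Let dlim t i j : limn (pseries (pseries_diffs (c i j)) t) =
  (A *m expmx (t *: A)) i j /\ limn (pseries (pseries_diffs (c i j)) t) =
  (expmx (t *: A) *m A) i j.
Proof.
have E : pseries_diffs (c i j) = (fun k => (A ^+ (k.+1)) i j / k`!%:R).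
  by have := diffs_coef 1 i j => /= ->; apply/funext => k; rewrite addn1.
split; apply: cvg_lim => //; rewrite mxE.
- rewrite (_ : pseries _ t = (fun k => \sum_l A i l * pseries (c l j) t k)).
    apply: cvgn_sum => l; apply: cvgMr; rewrite expmxE; exact: (@cvg_expmx_series 0 l j t).
  apply/funext => k; rewrite E /pseries /series /=.
  under [RHS]eq_bigr do rewrite mulr_sumr.
  rewrite exchange_big /=; apply: eq_bigr => q _.
  rewrite exprS mxE !mulr_suml; apply: eq_bigr => l _; rewrite /c; ring.
- rewrite (_ : pseries _ t = (fun k => \sum_l pseries (c i l) t k * A l j)).
    apply: cvgn_sum => l; apply: cvgMl; rewrite expmxE; exact: (@cvg_expmx_series 0 i l t).
  apply/funext => k; rewrite E /pseries /series /=.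
  under [RHS]eq_bigr do rewrite mulr_suml.
  rewrite exchange_big /=; apply: eq_bigr => q _.
  rewrite exprSr mxE !mulr_suml; apply: eq_bigr => l _; rewrite /c; ring.
Qed.

Lemma expmx_comm t : A *m expmx (t *: A) = expmx (t *: A) *m A.
Proof. by apply/matrixP => i j; have [<- <-] := dlim t i j. Qed.

Lemma mxderive_expmx : mxderive (fun t => expmx (t *: A)) (fun t => A *m expmx (t *: A)).
Proof.
move=> i j x; have [<- _] := dlim x i j.
rewrite (_ : (fun t => _) = (fun t => limn (pseries (c i j) t))); last first.
  by apply/funext => t; rewrite expmxE.
apply: (@pseries_snd_diffs _ _ (`|x| + 1)).
- exact: (@cvg_expmx_series 0 i j _).
- exact: (@cvg_expmx_series 1 i j _).
- exact: (@cvg_expmx_series 2 i j _).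
- by rewrite [ltRHS]ger0_norm ?addr_ge0// ltrDl.
Qed.

(** The Lyapunov operator appears inside the congruence, so a solution of the Lyapunov equation
    gives a primitive of the covariance integrand. *)
Lemma mxderive_expmx_congr (P : 'M[R]_n) :
  mxderive (fun t => expmx (t *: A) *m P *m (expmx (t *: A))^T)
    (fun t => expmx (t *: A) *m (A *m P + P *m A^T) *m (expmx (t *: A))^T).
Proof.
have d1 := mxderive_expmx.
apply: mxderive_ext (mxderiveM (mxderiveM d1 (mxderive_cst P)) (mxderive_tr d1)) => // t.
by rewrite mulmx0 addr0 expmx_comm trmx_mul mulmxDr [RHS]mulmxDl !mulmxA.
Qed.

Lemma mxderive_expmx_congr_tr (P : 'M[R]_n) :
  mxderive (fun t => (expmx (t *: A))^T *m P *m expmx (t *: A))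
    (fun t => (expmx (t *: A))^T *m (A^T *m P + P *m A) *m expmx (t *: A)).
Proof.
have d1 := mxderive_expmx.
apply: mxderive_ext (mxderiveM (mxderiveM (mxderive_tr d1) (mxderive_cst P)) d1) => // t.
by rewrite mulmx0 addr0 trmx_mul mulmxDr mulmxDl !mulmxA.
Qed.

End Expmx.

End MatrixExponential.

(** * Time-domain Gramians and decay of the transient *)

Section GramianTime.
Variable R : realType.
Local Notation mu := (@lebesgue_measure R).

Lemma mxderive_continuous m n (F F' : R -> 'M[R]_(m, n)) i j : mxderive F F' ->
  continuous (fun t : R => F t i j).
Proof.
move=> h x; apply: differentiable_continuous; apply/derivable1_diffP.
by case: (h i j x).
Qed.

Lemma Rintegral_FTC (f F : R -> R) (a b : R) : a <= b ->
  continuous f -> (forall x : R, is_derive x 1 F (f x)) ->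
  \int[mu]_(x in `[a, b]) f x = F b - F a.
Proof.
rewrite le_eqVlt => /orP[/eqP->|ab] cf dF.
  by rewrite set_itv1 Rintegral_set1 subrr.
rewrite /Rintegral (@continuous_FTC2 _ f F)//.
- exact: continuous_subspaceT.
- have cF : continuous F.
    by move=> x; apply: differentiable_continuous; apply/derivable1_diffP; case: (dF x).
  split.
  + by move=> x _; case: (dF x).
  + by apply: cvg_at_right_filter; exact: cF.
  + by apply: cvg_at_left_filter; exact: cF.
- by move=> x _; rewrite derive1E; case: (dF x).
Qed.

Lemma continuous_integrable_itv (f : R -> R) (a b : R) : continuous f ->
  mu.-integrable `[a, b] (EFin \o f).
Proof.
move=> cf; apply: continuous_compact_integrable; first exact: segment_compact.
exact: continuous_subspaceT.
Qed.

Section Gramian.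
Variables (n : nat) (A : 'M[R]_n).
Hypothesis hA : hurwitz A.
Local Notation E t := (expmx (t *: A)).

Lemma continuous_expmx_congr (M : 'M[R]_n) i j : continuous (fun t : R => (E t *m M *m (E t)^T) i j).
Proof. exact: mxderive_continuous (mxderive_expmx_congr A M). Qed.

Lemma gramian_integral k (B : 'M[R]_(n, k)) (P : 'M[R]_n) t i j : 0 <= t ->
  A *m P + P *m A^T + B *m B^T = 0 ->
  \int[mu]_(s in `[0, t]) (E (t - s) *m (B *m B^T) *m (E (t - s))^T) i j =
  (P - E t *m P *m (E t)^T) i j.
Proof.
move=> t0 hP.
pose F s := (E (t - s) *m P *m (E (t - s))^T) i j.
have dsub (s : R) : is_derive s 1 (fun s : R => t - s) (-1).
  rewrite (_ : (fun s => _) = cst t - id); last exact/funext.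
  by apply: is_derive_eq; rewrite sub0r.
have cf : continuous (fun s : R => (E (t - s) *m (B *m B^T) *m (E (t - s))^T) i j).
  move=> s; apply: (@continuous_comp _ _ _ (fun s : R => t - s)
    (fun u : R => (E u *m (B *m B^T) *m (E u)^T) i j)).
    by apply: differentiable_continuous; apply/derivable1_diffP; case: (dsub s).
  exact: continuous_expmx_congr.
have dF (s : R) : is_derive s 1 F ((E (t - s) *m (B *m B^T) *m (E (t - s))^T) i j).
  have h := @is_derive1_comp _ (fun u : R => (E u *m P *m (E u)^T) i j) (fun s : R => t - s)
    s _ _ (mxderive_expmx_congr A P i j (t - s)) (dsub s).
  apply: (is_derive_eq h).
  have -> : A *m P + P *m A^T = - (B *m B^T) by apply/eqP; rewrite -addr_eq0 hP.
  by rewrite mulmxN mulNmx mxE mulrN1 opprK.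
rewrite (Rintegral_FTC t0 cf dF).
have e (X Y : 'M[R]_n) : X i j - Y i j = (X - Y) i j by rewrite !mxE.
have F1 : F t = P i j by rewrite /F subrr expmx0 mul1mx trmx1 mulmx1.
have F0 : F 0 = (E t *m P *m (E t)^T) i j by rewrite /F subr0.
by rewrite F1 F0 e.
Qed.

(** Positivity is read in the frequency domain: up to 2 pi the trace is an integral of squares. *)
Lemma lyapunov_psd (P : 'M[R]_n) q (Co : 'M[R]_(q, n)) : P^T = P ->
  A *m P + P *m A^T + 1%:M = 0 -> 0 <= \tr (Co *m P *m Co^T).
Proof.
move=> PT hP; pose S := Lti A (1%:M : 'M[R]_n) Co.
have hP' : ssA S *m P + P *m (ssA S)^T + ssB S *m (ssB S)^T = 0 by rewrite /= trmx1 mulmx1.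
have h : (0 <= (2 * pi * \tr (Co *m P *m Co^T))%:E)%E.
  rewrite -(integral_freqresp (S := S) hA PT hP').
  by apply: integral_ge0 => w _; rewrite lee_fin fro2_ge0.
by move: h; rewrite lee_fin pmulr_rge0// mulr_gt0 ?pi_gt0.
Qed.

End Gramian.

Lemma hurwitz_tr n (A : 'M[R]_n) : hurwitz A -> hurwitz A^T.
Proof.
move=> hA l; have -> : map_mx (real_complex R) A^T = (cmx A)^T by rewrite /cmx map_trmx.
by rewrite eigenvalue_tr => /hA.
Qed.

Definition sqnorm n (M : 'M[R]_n) : R := \tr (M^T *m M).

Lemma sqnormE n (M : 'M[R]_n) : sqnorm M = \sum_i \sum_j M i j ^+ 2.
Proof.
rewrite /sqnorm /mxtrace exchange_big; apply: eq_bigr => i _; rewrite mxE.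
by apply: eq_bigr => j _; rewrite mxE expr2.
Qed.

Lemma entry_sqnorm n (M : 'M[R]_n) i j : M i j ^+ 2 <= sqnorm M.
Proof.
rewrite sqnormE (bigD1 i)//= (bigD1 j)//= -addrA lerDl addr_ge0//.
  by apply: sumr_ge0 => l _; exact: sqr_ge0.
by apply: sumr_ge0 => l _; apply: sumr_ge0 => q _; exact: sqr_ge0.
Qed.

Lemma continuous_sqnorm_expmx n (A : 'M[R]_n) :
  continuous (fun t : R => sqnorm (expmx (t *: A))).
Proof.
have -> : (fun t : R => sqnorm (expmx (t *: A))) =
    (fun t : R => \sum_i ((expmx (t *: A))^T *m 1%:M *m expmx (t *: A)) i i).
  by apply/funext => t; rewrite mulmx1.
apply: continuous_sum_seq => i.
exact: mxderive_continuous (mxderive_expmx_congr_tr A 1%:M).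
Qed.

(** tr (E^T P E) is nonnegative, starts at tr P and decreases at rate [sqnorm E]. This bound on the
    integral plays the part of an exponential decay estimate. *)
Lemma integral_sqnorm_expmx n (A : 'M[R]_n) : hurwitz A ->
  exists c, forall T, 0 <= T -> \int[mu]_(t in `[0, T]) sqnorm (expmx (t *: A)) <= c.
Proof.
move=> hA; have hAT := hurwitz_tr hA.
have [P PT hP] := lyapunov_solution hAT (trmx1 _ n).
rewrite trmxK in hP.
exists (\tr P) => T T0.
pose V t := \tr ((expmx (t *: A))^T *m P *m expmx (t *: A)).
have dV (t : R) : is_derive t 1 (- V) (sqnorm (expmx (t *: A))).
  have d : is_derive t 1 V _ := mxderive_trace t (mxderive_expmx_congr_tr A P).
  apply: is_derive_eq.
  have -> : A^T *m P + P *m A = - 1%:M by apply/eqP; rewrite -addr_eq0 hP.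
  by rewrite mulmxN mulmx1 mulNmx linearN opprK.
have cs := @continuous_sqnorm_expmx n A.
rewrite (Rintegral_FTC T0 cs dV) fctE opprK /V expmx0 trmx1 mul1mx mulmx1.
have h : 0 <= \tr ((expmx (T *: A))^T *m P *m ((expmx (T *: A))^T)^T).
  by apply: (lyapunov_psd hAT) => //; rewrite trmxK.
by rewrite trmxK in h; rewrite addrC gerDl oppr_le0.
Qed.

Lemma trace_expmx_bound n (Q M : 'M[R]_n) : exists2 c, 0 <= c &
  forall E : 'M[R]_n, `|\tr (Q *m (E *m M *m E^T))| <= c * sqnorm E.
Proof.
pose q := \sum_a \sum_b `|Q a b|; pose m := \sum_c \sum_d `|M c d|.
exists (\sum_(a < n) \sum_(b < n) `|Q a b| * (\sum_(d < n) \sum_(c < n) `|M c d|)).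
  do 2![apply: sumr_ge0 => ? _]; rewrite mulr_ge0//.
  by do 2![apply: sumr_ge0 => ? _].
move=> E; rewrite /mxtrace; apply: (le_trans (ler_norm_sum _ _ _)).
rewrite mulr_suml; apply: ler_sum => a _; rewrite mxE.
apply: (le_trans (ler_norm_sum _ _ _)); rewrite mulr_suml; apply: ler_sum => b _.
rewrite normrM -mulrA ler_wpM2l// mxE.
apply: (le_trans (ler_norm_sum _ _ _)); rewrite mulr_suml; apply: ler_sum => d _.
rewrite mxE mulr_suml [leRHS]mulr_suml.
apply: (le_trans (ler_norm_sum _ _ _)); apply: ler_sum => c _.
rewrite [E^T d a]mxE !normrM [`|E b c| * _]mulrC -mulrA ler_wpM2l//.
have h1 := entry_sqnorm E b c; have h2 := entry_sqnorm E a d.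
have := sqr_ge0 (`|E b c| - `|E a d|); rewrite sqrrB !real_normK ?num_real// => h3.
move: h1 h2 h3; set x := `|_|; set y := `|_|; rewrite -mulr_natl; lra.
Qed.

Lemma continuous_tr_expmx n (A Q M : 'M[R]_n) :
  continuous (fun t : R => \tr (Q *m (expmx (t *: A) *m M *m (expmx (t *: A))^T))).
Proof.
apply: continuous_sum_seq => i.
have d := mxderiveM (mxderive_cst Q) (mxderive_expmx_congr A M).
exact: mxderive_continuous d.
Qed.

Lemma integral_tr_expmx_bounded n (A Q M : 'M[R]_n) : hurwitz A ->
  exists c, forall T, 0 <= T ->
  `|\int[mu]_(t in `[0, T]) \tr (Q *m (expmx (t *: A) *m M *m (expmx (t *: A))^T))| <= c.
Proof.
move=> hA; have [c c0 hc] := trace_expmx_bound Q M.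
have [d hd] := integral_sqnorm_expmx hA.
exists (c * d) => T T0.
have cs := @continuous_sqnorm_expmx n A.
have ct := @continuous_tr_expmx n A Q M.
have mI : measurable (`[0, T]%classic : set (measurableTypeR R)) by exact: measurable_itv.
apply: (le_trans (le_normr_Rintegral mI (continuous_integrable_itv 0 T ct))).
apply: (@le_trans _ _ (\int[mu]_(t in `[0, T]) (c * sqnorm (expmx (t *: A))))).
  apply: le_Rintegral => //.
  - apply: (@continuous_integrable_itv (fun t : R => `|\tr (Q *m (expmx (t *: A) *m M *m (expmx (t *: A))^T))|)).
    by move=> t; apply: cvg_norm; exact: ct.
  - apply: (@continuous_integrable_itv (fun t : R => c * sqnorm (expmx (t *: A)))).
    by move=> t; apply: cvgMr; exact: cs.
rewrite RintegralZl//; last exact: continuous_integrable_itv.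
by rewrite ler_wpM2l// hd.
Qed.

End GramianTime.

(** * White noise and the LQG cost *)

Section NoiseMoments.
Variables (R : realType) (d : measure_display) (Omega : measurableType d).
Variable P : probability Omega R.
Local Notation mu := (@lebesgue_measure R).

(** Tonelli's theorem for a nonnegative jointly measurable process. *)
Lemma expectation_time_average (X : R * Omega -> R) (q : R -> R) (T : R) : 0 < T ->
  measurable_fun [set: R * Omega] X -> (forall p, 0 <= X p) -> continuous q ->
  (forall t, 0 <= t <= T -> (\int[P]_o (X (t, o))%:E)%E = (q t)%:E) ->
  ('E_P[fun o => (T^-1 * \int[mu]_(t in `[0, T]) X (t, o))%R])%E =
  (T^-1 * \int[mu]_(t in `[0, T]) q t)%:E.
Proof.
move=> T0 mX X0 cq Xq.
have mI : measurable (`[0, T]%classic : set (measurableTypeR R)) by exact: measurable_itv.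
pose F (p : measurableTypeR R * Omega) : \bar R := if (0 <= p.1 <= T) then (X p)%:E else 0%E.
have mF : measurable_fun [set: R * Omega] F.
  apply: measurable_fun_ifT.
  - rewrite (_ : (fun _ => _) = (fun t : R => 0 <= t <= T) \o fst)//.
    apply: measurableT_comp => //.
    apply: measurable_and; exact: measurable_fun_ler.
  - exact/measurable_EFinP.
  - exact: measurable_cst.
have F0 p : (0 <= F p)%E by rewrite /F; case: ifP => // _; rewrite lee_fin.
pose h o := (\int[mu]_t F (t, o))%E.
have hE o : h o = (\int[mu]_(t in `[0%R, T]) (X (t, o))%:E)%E.
  rewrite [RHS]integral_mkcond; apply: eq_integral => t _.
  by rewrite patchE mem_setE in_itv /F /=.
have Fub := @fubini_tonelli _ _ _ _ R (@lebesgue_measure R) P F mF F0.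
have iq : (\int[mu]_(t in `[0%R, T]) (q t)%:E)%E = (\int[mu]_(t in `[0, T]) q t)%:E.
  rewrite /Rintegral fineK//; apply: integrable_fin_num => //.
  exact: continuous_integrable_itv.
have ih : (\int[P]_o h o)%E = (\int[mu]_(t in `[0, T]) q t)%:E.
  rewrite /h -Fub -iq [RHS]integral_mkcond; apply: eq_integral => t _.
  rewrite patchE mem_setE in_itv /F /=; case: ifPn => tT; first by rewrite Xq.
  by rewrite integral0_eq.
have mh : measurable_fun [set: Omega] h.
  exact: (@measurable_fun_fubini_tonelli_G _ _ _ _ R (@lebesgue_measure R) F mF F0).
have h0 o : (0 <= h o)%E by exact: integral_ge0.
have inth : P.-integrable [set: Omega] h.
  apply/integrableP; split=> //.
  under eq_integral do rewrite gee0_abs//.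
  by rewrite ih ltry.
rewrite unlock.
transitivity (\int[P]_o ((T^-1)%:E * h o))%E; last first.
  by rewrite integralZl// ih EFinM.
apply: ae_eq_integral => //.
- apply/measurable_EFinP; apply: measurable_funM => //.
  under eq_fun do rewrite /Rintegral -hE.
  by apply: measurableT_comp => //.
- exact: measurable_funeM.
(* The real-valued integral turns an infinite value into 0, so the integrands agree only where h is
   finite, that is almost surely. *)
- have := integrable_ae measurableT inth; apply: filterS => o fo _.
  by rewrite EFinM /Rintegral -hE fineK// fo.
Qed.

Section WhiteNoise.
Variables (k : nat) (W : (R -> 'cV[R]_k) -> Omega -> R).
Hypothesis hW : white_noise P W.

Let integrable_cst (a : R) : P.-integrable [set: Omega] (EFin \o cst a).
Proof. exact: finite_measure_integrable_cst. Qed.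

Lemma noise_measurable f : sqr_integrable f -> measurable_fun [set: Omega] (W f).
Proof. by case: hW => h _ _ _ /h[]. Qed.

Lemma noise_sqr_integrable f : sqr_integrable f ->
  P.-integrable [set: Omega] (fun o => (W f o ^+ 2)%:E).
Proof.
move=> hf; have mf := noise_measurable hf; case: hW => _ _ /(_ f f hf hf) h _.
apply/integrableP; split.
  by apply/measurable_EFinP; apply: measurable_funX.
under eq_integral do rewrite gee0_abs ?lee_fin ?sqr_ge0// expr2.
by move: h; rewrite unlock => ->; rewrite ltry.
Qed.

Lemma noise_mul_integrable f g : sqr_integrable f -> sqr_integrable g ->
  P.-integrable [set: Omega] (fun o => (W f o * W g o)%:E).
Proof.
move=> hf hg; have mf := noise_measurable hf; have mg := noise_measurable hg.
apply: (le_integrable measurableT _ _ (integrableD measurableT (noise_sqr_integrable hf) (noise_sqr_integrable hg))).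
  by apply/measurable_EFinP; exact: measurable_funM.
move=> o _; rewrite /= lee_fin [leRHS]ger0_norm ?addr_ge0 ?sqr_ge0// normrM.
have := sqr_ge0 (`|W f o| - `|W g o|); rewrite sqrrB !real_normK ?num_real// -mulr_natl.
have := sqr_ge0 (W f o); have := sqr_ge0 (W g o).
have := normr_ge0 (W f o); have := normr_ge0 (W g o).
set x := `|_|; set y := `|_|; set u := W f o ^+ 2; set v := W g o ^+ 2 => *; nra.
Qed.

Lemma noise_integrable f : sqr_integrable f ->
  P.-integrable [set: Omega] (fun o => (W f o)%:E).
Proof.
move=> hf; have mf := noise_measurable hf.
apply: (le_integrable measurableT _ _ (integrableD measurableT (integrable_cst 1) (noise_sqr_integrable hf))).
  exact/measurable_EFinP.
move=> o _; rewrite /= lee_fin [leRHS]ger0_norm ?addr_ge0 ?sqr_ge0//.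
have := sqr_ge0 (`|W f o| - 1); rewrite sqrrB real_normK ?num_real// mulr1 expr1n -mulr_natl.
have := normr_ge0 (W f o).
set x := `|_|; set u := W f o ^+ 2; rewrite /cst; lra.
Qed.

Lemma noise_second_moment f g (a b : R) : sqr_integrable f -> sqr_integrable g ->
  P.-integrable [set: Omega] (fun o => ((a + W f o) * (b + W g o))%:E) /\
  (\int[P]_o ((a + W f o) * (b + W g o))%:E)%E = (a * b + L2_inner f g)%:E.
Proof.
move=> hf hg.
have E : (fun o => ((a + W f o) * (b + W g o))%:E) =
  (((EFin \o cst (a * b)%R) \+ (fun o => a%:E * (W g o)%:E)%E) \+
   ((fun o => b%:E * (W f o)%:E)%E \+ (fun o => (W f o * W g o)%:E)))%E.
  by apply/funext => o /=; rewrite -!EFinM -!EFinD; congr EFin; ring.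
have i1 := integrable_cst (a * b).
have i2 : P.-integrable [set: Omega] (fun o => a%:E * (W g o)%:E)%E by apply: integrableZl => //; exact: noise_integrable.
have i3 : P.-integrable [set: Omega] (fun o => b%:E * (W f o)%:E)%E by apply: integrableZl => //; exact: noise_integrable.
have i4 := noise_mul_integrable hf hg.
have i12 := integrableD measurableT i1 i2; have i34 := integrableD measurableT i3 i4.
have z f' : sqr_integrable f' -> (\int[P]_o (W f' o)%:E)%E = 0%E.
  by case: hW => h _ _ _ /h[_]; rewrite unlock.
split; first by rewrite E; exact: integrableD.
rewrite E integralD// integralD// integralD//.
rewrite (integralZl measurableT (noise_integrable hg)) (integralZl measurableT (noise_integrable hf)) !z// !mule0 adde0 add0e.
case: hW => _ _ /(_ f g hf hg); rewrite unlock => -> _.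
have -> : (\int[P]_o (EFin \o cst (a * b)%R) o = (a * b)%:E)%E.
  by have := expectation_cst P (a * b); rewrite unlock.
by rewrite -EFinD.
Qed.

End WhiteNoise.
End NoiseMoments.

(** * Second moments of the response and the limit of the mean cost *)

Section NoiseResponse.
Variable R : realType.
Local Notation mu := (@lebesgue_measure R).

Section Kernel.
Variables (n k : nat) (A : 'M[R]_n) (B : 'M[R]_(n, k)).
Local Notation E t := (expmx (t *: A)).

Definition noise_kernel (t : R) (i : 'I_n) (s : R) : 'cV[R]_k :=
  if (0 <= s <= t)%R then (row i (E (t - s) *m B))^T else 0.

Lemma continuous_kernel_entry (t : R) (i : 'I_n) l :
  continuous (fun s : R => (E (t - s) *m B) i l).
Proof.
move=> s; apply: (@continuous_comp _ _ _ (fun s : R => t - s) (fun u : R => (E u *m B) i l)).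
  by apply: continuousB; [exact: cst_continuous | exact: id].
have c := @mxderive_continuous _ _ _ _ _ i l (mxderiveM (mxderive_expmx A) (mxderive_cst B)).
exact: c.
Qed.

Lemma kernel_entry t i l :
  (fun s => noise_kernel t i s l 0) = (fun s => (E (t - s) *m B) i l) \_ `[0, t].
Proof.
apply/funext => s; rewrite /noise_kernel patchE mem_setE in_itv /=.
by case: ifP => _; rewrite !mxE.
Qed.

Lemma kernel_sqr_integrable t i : sqr_integrable (noise_kernel t i).
Proof.
move=> l; have mI : measurable (`[0, t]%classic : set (measurableTypeR R)) by exact: measurable_itv.
have cf := @continuous_kernel_entry t i l.
split.
  rewrite kernel_entry; apply/(measurable_restrictT _ mI).
  by apply: measurable_funTS; exact: continuous_measurable_fun.
have -> : (fun s => (noise_kernel t i s l 0 ^+ 2)%:E) =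
    (EFin \o (fun s => (E (t - s) *m B) i l ^+ 2)) \_ `[0, t].
  apply/funext => s; have /(congr1 (fun f => f s)) /= -> := kernel_entry t i l.
  by rewrite !patchE; case: ifP => // _; rewrite expr0n.
apply/(integrable_mkcond _ mI); apply: continuous_integrable_itv.
rewrite (_ : (fun s => _) = (fun s => (E (t - s) *m B) i l) \* (fun s => (E (t - s) *m B) i l)).
  by move=> s; apply: continuousM; exact: cf.
by apply/funext => s; rewrite expr2.
Qed.

Lemma kernel_inner (Pm : 'M[R]_n) t i j : 0 <= t -> A *m Pm + Pm *m A^T + B *m B^T = 0 ->
  L2_inner (noise_kernel t i) (noise_kernel t j) = (Pm - E t *m Pm *m (E t)^T) i j.
Proof.
move=> t0 hP; rewrite -(gramian_integral i j t0 hP) Rintegral_mkcond /L2_inner.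
congr Rintegral; apply/funext => s; rewrite patchE mem_setE in_itv /noise_kernel /=.
case: ifP => _; last by rewrite mulmx0 mxE.
have -> : E (t - s) *m (B *m B^T) *m (E (t - s))^T =
  (E (t - s) *m B) *m (E (t - s) *m B)^T by rewrite trmx_mul !mulmxA.
rewrite trmxK !mxE; apply: eq_bigr => l _.
by rewrite !mxE.
Qed.

End Kernel.

Section Response.
Variables (d : measure_display) (Omega : measurableType d) (P : probability Omega R).
Variables (n k : nat) (A : 'M[R]_n) (B : 'M[R]_(n, k)).
Variables (W : (R -> 'cV[R]_k) -> Omega -> R) (z : R -> Omega -> 'cV[R]_n).
Hypotheses (hW : white_noise P W) (hz : noise_response P W A B z).
Local Notation E t := (expmx (t *: A)).

(** The noise contributes Pm - E Pm E^T and the initial state E z0 z0^T E^T, hence the witness M =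
    z0 z0^T - Pm. *)
Lemma response_second_moment (Pm : 'M[R]_n) : A *m Pm + Pm *m A^T + B *m B^T = 0 ->
  exists M : 'M[R]_n, forall t i j, 0 <= t ->
  P.-integrable [set: Omega] (fun o => (z t o i 0 * z t o j 0)%:E) /\
  (\int[P]_o (z t o i 0 * z t o j 0)%:E)%E = ((Pm + E t *m M *m (E t)^T) i j)%:E.
Proof.
move=> hP; case: hz => mz [z0 rz]; exists (z0 *m z0^T - Pm) => t i j t0.
have mzt l : measurable_fun [set: Omega] (fun o => z t o l 0).
  exact: (measurable_fun_pair2 t (mz l)).
pose a l := (E t *m z0) l 0.
have [int1 int2] := noise_second_moment hW (a i) (a j)
  (kernel_sqr_integrable A B t i) (kernel_sqr_integrable A B t j).
have mzz : measurable_fun [set: Omega] (fun o => (z t o i 0 * z t o j 0)%:E).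
  by apply/measurable_EFinP; apply: measurable_funM.
have ae : ae_eq P [set: Omega] (fun o => ((a i + W (noise_kernel A B t i) o) *
    (a j + W (noise_kernel A B t j) o))%:E) (fun o => (z t o i 0 * z t o j 0)%:E).
  have := rz t i t0; have := rz t j t0.
  by apply: filterS2 => o /= -> ->.
have mi : measurable_fun [set: Omega] (fun o => ((a i + W (noise_kernel A B t i) o) *
    (a j + W (noise_kernel A B t j) o))%:E) by case/integrableP: int1.
split.
  apply/integrableP; split=> //; case/integrableP: int1 => _; apply: le_lt_trans.
  rewrite le_eqVlt; apply/orP; left; apply/eqP; apply: ae_eq_integral => //.
  - exact: measurableT_comp.
  - exact: measurableT_comp.
  - by move: ae; apply: filterS => o h oT; rewrite (h oT).
rewrite -(ae_eq_integral _ _ measurableT mi mzz ae) int2; congr EFin.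
rewrite (kernel_inner i j t0 hP).
have -> : E t *m (z0 *m z0^T - Pm) *m (E t)^T =
    (E t *m z0) *m (E t *m z0)^T - E t *m Pm *m (E t)^T.
  by rewrite mulmxBr mulmxBl trmx_mul !mulmxA.
rewrite /a; move: (E t *m Pm *m _) (E t *m z0) => Z u.
by rewrite !mxE big_ord1 !mxE; ring.
Qed.

Lemma response_quadratic (Pm Q : 'M[R]_n) : A *m Pm + Pm *m A^T + B *m B^T = 0 ->
  exists M : 'M[R]_n, forall t, 0 <= t ->
  (\int[P]_o (\tr (Q *m (z t o *m (z t o)^T)))%:E)%E =
  (\tr (Q *m (Pm + E t *m M *m (E t)^T)))%:E.
Proof.
move=> hP; have [M hM] := response_second_moment hP; exists M => t t0.
have trE (N : 'M[R]_n) : \tr (Q *m N) = \sum_(p : 'I_n * 'I_n) Q p.1 p.2 * N p.2 p.1.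
  rewrite -(pair_bigA _ (fun i j => Q i j * N j i)) /=; apply: eq_bigr => i _.
  by rewrite mxE.
rewrite trE -sumEFin.
under eq_integral => o _ do rewrite trE -sumEFin.
rewrite (@integral_sum _ _ _ P _ measurableT _ (fun (p : 'I_n * 'I_n) o => (Q p.1 p.2 * (z t o *m (z t o)^T) p.2 p.1)%:E)).
  apply: eq_bigr => p _; have [h1 h2] := hM t p.2 p.1 t0.
  rewrite EFinM -h2 -integralZl//; apply: eq_integral => o _.
  by rewrite -EFinM mxE big_ord1 !mxE.
move=> p; have [h1 _] := hM t p.2 p.1 t0.
have -> : (fun o => (Q p.1 p.2 * (z t o *m (z t o)^T) p.2 p.1)%:E) =
   (fun o => (Q p.1 p.2)%:E * (z t o p.2 0 * z t o p.1 0)%:E)%E.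
  by apply/funext => o; rewrite -EFinM mxE big_ord1 !mxE.
exact: integrableZl.
Qed.

End Response.

Definition loop_output m p nx nk (G : lti R m p nx) (K : lti R p m nk) :
  'M[R]_(p + m, nx + nk) := block_mx (ssC G) 0 0 (ssC K).

Lemma running_costE m p nx nk (G : lti R m p nx) (K : lti R p m nk) (v : 'cV[R]_(nx + nk)) :
  running_cost G K v =
  \tr ((loop_output G K)^T *m loop_output G K *m (v *m v^T)).
Proof.
set H := loop_output G K.
have -> : H^T *m H *m (v *m v^T) = (H^T *m (H *m v)) *m v^T by rewrite !mulmxA.
rewrite mxtrace_mulC.
have -> : v^T *m (H^T *m (H *m v)) = (H *m v)^T *m (H *m v) by rewrite trmx_mul !mulmxA.
have -> : H *m v = col_mx (ssC G *m usubmx v) (ssC K *m dsubmx v).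
  by rewrite -{1}[v]vsubmxK mul_block_col !mul0mx addr0 add0r.
rewrite /running_cost tr_col_mx mul_row_col -mulmxA -trmx_mul.
by rewrite /mxtrace big_ord1 trmx_mul !mulmxA.
Qed.

Lemma running_cost_ge0 m p nx nk (G : lti R m p nx) (K : lti R p m nk) v :
  0 <= running_cost G K v.
Proof.
have sq q (u : 'cV[R]_q) : 0 <= (u^T *m u) 0 0.
  by rewrite mxE sumr_ge0// => i _; rewrite mxE -expr2 sqr_ge0.
by rewrite /running_cost -mulmxA -trmx_mul mulmxA -mulmxA mxE addr_ge0.
Qed.

(** The mean cost over [0, T] is the stationary trace plus T^-1 times the integral of the transient,
    which stays bounded in T. *)
Lemma lqg_cost_gramian (d : measure_display) (Omega : measurableType d)
    (P : probability Omega R) m p nx nk (G : lti R m p nx) (K : lti R p m nk)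
    (W : (R -> 'cV[R]_(m + p)) -> Omega -> R) (z : R -> Omega -> 'cV[R]_(nx + nk))
    (Pm : 'M[R]_(nx + nk)) :
  internally_stabilizes G K -> white_noise P W -> closed_loop_response P G K W z ->
  closed_loopA G K *m Pm + Pm *m (closed_loopA G K)^T +
    closed_loopB G K *m (closed_loopB G K)^T = 0 ->
  lqg_cost P G K z (\tr (loop_output G K *m Pm *m (loop_output G K)^T)).
Proof.
move=> hA hW hz hP; set H := loop_output G K.
have [M hM] := response_quadratic hW hz (H^T *m H) hP.
set A := closed_loopA G K in hA hz hP hM.
pose g t := \tr (H^T *m H *m (expmx (t *: A) *m M *m (expmx (t *: A))^T)).
have cg : continuous g by exact: continuous_tr_expmx.
have -> : \tr (H *m Pm *m H^T) = \tr (H^T *m H *m Pm).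
  by rewrite mxtrace_mulC mulmxA.
set J := \tr (H^T *m H *m Pm).
have [c hc] := integral_tr_expmx_bounded (H^T *m H) M hA.
have mX : measurable_fun [set: R * Omega] (fun q => running_cost G K (z q.1 q.2)).
  have -> : (fun q => running_cost G K (z q.1 q.2)) =
    (fun q => \sum_(i < nx + nk) \sum_(j < nx + nk)
       ((H^T *m H) i j * (z q.1 q.2 j 0 * z q.1 q.2 i 0))).
    apply/funext => q; rewrite running_costE -/H; apply: eq_bigr => i _.
    by rewrite mxE; apply: eq_bigr => j _; rewrite !mxE big_ord1 !mxE.
  apply: measurable_sum => i; apply: measurable_sum => j.
  case: hz => mz _.
  by apply: measurable_funM => //; apply: measurable_funM.
have mean T : 0 < T -> mean_cost P G K z T =
    (J + T^-1 * \int[mu]_(t in `[0, T]) g t)%:E.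
  move=> T0; pose q t := J + g t.
  have cq : continuous q by move=> t; apply: (@continuousD _ _ _ (cst J) g); [exact: cst_continuous | exact: cg].
  rewrite /mean_cost (expectation_time_average T0 mX _ cq).
  - congr EFin; have iJ : mu.-integrable `[0, T] (EFin \o cst J).
      by apply: continuous_integrable_itv; exact: cst_continuous.
    have -> : \int[mu]_(t in `[0, T]) q t = J * T + \int[mu]_(t in `[0, T]) g t.
      rewrite (_ : q = fun t => cst J t + g t)// RintegralD//; last exact: continuous_integrable_itv.
      congr (_ + _); rewrite Rintegral_cst//= lebesgue_measure_itv/= lte_fin T0.
      by rewrite -EFinB subr0.
    by rewrite mulrDr (mulrC J) mulKf// gt_eqF.
  - by move=> ?; exact: running_cost_ge0.
  - move=> t /andP[t0 _] /=; under eq_integral do rewrite running_costE -/H.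
    by rewrite hM// mulmxDr mxtraceD.
rewrite /lqg_cost.
have lim : T^-1 * \int[mu]_(t in `[0, T]) g t @[T --> +oo] --> (0 : R).
  apply/cvgrPdist_le => e e0; near=> T.
  have T0 : 0 < T by near: T; exact: nbhs_pinfty_gt.
  have Ti : `|T^-1| = T^-1 by rewrite gtr0_norm// invr_gt0.
  rewrite sub0r normrN normrM Ti mulrC ler_pdivrMr//.
  apply: le_trans (hc T (ltW T0)) _.
  have : c / e <= T by near: T; apply: nbhs_pinfty_ge; rewrite num_real.
  by rewrite ler_pdivrMr// mulrC.
have lim' : (J + T^-1 * \int[mu]_(t in `[0, T]) g t)%:E @[T --> +oo] --> J%:E.
  apply: cvg_EFin; first by apply: nearW => T.
  rewrite -[X in _ --> X]addr0; apply: cvgD; first exact: cvg_cst.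
  exact: lim.
apply: cvg_trans lim'; apply: near_eq_cvg; near=> T.
have T0 : 0 < T by near: T; exact: nbhs_pinfty_gt.
by rewrite mean.
Unshelve. all: by end_near.
Qed.

End NoiseResponse.

(** * Perturbed closed loop *)

Section LoopPerturbation.
Variable R : realType.
Local Notation C := R[i].

(** The Gramian splits over the two noises by linearity, and the output weight over C x and u; the
    four traces are the four squared H2 norms. *)
Lemma lqg_cost_h2 (d : measure_display) (Omega : measurableType d)
    (P : probability Omega R) m p nx nk (G : lti R m p nx) (K : lti R p m nk)
    (W : (R -> 'cV[R]_(m + p)) -> Omega -> R) (z : R -> Omega -> 'cV[R]_(nx + nk)) :
  internally_stabilizes G K -> white_noise P W -> closed_loop_response P G K W z ->
  lqg_cost P G K z
    (h2_norm (tf (loop_wy G K)) ^+ 2 + h2_norm (tf (loop_vy G K)) ^+ 2 +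
     h2_norm (tf (loop_wu G K)) ^+ 2 + h2_norm (tf (loop_vu G K)) ^+ 2).
Proof.
move=> hA hW hz.
have QT q (B : 'M[R]_(nx + nk, q)) : (B *m B^T)^T = B *m B^T by rewrite trmx_mul trmxK.
pose B1 := col_mx (ssB G) (0 : 'M[R]_(nk, m)); pose B2 := col_mx (0 : 'M[R]_(nx, p)) (ssB K).
have [P1 P1T hP1] := lyapunov_solution hA (QT _ B1).
have [P2 P2T hP2] := lyapunov_solution hA (QT _ B2).
have BE : closed_loopB G K *m (closed_loopB G K)^T = B1 *m B1^T + B2 *m B2^T.
  have -> : closed_loopB G K = row_mx B1 B2 by rewrite /closed_loopB block_mxEh.
  by rewrite tr_row_mx mul_row_col.
have hP : closed_loopA G K *m (P1 + P2) + (P1 + P2) *m (closed_loopA G K)^T +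
    closed_loopB G K *m (closed_loopB G K)^T = 0.
  by rewrite BE mulmxDr mulmxDl (addrACA (_ *m P1)) (addrACA _ _ (B1 *m _)) hP1 hP2 addr0.
have := lqg_cost_gramian hA hW hz hP; congr lqg_cost.
rewrite (h2_norm_gramian (S := loop_wy G K) hA P1T hP1) (h2_norm_gramian (S := loop_vy G K) hA P2T hP2).
rewrite (h2_norm_gramian (S := loop_wu G K) hA P1T hP1) (h2_norm_gramian (S := loop_vu G K) hA P2T hP2) /=.
set C1 := row_mx (ssC G) 0; set C2 := row_mx 0 (ssC K).
have -> : loop_output G K = col_mx C1 C2 by rewrite /loop_output block_mxEv.
rewrite mul_col_mx tr_col_mx mul_col_row mxtrace_block !mulmxDr !mulmxDl !mxtraceD.
by rewrite !addrA.
Qed.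

Lemma mxev_unique m n s (A : 'M[{fraction {poly R}}]_(m, n)) V V' :
  mxev s A V -> mxev s A V' -> V = V'.
Proof.
by move=> h h'; apply/matrixP => i j; rewrite -(evrel_ratval (h i j)) (evrel_ratval (h' i j)).
Qed.

Lemma loop_maps_perturbation (F : fieldType) m p (G X Xr : 'M[F]_(p, m))
    (K D Kr Z Zr : 'M[F]_(m, p)) (V Vr : 'M[F]_p) (U Ur : 'M[F]_m) :
  Kr = K + D ->
  let Y := invmx (1%:M - G *m K) in let Yr := invmx (1%:M - G *m Kr) in
  (1%:M - G *m K) \in unitmx -> (1%:M - G *m Kr) \in unitmx ->
  Y = 1%:M + V -> Yr = 1%:M + Vr -> Y *m G = X -> Yr *m G = Xr ->
  K *m (Y *m G) = U -> Kr *m (Yr *m G) = Ur -> K *m Y = Z -> Kr *m Yr = Zr ->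
  [/\ 1%:M + Vr = 1%:M + V + X *m D *m (1%:M + Vr), Xr = X + X *m D *m Xr,
      Zr = Z + (1%:M + U) *m D *m (1%:M + Vr) & Ur = U + (1%:M + U) *m D *m Xr].
Proof.
move=> KrE Y Yr UK UKr <- <- <- <- <- <- <- <-.
by have [] := loop_perturbation KrE (mulVmx UK) (mulmxV UKr).
Qed.

Lemma loop_response_perturbation m p nx nk nkr nd (G : lti R m p nx) (K : lti R p m nk)
    (Kr : lti R p m nkr) (D : lti R p m nd) w :
  hurwitz (closed_loopA G K) -> hurwitz (closed_loopA G Kr) -> hurwitz (ssA D) ->
  tf Kr = tf K + tf D ->
  let X := freqresp (loop_wy G K) w in let Xr := freqresp (loop_wy G Kr) w in
  let Y := 1%:M + freqresp (loop_vy G K) w in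
  let Yr := 1%:M + freqresp (loop_vy G Kr) w in
  let L := 1%:M + freqresp (loop_wu G K) w in let Dw := freqresp D w in
  [/\ Yr = Y + X *m Dw *m Yr, Xr = X + X *m Dw *m Xr,
      freqresp (loop_vu G Kr) w = freqresp (loop_vu G K) w + L *m Dw *m Yr &
      freqresp (loop_wu G Kr) w = freqresp (loop_wu G K) w + L *m Dw *m Xr].
Proof.
move=> hK hKr hD KrE X Xr Y Yr L Dw.
have [U YE XE [_ KXE KYE]] := loop_tf G K.
have [Ur YrE XrE [_ KrXE KrYE]] := loop_tf G Kr.
have [] := loop_maps_perturbation KrE U Ur YE YrE XE XrE KXE KrXE KYE KrYE.
move=> e1 e2 e3 e4.
have eX := mxev_tf_hurwitz (S := loop_wy G K) w hK.
have eXr := mxev_tf_hurwitz (S := loop_wy G Kr) w hKr.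
have eY := mxevD (mxev1 _) (mxev_tf_hurwitz (S := loop_vy G K) w hK).
have eYr := mxevD (mxev1 _) (mxev_tf_hurwitz (S := loop_vy G Kr) w hKr).
have eu := mxev_tf_hurwitz (S := loop_wu G K) w hK.
have eur := mxev_tf_hurwitz (S := loop_wu G Kr) w hKr.
have ev := mxev_tf_hurwitz (S := loop_vu G K) w hK.
have evr := mxev_tf_hurwitz (S := loop_vu G Kr) w hKr.
have eD := mxev_tf_hurwitz w hD.
have eL := mxevD (mxev1 _) eu.
have e1' := mxevD eY (mxevM (mxevM eX eD) eYr).
have e2' := mxevD eX (mxevM (mxevM eX eD) eXr).
have e3' := mxevD ev (mxevM (mxevM eL eD) eYr).
have e4' := mxevD eu (mxevM (mxevM eL eD) eXr).
rewrite -e1 in e1'. rewrite -e2 in e2'. rewrite -e3 in e3'. rewrite -e4 in e4'.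
by split; [exact: mxev_unique eYr e1' | exact: mxev_unique eXr e2'
  | exact: mxev_unique evr e3' | exact: mxev_unique eur e4'].
Qed.

(** V is the strictly proper part of Y. Solving for it gives Vr = (1 - X D)^-1 (V + X D); the extra
    X D is the origin of the terms pairing Delta with the H2 norm of X in S1 and S2. *)
Lemma perturbed_loop_bounds m p (X Xr : 'M[C]_(p, m)) (V Vr : 'M[C]_p)
    (U Ur : 'M[C]_m) (Z Zr D : 'M[C]_(m, p)) (x dl y k : R) :
  0 <= x -> 0 <= dl -> 0 <= y -> 0 <= k -> x * dl < 1 ->
  opbound x X -> opbound dl D -> opbound y (1%:M + V) -> opbound k U ->
  1%:M + Vr = 1%:M + V + X *m D *m (1%:M + Vr) ->
  Xr = X + X *m D *m Xr ->
  Zr = Z + (1%:M + U) *m D *m (1%:M + Vr) ->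
  Ur = U + (1%:M + U) *m D *m Xr ->
  let g := 1 / (1 - x * dl) in
  [/\ fro Xr <= g * fro X, fro Vr <= g * (fro V + dl * fro X),
      fro Ur <= g * (fro U + x * (1 + k) * fro D) &
      fro Zr <= g * (fro Z + y * (1 + k) * fro D)].
Proof.
move=> x0 dl0 y0 k0 xd bX bD bY bU eV eX eZ eU g.
have g01 : 0 <= x * dl < 1 by rewrite mulr_ge0.
have bN : opbound (x * dl) (X *m D) by exact: opboundM.
have NU := Neumann_unit g01 bN; set N := X *m D in eV eX bN NU.
have bI := opbound_Neumann g01 bN (mulmxV NU); rewrite -/g in bI.
(* Lets g also multiply the unperturbed term, so that one factor serves all four bounds. *)
have g1 : 1 <= g by rewrite /g ler_pdivlMr ?subr_gt0// mul1r lerBlDr lerDl mulr_ge0.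
have g0 : 0 <= g by exact: le_trans ler01 g1.
clearbody g.
have solve q (A B : 'M[C]_(p, q)) : A = B + N *m A -> A = invmx (1%:M - N) *m B.
  move=> AE; have -> : B = (1%:M - N) *m A by rewrite mulmxBl mul1mx {1}AE addrK.
  by rewrite mulKmx.
have VE : Vr = invmx (1%:M - N) *m (V + N).
  apply: solve; apply: (@addrI _ 1%:M); rewrite {1}eV mulmxDr mulmx1 !addrA.
  by [].
have bXr : opbound (g * x) Xr by rewrite (solve _ _ _ eX); exact: opboundM.
have bYr : opbound (g * y) (1%:M + Vr) by rewrite (solve _ _ _ eV); exact: opboundM.
have k1 : 0 <= 1 + k by exact: addr_ge0.
have bL : opbound (1 + k) (1%:M + U) by apply: opboundD => //; exact: opbound1.
have tail q c (A : 'M[C]_(m, q)) (B : 'M[C]_(p, q)) : 0 <= c -> opbound (g * c) B ->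
    fro (A + (1%:M + U) *m D *m B) <= g * (fro A + c * (1 + k) * fro D).
  move=> c0 bB; apply: le_trans (froD _ _) _; rewrite mulrDr lerD//.
    by rewrite ler_peMl ?fro_ge0.
  apply: le_trans (opbound_fror _ _ bB) _; first by rewrite mulr_ge0.
  rewrite mulrC -!mulrA ler_wpM2l// ler_wpM2l//.
  exact: opbound_frol.
split.
- by rewrite (solve _ _ _ eX); exact: opbound_frol.
- rewrite VE; apply: le_trans (opbound_frol _ g0 bI) _; rewrite ler_wpM2l//.
  by apply: le_trans (froD _ _) _; rewrite lerD2l mulrC; exact: opbound_fror.
- by rewrite eU; exact: tail.
- by rewrite eZ; exact: tail.
Qed.

End LoopPerturbation.

(** * The cost bound and the conclusion *)

Section PerturbedCost.
Variable R : realType.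

Lemma hinf_norm_return p n (S : lti R p p n) : hurwitz (ssA S) ->
  0 <= hinf_norm (1%:M + tf S) /\
  forall w, opbound (hinf_norm (1%:M + tf S)) (1%:M + freqresp S w).
Proof.
move=> hS; have [c c0 hc] := freqresp_bounded hS.
have fE w : freq (1%:M + tf S) w = 1%:M + freqresp S w.
  by apply: mxev_freq; exact: mxevD (mxev1 _) (mxev_tf_hurwitz w hS).
have hc' w : opbound (1 + c) (freq (1%:M + tf S) w).
  by rewrite fE; apply: opboundD => //; exact: opbound1.
have c1 : 0 <= 1 + c by exact: addr_ge0.
split; first exact: hinf_norm_ge0 c1 hc'.
by move=> w; rewrite -fE; exact: opbound_hinf_norm hc' w.
Qed.

Lemma perturbed_cost_bound m p nx nk nkr nd (G : lti R m p nx) (K : lti R p m nk)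
    (Kr : lti R p m nkr) (D : lti R p m nd) :
  hurwitz (closed_loopA G K) -> hurwitz (closed_loopA G Kr) -> hurwitz (ssA D) ->
  tf Kr = tf K + tf D ->
  let X := tf (loop_wy G K) in let XK := tf (loop_vy G K) in
  let KX := tf (loop_wu G K) in let KY := tf (loop_vu G K) in
  let dl := hinf_norm (tf D) in let h := h2_norm (tf D) in
  let x := hinf_norm X in let y := hinf_norm (1%:M + XK) in let k := hinf_norm KX in
  x * dl < 1 ->
  h2_norm (tf (loop_wy G Kr)) ^+ 2 + h2_norm (tf (loop_vy G Kr)) ^+ 2 +
  h2_norm (tf (loop_wu G Kr)) ^+ 2 + h2_norm (tf (loop_vu G Kr)) ^+ 2 <=
  1 / (1 - x * dl) ^+ 2 *
  (h2_norm X ^+ 2 + h2_norm XK ^+ 2 + h2_norm KX ^+ 2 + h2_norm KY ^+ 2 +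
   (2 * dl * h2_norm X * h2_norm XK +
    2 * h * (h2_norm KY * y + h2_norm KX * x) * (1 + k)) +
   (dl ^+ 2 * h2_norm X ^+ 2 + h ^+ 2 * (y ^+ 2 + x ^+ 2) * (1 + k) ^+ 2)).
Proof.
move=> hK hKr hD KrE X XK KX KY dl h x y k xd.
have [x0 bX] := hinf_norm_tf (S := loop_wy G K) hK.
have [k0 bU] := hinf_norm_tf (S := loop_wu G K) hK.
have [y0 bY] := hinf_norm_return (S := loop_vy G K) hK.
have [dl0 bD] := hinf_norm_tf hD.
rewrite -/X -/x in x0 bX. rewrite -/KX -/k in k0 bU. rewrite -/XK -/y in y0 bY. rewrite -/dl in dl0 bD.
pose g := 1 / (1 - x * dl).
have g0 : 0 <= g by rewrite divr_ge0// subr_ge0 ltW.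
have bounds w := let: And4 eY eX eZ eU := loop_response_perturbation w hK hKr hD KrE in
  perturbed_loop_bounds x0 dl0 y0 k0 xd (bX w) (bD w) (bY w) (bU w) eY eX eZ eU.
have k1 : 0 <= 1 + k by exact: addr_ge0.
(* The null term puts the one-term bound in the two-term form of [h2_norm_minkowski]. *)
have b1 : h2_norm (tf (loop_wy G Kr)) ^+ 2 <= g ^+ 2 * (h2_norm X + 0 * h2_norm X) ^+ 2.
  apply: (@h2_norm_minkowski _ _ _ _ _ _ _ _ _ _ (loop_wy G Kr) (loop_wy G K) (loop_wy G K)) => // w.
  by rewrite mul0r addr0; case: (bounds w).
have b2 : h2_norm (tf (loop_vy G Kr)) ^+ 2 <= g ^+ 2 * (h2_norm XK + dl * h2_norm X) ^+ 2.
  apply: (@h2_norm_minkowski _ _ _ _ _ _ _ _ _ _ (loop_vy G Kr) (loop_vy G K) (loop_wy G K)) => // w.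
  by case: (bounds w).
have b3 : h2_norm (tf (loop_wu G Kr)) ^+ 2 <= g ^+ 2 * (h2_norm KX + x * (1 + k) * h) ^+ 2.
  apply: (@h2_norm_minkowski _ _ _ _ _ _ _ _ _ _ (loop_wu G Kr) (loop_wu G K) D) => //.
    exact: (mulr_ge0 x0 k1).
  by move=> w; case: (bounds w).
have b4 : h2_norm (tf (loop_vu G Kr)) ^+ 2 <= g ^+ 2 * (h2_norm KY + y * (1 + k) * h) ^+ 2.
  apply: (@h2_norm_minkowski _ _ _ _ _ _ _ _ _ _ (loop_vu G Kr) (loop_vu G K) D) => //.
    exact: (mulr_ge0 y0 k1).
  by move=> w; case: (bounds w).
apply: le_trans (lerD (lerD (lerD b1 b2) b3) b4) _.
(* The expanded squares are exactly J + S1 + S2: cross terms form S1, squared perturbations S2. *)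
rewrite /g !div1r exprVn le_eqVlt; apply/orP; left; apply/eqP.
by clear; ring.
Qed.

End PerturbedCost.

(* n1 = nr + nt, n = n1 + n2, r = nr + n2 < n *)
Theorem corollary1 (R : realType) (nx m p nr nt n2 : nat)
  (G : lti R m p nx)
  (K : lti R p m ((nr + nt) + n2))
  (Klt : lti R p m (nr + nt)) (Kge : lti R p m n2)
  (sig : 'rV[R]_(nr + nt)) (Kltr : lti R p m nr) :
  let Kr := parallel Kltr Kge in
  let tG := tf G in
  let tK := tf K in
  let Y := invmx (1%:M - tG *m tK) in
  let X := Y *m tG in
  let Delta := (tf Kltr + tf Kge) - tK in
  let S1 :=
    2 * hinf_norm Delta * h2_norm X * h2_norm (X *m tK)
    + 2 * h2_norm Delta
        * (h2_norm (tK *m Y) * hinf_norm Y + h2_norm (tK *m X) * hinf_norm X)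
        * (1 + hinf_norm (tK *m X)) in
  let S2 :=
    hinf_norm Delta ^+ 2 * h2_norm X ^+ 2
    + h2_norm Delta ^+ 2 * (hinf_norm Y ^+ 2 + hinf_norm X ^+ 2)
        * (1 + hinf_norm (tK *m X)) ^+ 2 in
  (0 < nt)%N ->
  minimal G ->
  minimal K ->
  internally_stabilizes G K ->
  stable_separation K Klt Kge ->
  balanced_truncation Klt sig Kltr ->
  (forall a : R, ~ (eigenvalue (diag_mx (lsubmx sig)) a /\
                    eigenvalue (diag_mx (rsubmx sig)) a)) ->
  \sum_(i < nt) sig 0 (rshift nr i) < 1 / (2 * hinf_norm X) ->
  internally_stabilizes G Kr /\
  forall (d : measure_display) (Omega : measurableType d)
    (P : probability Omega R) (W : (R -> 'cV[R]_(m + p)) -> Omega -> R)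
    (z : R -> Omega -> 'cV[R]_(nx + ((nr + nt) + n2)))
    (zr : R -> Omega -> 'cV[R]_(nx + (nr + n2))),
  white_noise P W ->
  closed_loop_response P G K W z ->
  closed_loop_response P G Kr W zr ->
  exists J Jr : R,
    [/\ lqg_cost P G K z J, lqg_cost P G Kr zr Jr &
        Jr <= 1 / (1 - hinf_norm X * hinf_norm Delta) ^+ 2 * (J + S1 + S2)].
Proof.
move=> Kr tG tK Y X Delta S1 S2 _ _ _ hK [[T TU TK] hlt _] hbt hdisj hsum.
have [U YE XE [XKE KXE KYE]] := loop_tf G K.
have [hltr err] := balanced_truncation_error hlt hbt hdisj.
have tKE : tK = tf Klt + tf Kge by rewrite -tf_parallel -TK tf_change_coordinates.
pose Ksep := parallel Klt Kge.
have hsep : hurwitz (closed_loopA G Ksep).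
  by rewrite /Ksep -TK; exact: closed_loopA_change_coordinates.
have tsep : tf Ksep = tK by rewrite /Ksep -TK tf_change_coordinates.
(* A stable realization of Delta, in which the antistable part has cancelled. *)
pose D := parallel Kltr (neg_output Klt).
have hD : hurwitz (ssA D).
  by apply: hurwitz_block_lower.
have DE : Delta = tf D.
  by rewrite /Delta tKE tf_parallel tf_neg_output opprD addrACA subrr addr0.
have KrE : tf Kr = tK + tf D.
  by rewrite -DE /Delta tf_parallel [RHS]addrC subrK.
have Xsep : tf (loop_wy G Ksep) = tf (loop_wy G K).
  by have [_ _ <- _] := loop_tf G Ksep; rewrite tsep.
have [x0 bX] := hinf_norm_tf (S := loop_wy G Ksep) hsep.
have XE' : X = tf (loop_wy G Ksep) by rewrite Xsep.
rewrite -XE' in x0 bX.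
set e := \sum_(i < nt) _ in hsum err.
have e0 : 0 <= e.
  case: hbt => [? [? [? [? [lam [_ _ [_ sE] _ _]]]]]].
  by apply: sumr_ge0 => i _; rewrite sE mxE sqrtr_ge0.
(* If the norm were 0, the bound 1 / (2 * 0) would be 0 by convention, contradicting a nonnegative
   sum strictly below it. *)
have x1 : 0 < hinf_norm X.
  rewrite lt_neqAle x0 andbT eq_sym; apply: contraTneq hsum => ->.
  by rewrite mulr0 invr0 mulr0 -leNgt.
have freqD w : opbound (2 * e) (freq (tf D) w).
  have -> : freq (tf D) w = freqresp Kltr w - freqresp Klt w.
    apply: mxev_freq; rewrite tf_parallel tf_neg_output.
    exact: mxevD (mxev_tf_hurwitz w hltr) (mxevN (mxev_tf_hurwitz w hlt)).
  exact: err.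
have e20 : 0 <= 2 * e by rewrite mulr_ge0.
have dle : hinf_norm Delta <= 2 * e by rewrite DE; exact: hinf_norm_le.
have xd : hinf_norm X * hinf_norm Delta < 1.
  apply: le_lt_trans (ler_wpM2l x0 dle) _.
  move: hsum x1; move: (hinf_norm X) (e) => a b ab a0.
  have -> : a * (2 * b) = b * (2 * a) by ring.
  by rewrite -ltr_pdivlMr ?mulr_gt0.
have [d0 bD] := hinf_norm_tf hD.
(* X is realized with the separated controller, so that its stable part can be the [Kc] of
   [internally_stabilizes_replace]. *)
have hKr : hurwitz (closed_loopA G Kr).
  have xd' : hinf_norm X * hinf_norm (tf D) < 1 by rewrite -DE.
  have hloop := @small_gain _ _ _ _ _ (loop_wy G Ksep) D _ _ hsep hD x0 d0 xd' bX bD.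
  exact: internally_stabilizes_replace hlt hloop.
split; first exact: hKr.
move=> dd Omega P W z zr hW hz hzr.
have c := lqg_cost_h2 hK hW hz; have cr := lqg_cost_h2 hKr hW hzr.
do 2 eexists; split; [exact: c|exact: cr|].
have := perturbed_cost_bound hK hKr hD KrE; rewrite /S1 /S2; clear S1 S2.
have {}XE : X = tf (loop_wy G K) := XE.
have {}YE : Y = 1%:M + tf (loop_vy G K) := YE.
have {}XKE : X *m tK = tf (loop_vy G K) := XKE.
have {}KXE : tK *m X = tf (loop_wu G K) := KXE.
have {}KYE : tK *m Y = tf (loop_vu G K) := KYE.
move: xd; clearbody Delta X Y tK.
by rewrite XKE KXE KYE DE YE XE => xd /(_ xd).
Qed.
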